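(* Let $X$ be a nonempty completely regular space, $\mu$ a $\sigma$-finite Borel measure on $X$ with support equal to the whole of $X$, $E\ne\{0\}$ a Banach space, and $D=L^1_\mu(X,E)$. Let $A=C(X,L(E))\subset L(D)$ act by multiplication, $(af)(x)=a(x)f(x)$. Let $G$ be a discrete group, $\{t_g\}_{g\in G}$ a group of homeomorphisms of $X$ ($t_{gh}=t_g\circ t_h$) preserving the equivalence class of $\mu$, and let $T_g$ be the isometry of $D$ given by $$(T_gf)(x)=\frac{d\,t_g^{-1}(\mu)}{d\mu}(x)\,f(t_g^{-1}(x)).$$ Let $B(A,T_g)\subset L(D)$ be the algebra generated by $A$ and $\{T_g\}_{g\in G}$ and let $B(\bar A,V_g)$ be the corresponding regular representation in the space $H=l^1(G,L^1_\mu(X,E))$. If $G$ acts topologically freely on $X$, then $$B(A,T_g)\cong B(\bar A,V_g),$$ where the isomorphism is generated by the mappings $a\mapsto\bar a$ ($a\in A$) and $T_g\mapsto V_g$ ($g\in G$); in particular, $B(A,T_g)$ possesses the properties ( * ) and ( ** ) and the property that for every finite $F\subset G$, all $a_g\in A$ and every character $\chi$ of $G$, $\|\sum_{g\in F}a_gT_g\|=\|\sum_{g\in F}a_g\chi(g)T_g\|$.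
   Context: All Banach spaces are complex, completely regular spaces are Hausdorff. $L(E)$ is the algebra of bounded linear operators on $E$; $C(X,B)$ is the space of bounded continuous functions $X\to B$ with the sup norm; $L^1_\mu(X,E)$ is the Bochner space. $t_g^{-1}(\mu)$ denotes the measure $Q\mapsto\mu(t_g^{-1}(Q))$; preserving the equivalence class of $\mu$ means that for each $g\in G$ this measure is absolutely continuous with respect to $\mu$. A character of $G$ is a homomorphism from $G$ to the unit circle. $\hat T_g(a)=T_gaT_g^{-1}$, so $(\hat T_g(a))(x)=a(t_g^{-1}(x))$. $B(A,T_g)$ is the norm closure in $L(D)$ of the finite sums $\sum_{g\in F}a_gT_g$, $a_g\in A$. Regular representation in a space $H$ of $D$-valued functions on $G$: $(V_{g_0}\xi)(g)=\xi(gg_0)$, and for $a\in A$, $(\bar a\xi)(g)=\hat T_g(a)\xi(g)$; $\bar A=\{\bar a:a\in A\}\subset L(H)$; $B(\bar A,V_g)$ is the norm closure in $L(H)$ of the finite sums $\sum\bar a_gV_g$. ''$\cong$'' is isometric isomorphism of Banach algebras. Topologically free action: for every $g\ne e$ the set $\{x\in X:t_g(x)=x\}$ has empty interior. Property ( * ): $\|\sum a_gT_g\|\ge\|a_e\|$ for every finite sum with $a_g\in A$. Then for each $g_0\in G$ the map $N_{g_0}:\sum a_gT_g\mapsto a_{g_0}$ is well defined on finite sums and extends by continuity to $N_{g_0}:B(A,T_g)\to A$. Property ( ** ): ( * ) holds and for $b\in B(A,T_g)$, $b=0$ iff $N_g(b)=0$ for every $g\in G$. *)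

(* Defs.v *)
From HB Require Import structures.
From mathcomp Require Import all_boot all_order all_algebra finmap.
From mathcomp Require Import all_classical all_reals all_analysis.
From mathcomp Require Import measurable_realfun complex.

Set Implicit Arguments.
Unset Strict Implicit.
Unset Printing Implicit Defensive.

Import Order.TTheory GRing.Theory Num.Theory.
Import numFieldNormedType.Exports.

Local Open Scope classical_set_scope.
Local Open Scope complex_scope.
Local Open Scope ring_scope.

(* Norms of normed modules over R[i] take values in R[i]; rnorm is the same
   norm seen in R, so that suprema and integrals can be taken in R. *)
Definition rnorm (R : realType) (V : normedModType R[i]) (v : V) : R :=
  complex.Re `|v|.

Section rnorm_theory.
Context (R : realType) (V : normedModType R[i]).
Implicit Types u v : V.

Lemma rnormE v : (rnorm v)%:C = `|v|.
Proof. by rewrite /rnorm RRe_real ?normr_real. Qed.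

Lemma rnorm_ge0 v : 0 <= rnorm v.
Proof. by rewrite -lecR rnormE; exact: normr_ge0. Qed.

Lemma rnormD u v : rnorm (u + v) <= rnorm u + rnorm v.
Proof. by rewrite -lecR rmorphD/= !rnormE ler_normD. Qed.

Lemma rnormZ (k : R[i]) v : rnorm (k *: v) = rnorm (k : R[i]^o) * rnorm v.
Proof.
apply: (@complexI R); rewrite rmorphM rnormE normrZ; congr (_ * _).
exact/esym/rnormE.
Qed.

Lemma rnorm0 : rnorm (0 : V) = 0.
Proof. by rewrite /rnorm normr0. Qed.

Lemma rnorm_eq0 v : rnorm v = 0 -> v = 0.
Proof. by move=> v0; apply/eqP; rewrite -normr_eq0 -rnormE v0. Qed.

Lemma rnormN v : rnorm (- v) = rnorm v.
Proof. by rewrite /rnorm normrN. Qed.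

End rnorm_theory.

Lemma rnorm_real (R : realType) (r : R) :
  0 <= r -> rnorm (r%:C : R[i]^o) = r.
Proof. by move=> r0; rewrite /rnorm ger0_norm// lecR. Qed.

Section norm_from_real.
Context (R : realType) (V : lmodType R[i]) (n : V -> R).
Hypothesis n_ge0 : forall v, 0 <= n v.
Hypothesis nD : forall u v, n (u + v) <= n u + n v.
Hypothesis nZ : forall (k : R[i]) v, n (k *: v) <= rnorm (k : R[i]^o) * n v.
Hypothesis n_eq0 : forall v, n v = 0 -> v = 0.

Lemma cnormD u v : (n (u + v))%:C <= (n u)%:C + (n v)%:C.
Proof. by rewrite -rmorphD lecR. Qed.

Lemma cnormZ (k : R[i]) v : (n (k *: v))%:C = `|k| * (n v)%:C.
Proof.
have <- : (rnorm (k : R[i]^o))%:C = `|k| by exact: rnormE.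
rewrite -rmorphM/=; congr (_%:C).
apply/eqP; rewrite eq_le nZ /=.
have [->|k0] := eqVneq k 0; first by rewrite rnorm0 mul0r n_ge0.
have kV : rnorm (k : R[i]^o) * rnorm (k^-1 : R[i]^o) = 1.
  rewrite -[LHS](@rnormZ R R[i]^o k) /rnorm -[_ *: _]/(k / k) divff// normr1.
  by [].
rewrite -[in leLHS](scale1r v) -(mulVf k0) -scalerA.
rewrite (le_trans (ler_wpM2l (rnorm_ge0 _) (nZ _ _)))//.
by rewrite mulrA kV mul1r.
Qed.

Lemma cnorm_eq0 v : (n v)%:C = 0 -> v = 0.
Proof. by move=> /complexI /n_eq0. Qed.

End norm_from_real.

(** Bounded linear operators. *)

Section bop.
Context (R : realType).

Definition bounded_linear (V W : normedModType R[i]) (f : V -> W) :=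
  linear f /\ exists M, forall x, rnorm (f x) <= M * rnorm x.

Definition bop_pred (V W : normedModType R[i]) : {pred V -> W} :=
  [pred f | `[< bounded_linear f >]].

Lemma bop_predP (V W : normedModType R[i]) (f : V -> W) :
  reflect (bounded_linear f) (f \in @bop_pred V W).
Proof. exact: asboolP. Qed.

Lemma bop_pred_submod (V W : normedModType R[i]) :
  submod_closed (@bop_pred V W).
Proof.
split.
- apply/bop_predP; split=> [k x y|].
    by rewrite /= !scaler0 addr0.
  by exists 0 => x; rewrite rnorm0 mul0r.
- move=> k f g /bop_predP[lf [M fM]] /bop_predP[lg [N gN]].
  apply/bop_predP; split=> [l x y|].
    rewrite !fctE /= lf lg !scalerDr !scalerA (mulrC l k) addrACA.
    by [].
  exists (rnorm (k : R[i]^o) * M + N) => x.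
  rewrite !fctE (le_trans (rnormD _ _))// mulrDl lerD//.
  by rewrite rnormZ -mulrA ler_wpM2l ?rnorm_ge0.
Qed.

HB.instance Definition _ (V W : normedModType R[i]) :=
  GRing.isSubmodClosed.Build R[i] (V -> W) (@bop_pred V W)
    (@bop_pred_submod V W).

Record bop (V W : normedModType R[i]) :=
  Bop { bop_fun :> V -> W ; _ : bop_fun \in @bop_pred V W }.

HB.instance Definition _ (V W : normedModType R[i]) :=
  [isSub of bop V W for @bop_fun V W].
HB.instance Definition _ (V W : normedModType R[i]) :=
  [Choice of bop V W by <:].
HB.instance Definition _ (V W : normedModType R[i]) :=
  [SubChoice_isSubLmodule of bop V W by <:].

Section opnorm.
Variables V W : normedModType R[i].
Implicit Types f g : bop V W.

Definition opnorm f : R :=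
  sup [set rnorm (f x) | x in [set x | rnorm x <= 1]].

Lemma bopP f : bounded_linear f.
Proof. by apply/bop_predP; case: f. Qed.

Lemma bop_linear f : linear f.
Proof. by case: (bopP f). Qed.

Lemma bop_ext f g : f =1 g -> f = g.
Proof. by move=> fg; apply: val_inj; apply/funext. Qed.

Lemma bopDE f g x : (f + g) x = f x + g x.
Proof. by []. Qed.

Lemma bopZE (k : R[i]) f x : (k *: f) x = k *: f x.
Proof. by []. Qed.

Lemma bop0E x : (0 : bop V W) x = 0.
Proof. by []. Qed.

Lemma bop_at0 f : f 0 = 0.
Proof.
have := bop_linear f (-1) 0 0.
by rewrite scaler0 addr0 scaleN1r addNr.
Qed.

Lemma bop_scale f (k : R[i]) x : f (k *: x) = k *: f x.
Proof. by rewrite -[k *: x]addr0 bop_linear bop_at0 addr0. Qed.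

Lemma bop_add f x y : f (x + y) = f x + f y.
Proof. by rewrite -{1}(scale1r x) bop_linear scale1r. Qed.

Lemma opnorm_nonempty f :
  [set rnorm (f x) | x in [set x | rnorm x <= 1]] !=set0.
Proof. by exists (rnorm (f 0)), 0 => //=; rewrite rnorm0. Qed.

Lemma opnorm_has_ubound f :
  has_ubound [set rnorm (f x) | x in [set x | rnorm x <= 1]].
Proof.
have [_ [M fM]] := bopP f; exists `|M| => _ [x /= x1 <-].
rewrite (le_trans (fM x))// (le_trans (ler_wpM2r (rnorm_ge0 _) (ler_norm M)))//.
by rewrite ler_piMr.
Qed.

Lemma opnorm_ge f x : rnorm x <= 1 -> rnorm (f x) <= opnorm f.
Proof.
by move=> x1; apply: ub_le_sup; [exact: opnorm_has_ubound|exists x].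
Qed.

Lemma opnorm_le f M : (forall x, rnorm x <= 1 -> rnorm (f x) <= M) ->
  opnorm f <= M.
Proof.
move=> fM; apply: ge_sup; first exact: opnorm_nonempty.
by move=> _ [x /= x1 <-]; exact: fM.
Qed.

Lemma opnorm_ge0 f : 0 <= opnorm f.
Proof. by rewrite (le_trans (rnorm_ge0 (f 0)))// opnorm_ge// rnorm0. Qed.

Lemma opnormM f x : rnorm (f x) <= opnorm f * rnorm x.
Proof.
have [/rnorm_eq0 ->|x0] := eqVneq (rnorm x) 0.
  by rewrite bop_at0 !rnorm0 mulr0.
have {}x0 : 0 < rnorm x by rewrite lt_neqAle eq_sym x0 rnorm_ge0.
have nx : rnorm ((rnorm x)^-1%:C *: x) = 1.
  by rewrite rnormZ rnorm_real ?invr_ge0 ?rnorm_ge0// mulVf// gt_eqF.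
have -> : f x = (rnorm x)%:C *: f ((rnorm x)^-1%:C *: x).
  by rewrite -bop_scale scalerA -rmorphM mulfV ?gt_eqF// scale1r.
rewrite rnormZ rnorm_real ?rnorm_ge0// mulrC ler_wpM2r ?rnorm_ge0//.
by rewrite opnorm_ge// nx.
Qed.

Lemma opnormD f g : opnorm (f + g) <= opnorm f + opnorm g.
Proof.
by apply: opnorm_le => x x1; rewrite (le_trans (rnormD _ _))// lerD// opnorm_ge.
Qed.

Lemma opnormZ (k : R[i]) f : opnorm (k *: f) <= rnorm (k : R[i]^o) * opnorm f.
Proof.
apply: opnorm_le => x x1.
by rewrite rnormZ ler_wpM2l ?rnorm_ge0// opnorm_ge.
Qed.

Lemma opnorm_eq0 f : opnorm f = 0 -> f = 0.
Proof.
move=> f0; apply: bop_ext => x; apply: rnorm_eq0; apply/eqP.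
by rewrite eq_le rnorm_ge0 andbT (le_trans (opnormM _ _))// f0 mul0r.
Qed.

HB.instance Definition _ := Lmodule_isNormed.Build R[i] (bop V W)
  (cnormD opnormD) (cnormZ opnorm_ge0 opnormZ) (cnorm_eq0 opnorm_eq0).

Lemma rnorm_bopE f : rnorm f = opnorm f.
Proof. by []. Qed.

End opnorm.

Section bop_ring.
Variable V : normedModType R[i].
Implicit Types f g : bop V V.

Lemma bop_id_subproof : (idfun : V -> V) \in @bop_pred V V.
Proof. by apply/bop_predP; split=> //; exists 1 => x; rewrite mul1r. Qed.

Definition bop_id : bop V V := Bop bop_id_subproof.

Lemma bop_comp_subproof f g : f \o g \in @bop_pred V V.
Proof.
apply/bop_predP; split=> [k x y|]; first by rewrite /= !bop_linear.
exists (opnorm f * opnorm g) => x; rewrite (le_trans (opnormM _ _))// -mulrA.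
by rewrite ler_wpM2l ?opnorm_ge0// opnormM.
Qed.

Definition bop_comp f g : bop V V := Bop (bop_comp_subproof f g).

Lemma bop_compA : associative bop_comp.
Proof. by move=> f g h; exact: bop_ext. Qed.

Lemma bop_comp1f : left_id bop_id bop_comp.
Proof. by move=> f; exact: bop_ext. Qed.

Lemma bop_compf1 : right_id bop_id bop_comp.
Proof. by move=> f; exact: bop_ext. Qed.

Lemma bop_compDl : left_distributive bop_comp +%R.
Proof. by move=> f g h; exact: bop_ext. Qed.

Lemma bop_compDr : right_distributive bop_comp +%R.
Proof. by move=> f g h; apply: bop_ext => x; exact: bop_add. Qed.

HB.instance Definition _ := GRing.Zmodule_isPzRing.Build (bop V V)
  bop_compA bop_comp1f bop_compf1 bop_compDl bop_compDr.

End bop_ring.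
End bop.

(** Bounded continuous functions. *)

Section cbfun.
Context (R : realType) (X : ptopologicalType) (V : normedModType R[i]).

Definition bounded_continuous (a : X -> V) :=
  continuous a /\ exists M, forall x, rnorm (a x) <= M.

Definition cbfun_pred : {pred X -> V} := [pred a | `[< bounded_continuous a >]].

Lemma cbfun_predP a : reflect (bounded_continuous a) (a \in cbfun_pred).
Proof. exact: asboolP. Qed.

Lemma cbfun_pred_submod : submod_closed cbfun_pred.
Proof.
split.
  apply/cbfun_predP; split; first by move=> x; exact: cvg_cst.
  by exists 0 => x; rewrite rnorm0.
move=> k a b /cbfun_predP[ca [M aM]] /cbfun_predP[cb [N bN]].
apply/cbfun_predP; split=> [x|].
  apply: (@cvgD _ _ _ _ _ (fun x => k *: a x) b); last exact: cb.
  by apply: cvgZl_tmp; exact: ca.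
exists (rnorm (k : R[i]^o) * M + N) => x; rewrite (le_trans (rnormD _ _))//.
by rewrite lerD// rnormZ ler_wpM2l ?rnorm_ge0.
Qed.

HB.instance Definition _ :=
  GRing.isSubmodClosed.Build R[i] (X -> V) cbfun_pred cbfun_pred_submod.

Record cbfun := CbFun { cbfun_fun :> X -> V ; _ : cbfun_fun \in cbfun_pred }.

HB.instance Definition _ := [isSub of cbfun for cbfun_fun].
HB.instance Definition _ := [Choice of cbfun by <:].
HB.instance Definition _ := [SubChoice_isSubLmodule of cbfun by <:].

Implicit Types a b : cbfun.

Definition supnorm a : R := sup (range (fun x => rnorm (a x))).

Lemma cbfunP a : bounded_continuous a.
Proof. by apply/cbfun_predP; case: a. Qed.

Lemma cbfun_ext a b : a =1 b -> a = b.
Proof. by move=> ab; apply: val_inj; apply/funext. Qed.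

Lemma supnorm_ge a x : rnorm (a x) <= supnorm a.
Proof.
apply: ub_le_sup; last by exists x.
by have [_ [M aM]] := cbfunP a; exists M => _ [y _ <-].
Qed.

Lemma supnorm_le a M : (forall x, rnorm (a x) <= M) -> supnorm a <= M.
Proof.
move=> aM; apply: ge_sup; first by exists (rnorm (a point)), point.
by move=> _ [x _ <-].
Qed.

Lemma supnorm_ge0 a : 0 <= supnorm a.
Proof. exact: le_trans (rnorm_ge0 _) (supnorm_ge a point). Qed.

Lemma supnormD a b : supnorm (a + b) <= supnorm a + supnorm b.
Proof.
apply: supnorm_le => x; rewrite (le_trans (rnormD _ _))//.
by rewrite lerD// supnorm_ge.
Qed.

Lemma supnormZ (k : R[i]) a : supnorm (k *: a) <= rnorm (k : R[i]^o) * supnorm a.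
Proof.
by apply: supnorm_le => x; rewrite rnormZ ler_wpM2l ?rnorm_ge0// supnorm_ge.
Qed.

Lemma supnorm_eq0 a : supnorm a = 0 -> a = 0.
Proof.
move=> a0; apply: cbfun_ext => x; apply: rnorm_eq0; apply/eqP.
by rewrite eq_le rnorm_ge0 andbT -a0 supnorm_ge.
Qed.

HB.instance Definition _ := Lmodule_isNormed.Build R[i] cbfun
  (cnormD supnormD) (cnormZ supnorm_ge0 supnormZ) (cnorm_eq0 supnorm_eq0).

Lemma rnorm_cbfunE a : rnorm a = supnorm a.
Proof. by []. Qed.

End cbfun.

(** The space of summable families. *)

Section l1fun.
Context (R : realType) (G : choiceType) (V : normedModType R[i]).

Definition esum_norm (xi : G -> V) : \bar R :=
  (\esum_(g in [set: G]) (rnorm (xi g))%:E)%E.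

Lemma esum_norm_ge0 xi : (0 <= esum_norm xi)%E.
Proof. by apply: esum_ge0 => g _; rewrite lee_fin rnorm_ge0. Qed.

Lemma esum_normD (xi eta : G -> V) :
  (esum_norm (xi + eta)%R <= esum_norm xi + esum_norm eta)%E.
Proof.
rewrite -esumD; try by move=> g _; rewrite lee_fin rnorm_ge0.
by apply: le_esum => g _; rewrite -EFinD lee_fin rnormD.
Qed.

Lemma esum_normZ (k : R[i]) (xi : G -> V) :
  (esum_norm (k *: xi)%R <= (rnorm (k : R[i]^o))%:E * esum_norm xi)%E.
Proof.
apply: ge_ereal_sup => _ [F [finF _] <-].
rewrite (eq_fsbigr (fun g => (rnorm (k : R[i]^o))%:E * (rnorm (xi g))%:E)%E); last first.
  by move=> g _; rewrite rnormZ EFinM.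
rewrite -ge0_mule_fsumr; last by move=> g; rewrite lee_fin rnorm_ge0.
rewrite lee_wpmul2l ?lee_fin ?rnorm_ge0//.
by apply: ereal_sup_ubound; exists F.
Qed.

Definition l1fun_pred : {pred G -> V} := [pred xi | `[< (esum_norm xi < +oo)%E >]].

Lemma l1fun_predP xi : reflect (esum_norm xi < +oo)%E (xi \in l1fun_pred).
Proof. exact: asboolP. Qed.

Lemma l1fun_pred_submod : submod_closed l1fun_pred.
Proof.
split.
  apply/l1fun_predP; rewrite /esum_norm esum1 ?ltry// => g _.
  by rewrite rnorm0.
move=> k xi eta /l1fun_predP xi1 /l1fun_predP eta1; apply/l1fun_predP.
apply: le_lt_trans (esum_normD _ _) _; rewrite lte_add_pinfty//.
apply: le_lt_trans (esum_normZ _ _) _.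
by rewrite lte_mul_pinfty// ?lee_fin ?rnorm_ge0.
Qed.

HB.instance Definition _ :=
  GRing.isSubmodClosed.Build R[i] (G -> V) l1fun_pred l1fun_pred_submod.

Record l1fun := L1Fun { l1fun_fun :> G -> V ; _ : l1fun_fun \in l1fun_pred }.

HB.instance Definition _ := [isSub of l1fun for l1fun_fun].
HB.instance Definition _ := [Choice of l1fun by <:].
HB.instance Definition _ := [SubChoice_isSubLmodule of l1fun by <:].

Implicit Types xi eta : l1fun.

Definition l1norm xi : R := fine (esum_norm xi).

Lemma l1funP xi : (esum_norm xi < +oo)%E.
Proof. by apply/l1fun_predP; case: xi. Qed.

Lemma l1fun_ext xi eta : xi =1 eta -> xi = eta.
Proof. by move=> e; apply: val_inj; apply/funext. Qed.

Lemma l1normE xi : (l1norm xi)%:E = esum_norm xi.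
Proof. by rewrite fineK// ge0_fin_numE ?esum_norm_ge0// l1funP. Qed.

Lemma l1norm_ge0 xi : 0 <= l1norm xi.
Proof. by rewrite -lee_fin l1normE esum_norm_ge0. Qed.

Lemma l1normD xi eta : l1norm (xi + eta) <= l1norm xi + l1norm eta.
Proof. by rewrite -lee_fin EFinD !l1normE; exact: esum_normD. Qed.

Lemma l1normZ (k : R[i]) xi : l1norm (k *: xi) <= rnorm (k : R[i]^o) * l1norm xi.
Proof. by rewrite -lee_fin EFinM !l1normE; exact: esum_normZ. Qed.

Lemma l1norm_ge xi g : rnorm (xi g) <= l1norm xi.
Proof.
rewrite -lee_fin l1normE; apply: esum_ge; exists [set g].
  by split => //; exact: finite_set1.
by rewrite fsbig_set1.
Qed.

Lemma l1norm_eq0 xi : l1norm xi = 0 -> xi = 0.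
Proof.
move=> xi0; apply: l1fun_ext => g; apply: rnorm_eq0; apply/eqP.
by rewrite eq_le rnorm_ge0 andbT -xi0 l1norm_ge.
Qed.

HB.instance Definition _ := Lmodule_isNormed.Build R[i] l1fun
  (cnormD l1normD) (cnormZ l1norm_ge0 l1normZ) (cnorm_eq0 l1norm_eq0).

Lemma rnorm_l1funE xi : rnorm xi = l1norm xi.
Proof. by []. Qed.

End l1fun.

(** Bochner space. *)

Section strongly_measurable.
Context d (T : measurableType d).

Definition simple_fun (V : Type) (s : T -> V) :=
  finite_set (range s) /\ forall v, measurable (s @^-1` [set v]).

Lemma simple_preimage (V : Type) (s : T -> V) (Y : set V) :
  simple_fun s -> measurable (s @^-1` Y).
Proof.
move=> [fs ms].
rewrite (_ : _ @^-1` _ = \bigcup_(v in range s `&` Y) (s @^-1` [set v])).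
  by apply: fin_bigcup_measurable => //; exact: finite_setIl.
apply/seteqP; split=> [x Yx|x [v [_ Yv] /= ->]//].
by exists (s x) => //; split => //; exists x.
Qed.

Lemma simple_fun_cst (V : Type) (v : V) : simple_fun (fun=> v).
Proof.
split=> [|w]; first by apply: sub_finite_set (finite_set1 v) => _ [x _ <-].
rewrite preimage_cst; case: ifP => _; [exact: measurableT|exact: measurable0].
Qed.

Lemma simple_fun_comp (U V : Type) (op : U -> V) (s : T -> U) :
  simple_fun s -> simple_fun (op \o s).
Proof.
move=> ss; split=> [|v]; last by rewrite comp_preimage; exact: simple_preimage.
apply: sub_finite_set (finite_image op ss.1) => _ [x _ <-].
by exists (s x) => //; exists x.
Qed.

Lemma simple_fun_pair (U V : Type) (s : T -> U) (s' : T -> V) :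
  simple_fun s -> simple_fun s' -> simple_fun (fun x => (s x, s' x)).
Proof.
move=> ss ss'; split=> [|[u v]].
  apply: sub_finite_set (finite_setX ss.1 ss'.1) => _ [x _ <-].
  by split; exists x.
rewrite (_ : _ @^-1` _ = (s @^-1` [set u]) `&` (s' @^-1` [set v])).
  by apply: measurableI; exact: simple_preimage.
by apply/seteqP; split=> [x [<- <-]//|x [/= -> ->]].
Qed.

Lemma simple_fun2 (U V W : Type) (op : U -> V -> W) (s : T -> U) (s' : T -> V) :
  simple_fun s -> simple_fun s' -> simple_fun (fun x => op (s x) (s' x)).
Proof.
by move=> ss ss'; have := simple_fun_comp (uncurry op) (simple_fun_pair ss ss').
Qed.

(* The approximating simple functions converge at every point and not merely
   almost everywhere; as every almost everywhere class of Bochner measurable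
   functions has such a representative, the space L1 below is the same. *)
Definition strongly_measurable (V : topologicalType) (f : T -> V) :=
  exists2 s : nat -> T -> V,
    (forall n, simple_fun (s n)) & forall x, s n x @[n --> \oo] --> f x.

Lemma strongly_measurable2 (U V W : topologicalType) (op : U -> V -> W)
    (f : T -> U) (g : T -> V) :
  (forall u v, {for (u, v), continuous (fun z : U * V => op z.1 z.2)}) ->
  strongly_measurable f -> strongly_measurable g ->
  strongly_measurable (fun x => op (f x) (g x)).
Proof.
move=> cop [s ss sf] [s' ss' sg]; exists (fun n x => op (s n x) (s' n x)).
  by move=> n; exact: simple_fun2.
move=> x; apply: (@continuous2_cvg _ _ _ _ _ _ (s^~ x) (s'^~ x)) => //.
exact: cop.
Qed.

Lemma strongly_measurable_comp (U V : topologicalType) (op : U -> V)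
    (f : T -> U) : continuous op ->
  strongly_measurable f -> strongly_measurable (op \o f).
Proof.
move=> cop [s ss sf]; exists (fun n => op \o s n).
  by move=> n; exact: simple_fun_comp.
by move=> x; apply: continuous_cvg; [exact: cop|exact: sf].
Qed.

Lemma strongly_measurable_cst (V : topologicalType) (v : V) :
  strongly_measurable (fun=> v).
Proof.
by exists (fun _ _ => v) => [n|x]; [exact: simple_fun_cst|exact: cvg_cst].
Qed.

Lemma strongly_measurable_real (R : realType) (f : T -> R) :
  strongly_measurable f -> measurable_fun [set: T] f.
Proof.
move=> [s ss sf]; apply: (@measurable_fun_cvg _ _ _ _ s) => //.
by move=> n _ Y mY; rewrite setTI; exact: simple_preimage.
Qed.

End strongly_measurable.

Lemma rnorm_continuous (R : realType) (V : normedModType R[i]) :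
  continuous (@rnorm R V : V -> R).
Proof.
move=> v; apply/cvgrPdist_lt => e e0.
have := @nbhsx_ballx _ _ v e%:C; rewrite ltcR e0 => /(_ isT).
apply: filterS => w; rewrite -ball_normE /= -rnormE ltcR; apply: le_lt_trans.
rewrite ler_norml; apply/andP; split.
  rewrite lerBrDr addrC lerBlDr -(rnormN (v - w)) opprB.
  by rewrite addrC -{1}(subrK v w) rnormD.
by rewrite lerBlDr -{1}(subrK w v) rnormD.
Qed.

Section bochner.
Context d (T : measurableType d) (R : realType).
Variables (mu : {measure set T -> \bar R}) (E : normedModType R[i]).

Definition int_norm (f : T -> E) : \bar R := (\int[mu]_x (rnorm (f x))%:E)%E.

Definition bochner_integrable (f : T -> E) :=
  strongly_measurable f /\ (int_norm f < +oo)%E.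

Lemma measurable_rnorm (f : T -> E) : strongly_measurable f ->
  measurable_fun [set: T] (fun x => (rnorm (f x))%:E).
Proof.
move=> mf; apply/measurable_EFinP; apply: strongly_measurable_real.
exact: (strongly_measurable_comp (@rnorm_continuous R E) mf).
Qed.

Lemma int_norm_ge0 f : (0 <= int_norm f)%E.
Proof. by apply: integral_ge0 => x _; rewrite lee_fin rnorm_ge0. Qed.

Lemma strongly_measurableD (f g : T -> E) :
  strongly_measurable f -> strongly_measurable g -> strongly_measurable (f + g).
Proof.
apply: (@strongly_measurable2 _ _ _ _ _ (fun u v : E => u + v)) => u v.
exact: add_continuous.
Qed.

Lemma strongly_measurableZ (k : R[i]) (f : T -> E) :
  strongly_measurable f -> strongly_measurable (k *: f).
Proof.
apply: (@strongly_measurable_comp _ _ _ _ (fun v : E => k *: v)) => v.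
exact: scaler_continuous.
Qed.

Lemma int_normD f g : strongly_measurable f -> strongly_measurable g ->
  (int_norm (f + g)%R <= int_norm f + int_norm g)%E.
Proof.
move=> mf mg; rewrite -ge0_integralD//; last 4 first.
- by move=> x _; rewrite lee_fin rnorm_ge0.
- exact: measurable_rnorm.
- by move=> x _; rewrite lee_fin rnorm_ge0.
- exact: measurable_rnorm.
apply: ge0_le_integral => //.
- by move=> x _; rewrite lee_fin rnorm_ge0.
- by apply: measurable_rnorm; exact: strongly_measurableD.
- by apply: emeasurable_funD; exact: measurable_rnorm.
- by move=> x _; rewrite -EFinD lee_fin rnormD.
Qed.

Lemma int_normZ (k : R[i]) f : strongly_measurable f ->
  (int_norm (k *: f)%R = (rnorm (k : R[i]^o))%:E * int_norm f)%E.
Proof.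
move=> mf; rewrite -ge0_integralZl_EFin ?rnorm_ge0//; last 2 first.
- by move=> x _; rewrite lee_fin rnorm_ge0.
- exact: measurable_rnorm.
by apply: eq_integral => x _; rewrite -EFinM -rnormZ.
Qed.

Definition bochner_pred : {pred T -> E} := [pred f | `[< bochner_integrable f >]].

Lemma bochner_predP f : reflect (bochner_integrable f) (f \in bochner_pred).
Proof. exact: asboolP. Qed.

Lemma bochner_pred_submod : submod_closed bochner_pred.
Proof.
split.
  apply/bochner_predP; split; first exact: strongly_measurable_cst.
  rewrite /int_norm; under eq_integral do rewrite rnorm0.
  by rewrite integral0 ltry.
move=> k f g /bochner_predP[mf f1] /bochner_predP[mg g1]; apply/bochner_predP.
have mkf := strongly_measurableZ k mf.
split; first exact: strongly_measurableD.
apply: le_lt_trans (int_normD mkf mg) _; rewrite lte_add_pinfty// int_normZ//.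
by rewrite lte_mul_pinfty// lee_fin rnorm_ge0.
Qed.

HB.instance Definition _ :=
  GRing.isSubmodClosed.Build R[i] (T -> E) bochner_pred bochner_pred_submod.

Record bochner :=
  Bochner { bochner_fun :> T -> E ; _ : bochner_fun \in bochner_pred }.

HB.instance Definition _ := [isSub of bochner for bochner_fun].
HB.instance Definition _ := [Choice of bochner by <:].
HB.instance Definition _ := [SubChoice_isSubLmodule of bochner by <:].

Lemma bochnerP (f : bochner) : bochner_integrable f.
Proof. by apply/bochner_predP; case: f. Qed.

Definition bochner_eq (f g : bochner) : bool := `[< ae_eq mu [set: T] f g >].

Lemma bochner_eq_refl : reflexive bochner_eq.
Proof. by move=> f; apply/asboolP; exact: ae_eq_refl. Qed.

Lemma bochner_eq_sym : symmetric bochner_eq.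
Proof.
by move=> f g; apply/idP/idP => /asboolP fg; apply/asboolP; exact: ae_eq_sym.
Qed.

Lemma bochner_eq_trans : transitive bochner_eq.
Proof.
move=> g f h /asboolP fg /asboolP gh; apply/asboolP.
exact: ae_eq_trans fg gh.
Qed.

Canonical bochner_equiv :=
  EquivRel bochner_eq bochner_eq_refl bochner_eq_sym bochner_eq_trans.

Local Open Scope quotient_scope.

Definition L1 : Type := {eq_quot bochner_eq}.
HB.instance Definition _ := Choice.on L1.
HB.instance Definition _ := EqQuotient.on L1.

Definition L1_fun (u : L1) : T -> E := repr u.
Coercion L1_fun : L1 >-> Funclass.

Lemma L1_piP (f g : bochner) : \pi_L1 f = \pi_L1 g <-> ae_eq mu [set: T] f g.
Proof. by split=> [/eqquotP/asboolP//|fg]; apply/eqquotP/asboolP. Qed.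

Lemma L1_reprK (f : bochner) : ae_eq mu [set: T] (\pi_L1 f : L1) f.
Proof. by apply/L1_piP; rewrite reprK. Qed.

Lemma L1_eqP (u v : L1) : u = v <-> ae_eq mu [set: T] u v.
Proof. by rewrite -{1}(reprK u) -{1}(reprK v) L1_piP. Qed.

Lemma L1P (u : L1) : bochner_integrable u.
Proof. exact: bochnerP. Qed.

Definition L1_zero : L1 := \pi_L1 (0 : bochner).
Definition L1_add (u v : L1) : L1 := \pi_L1 (repr u + repr v).
Definition L1_opp (u : L1) : L1 := \pi_L1 (- repr u).
Definition L1_scale (k : R[i]) (u : L1) : L1 := \pi_L1 (k *: repr u).

Lemma L1_pi_add (f g : bochner) : L1_add (\pi_L1 f) (\pi_L1 g) = \pi_L1 (f + g).
Proof.
apply/L1_piP; apply: (filterS2 _ _ (L1_reprK f) (L1_reprK g)) => x fx gx _.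
by rewrite /= -[LHS]/(L1_fun (\pi_L1 f) x + L1_fun (\pi_L1 g) x) fx ?gx.
Qed.

Lemma L1_pi_opp (f : bochner) : L1_opp (\pi_L1 f) = \pi_L1 (- f).
Proof.
apply/L1_piP; apply: (filterS _ (L1_reprK f)) => x fx _.
by rewrite /= -[LHS]/(- L1_fun (\pi_L1 f) x) fx.
Qed.

Lemma L1_pi_scale k (f : bochner) : L1_scale k (\pi_L1 f) = \pi_L1 (k *: f).
Proof.
apply/L1_piP; apply: (filterS _ (L1_reprK f)) => x fx _.
by rewrite /= -[LHS]/(k *: L1_fun (\pi_L1 f) x) fx.
Qed.

Lemma L1W (P : L1 -> Prop) : (forall f, P (\pi_L1 f)) -> forall u, P u.
Proof. by move=> Pf u; rewrite -(reprK u); exact: Pf. Qed.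

Lemma L1_addA : associative L1_add.
Proof.
move=> u v w; elim/L1W: u => f; elim/L1W: v => g; elim/L1W: w => h.
by rewrite !L1_pi_add addrA.
Qed.

Lemma L1_addC : commutative L1_add.
Proof. by move=> u v; elim/L1W: u => f; elim/L1W: v => g; rewrite !L1_pi_add addrC. Qed.

Lemma L1_add0 : left_id L1_zero L1_add.
Proof. by move=> u; elim/L1W: u => f; rewrite L1_pi_add add0r. Qed.

Lemma L1_addN : left_inverse L1_zero L1_opp L1_add.
Proof. by move=> u; elim/L1W: u => f; rewrite L1_pi_opp L1_pi_add addNr. Qed.

HB.instance Definition _ :=
  GRing.isZmodule.Build L1 L1_addA L1_addC L1_add0 L1_addN.

Lemma L1_scaleA k l u : L1_scale k (L1_scale l u) = L1_scale (k * l) u.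
Proof. by elim/L1W: u => f; rewrite !L1_pi_scale scalerA. Qed.

Lemma L1_scale1 : left_id 1 L1_scale.
Proof. by move=> u; elim/L1W: u => f; rewrite L1_pi_scale scale1r. Qed.

Lemma L1_scaleDr : right_distributive L1_scale +%R.
Proof.
move=> k u v; elim/L1W: u => f; elim/L1W: v => g.
rewrite -[_ + _]/(L1_add _ _) -[RHS]/(L1_add _ _).
by rewrite !(L1_pi_add, L1_pi_scale) scalerDr.
Qed.

Lemma L1_scaleDl u : {morph L1_scale^~ u : k l / k + l}.
Proof.
elim/L1W: u => f k l; rewrite -[RHS]/(L1_add _ _).
by rewrite !(L1_pi_add, L1_pi_scale) scalerDl.
Qed.

HB.instance Definition _ := GRing.Zmodule_isLmodule.Build R[i] L1
  L1_scaleA L1_scale1 L1_scaleDr L1_scaleDl.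

Lemma L1DE (u v : L1) : ae_eq mu [set: T] (u + v : L1) (fun x => u x + v x).
Proof. exact: L1_reprK. Qed.

Lemma L1ZE (k : R[i]) (u : L1) :
  ae_eq mu [set: T] (k *: u : L1) (fun x => k *: u x).
Proof. exact: L1_reprK. Qed.

Lemma L10E : ae_eq mu [set: T] (0 : L1) (fun=> 0).
Proof. exact: L1_reprK. Qed.

Lemma ae_eq_int_norm (f g : T -> E) :
  strongly_measurable f -> strongly_measurable g ->
  ae_eq mu [set: T] f g -> int_norm f = int_norm g.
Proof.
move=> mf mg fg; apply: ge0_ae_eq_integral => //.
- exact: measurable_rnorm.
- exact: measurable_rnorm.
- by move=> x _; rewrite lee_fin rnorm_ge0.
- by move=> x _; rewrite lee_fin rnorm_ge0.
by apply: filterS fg => x fgx _; rewrite fgx.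
Qed.

Definition L1norm (u : L1) : R := fine (int_norm u).

Lemma L1normE u : (L1norm u)%:E = int_norm u.
Proof. by rewrite fineK// ge0_fin_numE ?int_norm_ge0//; case: (L1P u). Qed.

Lemma L1norm_ge0 u : 0 <= L1norm u.
Proof. by rewrite -lee_fin L1normE int_norm_ge0. Qed.

Lemma L1normD u v : L1norm (u + v) <= L1norm u + L1norm v.
Proof.
have [[mu_ _] [mv _]] := (L1P u, L1P v).
rewrite -lee_fin EFinD !L1normE (le_trans _ (int_normD mu_ mv))//.
rewrite (ae_eq_int_norm _ _ (L1DE u v))//; first by case: (L1P (u + v)).
exact: strongly_measurableD.
Qed.

Lemma L1normZ (k : R[i]) u : L1norm (k *: u) <= rnorm (k : R[i]^o) * L1norm u.
Proof.
have [mu_ _] := L1P u.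
rewrite -lee_fin EFinM !L1normE -int_normZ//.
rewrite (ae_eq_int_norm _ _ (L1ZE k u))//; first by case: (L1P (k *: u)).
exact: strongly_measurableZ.
Qed.

Lemma L1norm_eq0 u : L1norm u = 0 -> u = 0.
Proof.
move=> u0; have {}u0 : int_norm u = 0%E by rewrite -L1normE u0.
apply/L1_eqP.
have mu_ : measurable_fun setT (fun x => (rnorm (u x))%:E).
  by apply: measurable_rnorm; case: (L1P u).
have h : (\int[mu]_x `|(rnorm (u x))%:E| = 0)%E.
  rewrite -[RHS]u0; apply: eq_integral => x _.
  by rewrite gee0_abs// lee_fin rnorm_ge0.
have aeu := (ae_eq_integral_abs mu measurableT mu_).1 h.
apply: (ae_eq_trans _ (ae_eq_sym L10E)); apply: filterS aeu => x ux _.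
by have [] := ux I => /rnorm_eq0.
Qed.

HB.instance Definition _ := Lmodule_isNormed.Build R[i] L1
  (cnormD L1normD) (cnormZ L1norm_ge0 L1normZ) (cnorm_eq0 L1norm_eq0).

Lemma rnorm_L1E u : rnorm u = L1norm u.
Proof. by []. Qed.

End bochner.

Notation borel X := (g_sigma_algebraType (@open X)).

(* Total versions of the constructors: the operator (class, family) defined by
   a formula, and 0 when the formula does not define one. *)
Definition mkop (R : realType) (V W : normedModType R[i]) (f : V -> W) :
  bop V W := insubd 0 f.

Definition mkL1 d (T : measurableType d) (R : realType)
    (mu : {measure set T -> \bar R}) (E : normedModType R[i]) (f : T -> E) :
  L1 mu E := (\pi_(L1 mu E) (insubd 0 f : bochner mu E))%qT.

Definition mkl1 (R : realType) (G : choiceType) (V : normedModType R[i])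
  (xi : G -> V) : l1fun G V := insubd 0 xi.

Definition op_inv (R : realType) (V : normedModType R[i]) (f : bop V V) :
  bop V V := xget 0 [set h | f * h = 1 /\ h * f = 1].

(* The density is only determined almost everywhere.  The library's
   Radon-Nikodym derivative is not used because it needs nu to be finite. *)
Definition rn_derivative d (T : measurableType d) (R : realType)
    (nu mu : set T -> \bar R) : T -> R :=
  xget (cst 0) [set rho : T -> R | [/\ measurable_fun [set: T] rho,
    forall x, 0 <= rho x &
    forall Q, measurable Q -> nu Q = (\int[mu]_(x in Q) (rho x)%:E)%E]].

Section dynamics.
Context (X : topologicalType) (G : groupType).

Definition homeomorphism (f : X -> X) :=
  exists h : X -> X, [/\ cancel f h, cancel h f, continuous f & continuous h].

Definition homeo_action (t : G -> X -> X) :=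
  (forall g, homeomorphism (t g)) /\ (forall g h, t (g * h)%g = t g \o t h).

Definition topologically_free (t : G -> X -> X) :=
  forall g, g != 1%g -> [set x | t g x = x]^° = set0.

End dynamics.

Section borel_measure.
Context (R : realType) (X : ptopologicalType).
Variable mu : set (borel X) -> \bar R.

Definition measure_support : set X :=
  [set x | forall U : set X, open U -> U x -> (0 < mu U)%E].

Definition preserves_class (G : groupType) (t : G -> X -> X) :=
  forall g, pushforward mu (t g : borel X -> borel X) `<< mu.

End borel_measure.

Definition reg_op (R : realType) (G : groupType) (V : normedModType R[i])
    (g0 : G) : bop (l1fun G V) (l1fun G V) :=
  mkop (fun xi : l1fun G V => mkl1 (fun g => xi (g * g0)%g)).

Section operators.
Context (R : realType) (X : ptopologicalType) (E : normedModType R[i]).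
Context (G : groupType).
Variables (mu : {measure set (borel X) -> \bar R}) (t : G -> X -> X).

Local Notation D := (L1 mu E).
Local Notation A := (cbfun X (bop E E)).
Local Notation H := (l1fun G D).

Definition mult_op (a : A) : bop D D :=
  mkop (fun f : D => mkL1 mu (fun x => a x (f x))).

Definition translation_op (g : G) : bop D D :=
  mkop (fun f : D => mkL1 mu (fun x =>
    (rn_derivative (pushforward mu (t g : borel X -> borel X)) mu x)%:C *:
      f (t g^-1%g x))).

Definition hat_op (g : G) (b : bop D D) : bop D D :=
  translation_op g * b * op_inv (translation_op g).

Definition bar_op (a : A) : bop H H :=
  mkop (fun xi : H => mkl1 (fun g => hat_op g (mult_op a) (xi g))).

End operators.
Arguments reg_op {R} G V g0.
Arguments mult_op {R X} E mu a.
Arguments translation_op {R X} E {G} mu t g.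
Arguments bar_op {R X} E {G} mu t a.

Section generated_algebra.
Context (R : realType) (G : groupType) (A V : normedModType R[i]).
Variables (rep : A -> bop V V) (U : G -> bop V V).

Definition fin_sum (F : {fset G}) (a : G -> A) : bop V V :=
  \sum_(g <- F) rep (a g) * U g.

Definition gen_alg : set (bop V V) :=
  closure [set b | exists F a, b = fin_sum F a].

Definition property_star :=
  forall (F : {fset G}) (a : G -> A), (1%g \in F) ->
    `|a 1%g| <= `|fin_sum F a|.

Definition coefficient_maps (N : G -> bop V V -> A) :=
  forall g, {within gen_alg, continuous (N g)} /\
    forall (F : {fset G}) (a : G -> A),
      N g (fin_sum F a) = if g \in F then a g else 0.

Definition property_star_star :=
  property_star /\ exists N, coefficient_maps N /\
    forall b, gen_alg b -> (b = 0 <-> forall g, N g b = 0).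

Definition character (chi : G -> R[i]) :=
  (forall g, `|chi g| = 1) /\ (forall g h, chi (g * h)%g = chi g * chi h).

Definition character_invariant :=
  forall (F : {fset G}) (a : G -> A) chi, character chi ->
    `|fin_sum F a| = `|\sum_(g <- F) rep (a g) * (chi g *: U g)|.

End generated_algebra.

Definition isometric_alg_iso (R : realType) (V W : normedModType R[i])
    (B : set (bop V V)) (C : set (bop W W)) (Phi : bop V V -> bop W W) :=
  [/\ set_bij B C Phi,
      (forall (k : R[i]) b c, B b -> B c -> Phi (k *: b + c) = k *: Phi b + Phi c),
      (forall b c, B b -> B c -> Phi (b * c) = Phi b * Phi c) &
      (forall b, B b -> `|Phi b| = `|b|)].

(* Main.v *)
Require Import Defs.
From mathcomp Require Import all_boot all_order all_algebra finmap.
From mathcomp Require Import all_classical all_reals all_analysis complex.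
From mathcomp Require Import measurable_realfun ring lra.
Import Order.TTheory GRing.Theory Num.Theory.
Import numFieldNormedType.Exports.

Local Open Scope classical_set_scope.
Local Open Scope ring_scope.

(** Write [c g] for the function [a g] moved to the fibre over [y], that is
    [a g (t g y)].  A finite sum of the [a g * T g] has norm at most [C] exactly
    when the norms of the vectors [c g e] add up to at most [C * |e|] for all [y]
    and [e].  Sufficiency is integration over [y], since [a g * T g] equals [T g]
    times a multiplication by [c g] and [T g] is isometric.  For necessity,
    topological freeness gives, near any point, a nonempty open set whose finitely
    many translates are disjoint; on a function carried by it the summands have
    disjoint supports and the L1 norm is additive.  The same condition controls the
    regular representation, so both algebras are completions of the same normed
    algebra of finite sums.  The fibre condition is visibly monotone in the
    coefficients and blind to unimodular factors, which gives the remaining claims. *)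

Set Implicit Arguments.
Unset Strict Implicit.
Unset Printing Implicit Defensive.

Local Open Scope complex_scope.

(** The space [X] need not be separable, so it is not evident that a continuous coefficient sends
    strongly measurable functions to strongly measurable ones. Full support of a sigma-finite
    measure supplies this: a disjoint family of nonempty open sets is countable, hence every
    continuous map from [X] to a normed space has separable range.

    A finite sum does not visibly remember its coefficients, so correspondences between sums are
    kept as linear relations. A contractive linear relation is single valued, and its closure is
    again contractive, and defined on the whole closure of the domain once the target is complete.
    The isomorphism and the coefficient maps are both obtained in this way.

    Continuity of the coefficient maps alone does not give [property_star_star]. The proof compares
    an approximant of an operator with vanishing coefficients to a much finer second one, whose
    coefficients on the finite support of the first are tiny. The difference of the two is small in
    norm, and discarding its terms off that support keeps the fibre condition, so the first
    approximant is itself small. *)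

(** * Topology and approximation in terms of the real-valued norm *)

Section rnorm_topology.
Context (R : realType) (V : normedModType R[i]).
Implicit Types (u v w : V) (S : set V).

Lemma rnorm_sub_sym u v : rnorm (u - v) = rnorm (v - u).
Proof. by rewrite -rnormN opprB. Qed.

Lemma rnorm_triangle w u v : rnorm (u - v) <= rnorm (u - w) + rnorm (w - v).
Proof. by rewrite (le_trans _ (rnormD _ _))// addrA subrK. Qed.

Lemma rnorm_sum (I : Type) (r : seq I) (P : pred I) (f : I -> V) :
  rnorm (\sum_(i <- r | P i) f i) <= \sum_(i <- r | P i) rnorm (f i).
Proof.
elim/big_ind2 : _ => //; first by rewrite rnorm0.
by move=> x y z t xy zt; rewrite (le_trans (rnormD _ _))// lerD.
Qed.

Lemma eq_of_rnorm u v : (forall e, 0 < e -> rnorm (u - v) <= e) -> u = v.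
Proof.
move=> uv; apply/eqP; rewrite -subr_eq0; apply/eqP/rnorm_eq0/eqP.
rewrite eq_le rnorm_ge0 andbT; apply/ler_addgt0Pr => e e0.
by rewrite add0r uv.
Qed.

Lemma complex_gt0 (e : R[i]) : 0 < e -> 0 < complex.Re e /\ e = (complex.Re e)%:C.
Proof.
move=> e0; have er : e \is Num.real by rewrite ger0_real// ltW.
by rewrite -ltcR RRe_real.
Qed.

Lemma nbhs_rnormP (x : V) S :
  nbhs x S <-> exists2 e : R, 0 < e & forall y, rnorm (x - y) < e -> S y.
Proof.
split.
  move=> /nbhs_ballP[e /= e0 eS]; have [r0 er] := complex_gt0 e0.
  exists (complex.Re e) => // y xy; apply: eS.
  by rewrite -ball_normE /= er -rnormE ltcR.
move=> [e e0 eS]; apply/nbhs_ballP; exists e%:C => /=; first by rewrite ltcR.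
by move=> y; rewrite -ball_normE /= -rnormE ltcR; exact: eS.
Qed.

Lemma near_rnorm v (e : R) : 0 < e -> \forall w \near v, rnorm (v - w) < e.
Proof. by move=> e0; apply/nbhs_rnormP; exists e. Qed.

Lemma cvg_rnormP (T : Type) (F : set_system T) (FF : Filter F) (f : T -> V) v :
  f @ F --> v <-> forall e : R, 0 < e -> \forall x \near F, rnorm (v - f x) < e.
Proof.
split=> [fv e e0|fv S /nbhs_rnormP[e e0 eS]].
  exact: (fv _ (near_rnorm v e0)).
by apply: filterS (fv e e0) => x; exact: eS.
Qed.

Lemma closure_rnormP S v :
  closure S v <-> forall e : R, 0 < e -> exists2 w, S w & rnorm (v - w) < e.
Proof.
split=> [Sv e e0|Sv B /nbhs_rnormP[e e0 eB]].
  by have [w [Sw vw]] := Sv _ (near_rnorm v e0); exists w.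
by have [w Sw vw] := Sv e e0; exists w; split => //; exact: eB.
Qed.

End rnorm_topology.

Lemma rnorm_normE (R : realType) (V W : normedModType R[i]) (v : V) (w : W) :
  rnorm v = rnorm w <-> `|v| = `|w|.
Proof. by rewrite -!rnormE; split=> [->|/complexI]. Qed.

Lemma le_rnorm_norm (R : realType) (V W : normedModType R[i]) (v : V) (w : W) :
  (`|v| <= `|w|) = (rnorm v <= rnorm w).
Proof. by rewrite -!rnormE lecR. Qed.

Lemma continuous_rnormP (R : realType) (X : topologicalType)
    (V : normedModType R[i]) (f : X -> V) (x : X) :
  {for x, continuous f} <->
  forall e : R, 0 < e -> \forall y \near x, rnorm (f x - f y) < e.
Proof. exact: cvg_rnormP. Qed.

Lemma cauchy_rnorm_cvg (R : realType) (E : completeNormedModType R[i])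
    (u : nat -> E) : (forall e : R, 0 < e ->
      exists N, forall m, (N <= m)%N -> rnorm (u m - u N) < e) -> cvg (u @ \oo).
Proof.
move=> uc; apply/cauchy_cvgP/cauchyP => e e0; have [r0 ->] := complex_gt0 e0.
have [N HN] := uc _ r0; exists (u N), N => // m /= Nm.
by rewrite -ball_normE /= -rnormE ltcR rnorm_sub_sym HN.
Qed.

(** * Completeness of the spaces of operators, coefficients and summable families *)

Section rapidly_complete.
Context (R : realType).
Implicit Types V W : normedModType R[i].

(** Sequential completeness tested on sequences with geometric increments; every Cauchy sequence has
    such a subsequence. The limit comes with an explicit rate that is linear in [C], so that a limit
    taken pointwise with [C] depending on the point still yields a norm estimate. *)
Definition rapidly_complete V := forall (C : R) (u : nat -> V), 0 <= C ->
  (forall n, rnorm (u n.+1 - u n) <= C * 2^-1 ^+ n) ->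
  exists l, forall n, rnorm (l - u n) <= 2 * C * 2^-1 ^+ n.

Lemma geometric_small (C e : R) : 0 < e ->
  exists n, forall m, (n <= m)%N -> C * 2^-1 ^+ m < e.
Proof.
move=> e0.
have /cvgrPdist_lt/(_ e e0) : (fun m => C * 2^-1 ^+ m) @ \oo --> (0 : R).
  rewrite -[X in _ --> X](mulr0 C); apply: cvgMl_tmp; apply: cvg_expr.
  by rewrite ger0_norm ?invr_ge0// invf_lt1// ltr1n.
move=> [n _ nP]; exists n => m nm; have := nP m nm.
by rewrite /= sub0r normrN; apply: le_lt_trans; exact: ler_norm.
Qed.

(** The right-hand side is the exact value of the geometric sum of the increments from [n] to [m],
    which is what makes the induction close. *)
Lemma rapid_partial V (C : R) (u : nat -> V) n m : 0 <= C ->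
  (forall n, rnorm (u n.+1 - u n) <= C * 2^-1 ^+ n) -> (n <= m)%N ->
  rnorm (u m - u n) <= 2 * C * 2^-1 ^+ n - 2 * C * 2^-1 ^+ m.
Proof.
move=> C0 uC; elim: m => [|m IH]; first by rewrite leqn0 => /eqP ->; rewrite !subrr rnorm0.
rewrite leq_eqVlt => /predU1P[->|]; first by rewrite !subrr rnorm0.
rewrite ltnS => /IH nm; rewrite (le_trans (rnorm_triangle (u m) _ _))//.
rewrite (le_trans (lerD (uC m) nm))// exprS.
by lra.
Qed.

Lemma complete_rapidly (E : completeNormedModType R[i]) : rapidly_complete E.
Proof.
move=> C u C0 uC.
have up n m : (n <= m)%N -> rnorm (u m - u n) <= 2 * C * 2^-1 ^+ n.
  move=> nm; rewrite (le_trans (rapid_partial C0 uC nm))// lerBlDr lerDl.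
  by rewrite !mulr_ge0// exprn_ge0// invr_ge0.
have : cvg (u @ \oo).
  apply: cauchy_rnorm_cvg => e e0; have [N HN] := geometric_small (2 * C) e0.
  by exists N => m Nm; rewrite (le_lt_trans (up _ _ Nm))// HN.
move=> /cvg_ex[l /cvg_rnormP ul]; exists l => n.
apply/ler_addgt0Pr => e e0; have [N _ HN] := ul e e0.
have := HN (maxn N n) (leq_maxl _ _) => /= /ltW h.
rewrite (le_trans (rnorm_triangle (u (maxn N n)) _ _))// addrC lerD//.
exact: up (leq_maxr _ _).
Qed.

End rapidly_complete.

Section complete_spaces.
Context (R : realType).
Implicit Types V W : normedModType R[i].

Lemma rapid_pointwise_limit (T : Type) W (C : T -> R) (u : nat -> T -> W) :
  rapidly_complete W -> (forall x, 0 <= C x) ->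
  (forall n x, rnorm (u n.+1 x - u n x) <= C x * 2^-1 ^+ n) ->
  exists l : T -> W, forall x n, rnorm (l x - u n x) <= 2 * C x * 2^-1 ^+ n.
Proof.
move=> cW C0 uC.
have /choice[l lP] : forall x, exists l, forall n,
    rnorm (l - u n x) <= 2 * C x * 2^-1 ^+ n.
  by move=> x; exact: (cW (C x) (fun n => u n x)).
by exists l.
Qed.

(** Serves to show that a pointwise limit of linear maps is linear: both sides of the linearity
    equation are geometric limits of one sequence, with different constants. *)
Lemma rapid_limit_unique W (l l' : W) (u : nat -> W) (C C' : R) :
  (forall n, rnorm (l - u n) <= C * 2^-1 ^+ n) ->
  (forall n, rnorm (l' - u n) <= C' * 2^-1 ^+ n) -> l = l'.
Proof.
move=> lu lu'; apply: eq_of_rnorm => e e0.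
have [N HN] := geometric_small (C + C') e0.
rewrite (le_trans (rnorm_triangle (u N) _ _))// (rnorm_sub_sym _ l').
by rewrite (le_trans (lerD (lu N) (lu' N)))// -mulrDl ltW// HN.
Qed.

(** At [x] the increments are bounded with constant [C * rnorm x]; the resulting pointwise rate is
    proportional to [rnorm x] and is therefore a rate in operator norm. *)
Lemma rapidly_complete_bop V W :
  rapidly_complete W -> rapidly_complete (bop V W).
Proof.
move=> cW C u C0 uC.
have Cx0 (x : V) : 0 <= C * rnorm x by rewrite mulr_ge0 ?rnorm_ge0.
have [|l lu] := rapid_pointwise_limit (u := fun n x => u n x) cW Cx0.
  move=> n x; rewrite (le_trans (opnormM (u n.+1 - u n) x))//.
  by rewrite mulrAC ler_wpM2r ?rnorm_ge0//; exact: uC.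
have lin : linear l.
  move=> k x y; pose M := 2 * (rnorm (k : R[i]^o) * (C * rnorm x)) + 2 * (C * rnorm y).
  apply: (@rapid_limit_unique _ _ _ (fun n => u n (k *: x + y)) _ M) => n.
    exact: lu.
  rewrite bop_linear opprD addrACA -scalerBr.
  rewrite (le_trans (rnormD _ _))// rnormZ mulrDl lerD//.
  rewrite mulrCA -mulrA ler_wpM2l ?rnorm_ge0//; exact: lu.
have lb : exists M, forall x, rnorm (l x) <= M * rnorm x.
  exists (2 * C + opnorm (u 0)) => x.
  rewrite -[l x](subrK (u 0 x)) (le_trans (rnormD _ _))// mulrDl lerD ?opnormM//.
  by rewrite -mulrA (le_trans (lu x 0%N))// expr0 mulr1.
exists (Bop (introT (bop_predP _) (conj lin lb))) => n.
apply: opnorm_le => x x1; rewrite (le_trans (lu x n))//.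
rewrite ler_wpM2r ?exprn_ge0 ?invr_ge0// ler_wpM2l//.
by rewrite ler_piMr.
Qed.

Lemma rapidly_complete_cbfun (X : ptopologicalType) W :
  rapidly_complete W -> rapidly_complete (cbfun X W).
Proof.
move=> cW C u C0 uC.
have [|l lu] := rapid_pointwise_limit (u := fun n x => u n x) cW (fun=> C0).
  move=> n x; rewrite (le_trans (supnorm_ge (u n.+1 - u n) x))//; exact: uC.
have lc : continuous l.
  move=> x; apply/continuous_rnormP => e e0.
  have [N HN] := geometric_small (2 * C) (divr_gt0 e0 (ltr0n R 3)).
  have luN y : rnorm (l y - u N y) < e / 3 by rewrite (le_lt_trans (lu y N))// HN.
  have [cu _] := cbfunP (u N).
  have /continuous_rnormP/(_ _ (divr_gt0 e0 (ltr0n R 3))) := cu x.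
  apply: filterS => y uxy; rewrite (le_lt_trans (rnorm_triangle (u N x) _ _))//.
  rewrite [ltRHS](_ : e = e / 3 + (e / 3 + e / 3)); last by field.
  rewrite ltrD// (le_lt_trans (rnorm_triangle (u N y) _ _))// ltrD//.
  by rewrite rnorm_sub_sym.
have lb : exists M, forall x, rnorm (l x) <= M.
  exists (2 * C + supnorm (u 0)) => x.
  rewrite -[l x](subrK (u 0 x)) (le_trans (rnormD _ _))// lerD ?supnorm_ge//.
  by rewrite (le_trans (lu x 0%N))// expr0 mulr1.
exists (CbFun (introT (cbfun_predP _) (conj lc lb))) => n.
by apply: supnorm_le => x; exact: lu.
Qed.

Lemma esum_norm_leP (G : choiceType) V (xi : G -> V) (M : R) :
  (esum_norm xi <= M%:E)%E <->
  forall F : {fset G}, \sum_(g <- F) rnorm (xi g) <= M.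
Proof.
split=> [xiM F|xiM].
  rewrite -lee_fin (le_trans _ xiM)//; apply: esum_ge.
  exists [set` F]; first by split => //; exact: finite_fset.
  by rewrite fsbig_finite ?finite_fset// set_fsetK sumEFin.
apply: ge_ereal_sup => _ [F [finF _] <-].
by rewrite fsbig_finite// sumEFin lee_fin.
Qed.

Lemma l1norm_leP (G : choiceType) V (xi : l1fun G V) (M : R) :
  rnorm xi <= M <-> forall F : {fset G}, \sum_(g <- F) rnorm (xi g) <= M.
Proof. by rewrite -esum_norm_leP rnorm_l1funE -lee_fin l1normE. Qed.

(** The pointwise rate is not summable over [G]. On a finite set [F] the limit is instead compared
    with a late term [u m]: the distance from [u m] to [u n] is controlled in the l1 norm, and the
    remaining pointwise errors are finitely many. *)
Lemma rapidly_complete_l1fun (G : choiceType) V :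
  rapidly_complete V -> rapidly_complete (l1fun G V).
Proof.
move=> cV C u C0 uC.
have [|l lu] := rapid_pointwise_limit (u := fun n x => u n x) cV (fun=> C0).
  move=> n x; rewrite (le_trans (l1norm_ge (u n.+1 - u n) x))//; exact: uC.
have luF n : (esum_norm (fun g => l g - u n g)%R <= (2 * C * 2^-1 ^+ n)%:E)%E.
  apply/esum_norm_leP => F; apply/ler_addgt0Pr => e e0.
  (* The constant is [2 * C] times the number of elements of [F], so the pointwise errors at a stage
     beyond [N] add up to less than [e]. *)
  have [N HN] := geometric_small (\sum_(g <- F) 2 * C) e0.
  pose m := maxn N n.
  rewrite (@le_trans _ _ (\sum_(g <- F) (rnorm (l g - u m g) + rnorm (u m g - u n g))))//.
    by apply: ler_sum => g _; exact: rnorm_triangle.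
  rewrite big_split/= addrC lerD//.
    have := rapid_partial C0 uC (leq_maxr N n : (n <= m)%N).
    move=> /l1norm_leP/(_ F) h; rewrite (le_trans h)// gerBl.
    by rewrite !mulr_ge0// exprn_ge0// invr_ge0.
  rewrite ltW// (le_lt_trans _ (HN m (leq_maxl _ _)))// mulr_suml.
  by apply: ler_sum => g _; exact: lu.
have l1 : (esum_norm l < +oo)%E.
  have -> : l = (fun g => l g - u 0 g) + u 0 by apply/funext => g; rewrite /= subrK.
  apply: le_lt_trans (esum_normD _ _) _; rewrite lte_add_pinfty ?l1funP//.
  exact: le_lt_trans (luF 0%N) (ltry _).
exists (L1Fun (introT (l1fun_predP _) l1)) => n.
by rewrite rnorm_l1funE -lee_fin l1normE; exact: luF.
Qed.

End complete_spaces.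

(** * Extension to closures by closing graphs *)

Section closed_relation.
Context (R : realType) (V W : normedModType R[i]).
Implicit Types (Gam : V -> W -> Prop) (v : V) (w : W).

(** Partial maps are handled as graphs: well-definedness need not be known beforehand and follows
    from contractivity. *)
Definition rel_linear Gam := forall (k : R[i]) v w v' w', Gam v w -> Gam v' w' ->
  Gam (k *: v + v') (k *: w + w').

Definition rel_contractive Gam := forall v w, Gam v w -> rnorm w <= rnorm v.

Definition rel_closure Gam v w := forall e : R, 0 < e ->
  exists v' w', [/\ Gam v' w', rnorm (v - v') < e & rnorm (w - w') < e].

Lemma subset_rel_closure Gam v w : Gam v w -> rel_closure Gam v w.
Proof. by move=> vw e e0; exists v, w; rewrite !subrr !rnorm0. Qed.

Lemma rel_closure_linear Gam : rel_linear Gam -> rel_linear (rel_closure Gam).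
Proof.
move=> lG k v w v' w' vw vw' e e0.
pose d := e / (rnorm (k : R[i]^o) + 1).
have k1 : 0 < rnorm (k : R[i]^o) + 1 by rewrite ltr_wpDl ?rnorm_ge0.
have d0 : 0 < d by rewrite divr_gt0.
have [v1 [w1 [vw1 vv1 ww1]]] := vw d d0.
have [v2 [w2 [vw2 vv2 ww2]]] := vw' d d0.
have kd : rnorm (k : R[i]^o) * d + d = e.
  by rewrite -{2}[d]mul1r -mulrDl mulrC divfK// gt_eqF.
have bnd (U : normedModType R[i]) (a a' b b' : U) : rnorm (a - a') < d ->
    rnorm (b - b') < d -> rnorm (k *: a + b - (k *: a' + b')) < e.
  move=> aa bb; rewrite opprD addrACA -scalerBr (le_lt_trans (rnormD _ _))//.
  by rewrite rnormZ -kd ler_ltD// ler_wpM2l ?rnorm_ge0// ltW.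
by exists (k *: v1 + v2), (k *: w1 + w2); split; [exact: lG|exact: bnd|exact: bnd].
Qed.

Lemma rel_closure_contractive Gam :
  rel_contractive Gam -> rel_contractive (rel_closure Gam).
Proof.
move=> cG v w vw; apply/ler_addgt0Pr => e e0.
have [v' [w' [/cG vw' vv' ww']]] := vw (e / 2) (divr_gt0 e0 (ltr0n R 2)).
have h1 : rnorm w <= rnorm (w - w') + rnorm w' by rewrite (le_trans _ (rnormD _ _))// subrK.
have h2 : rnorm v' <= rnorm (v' - v) + rnorm v by rewrite (le_trans _ (rnormD _ _))// subrK.
rewrite rnorm_sub_sym in h2; lra.
Qed.

(** The difference of the two pairs relates [0] to [w' - w], which then has norm at most [0]. *)
Lemma rel_contractive_unique Gam v w w' : rel_linear Gam -> rel_contractive Gam ->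
  Gam v w -> Gam v w' -> w = w'.
Proof.
move=> lG cG vw vw'; have := cG _ _ (lG (-1) _ _ _ _ vw vw').
rewrite !scaleN1r addNr rnorm0 => h.
apply/eqP; rewrite eq_sym -subr_eq0 addrC; apply/eqP/rnorm_eq0/eqP.
by rewrite eq_le h rnorm_ge0.
Qed.

(** Contractivity carries a rapidly converging choice of approximants of [v] to a rapidly converging
    sequence of partners in [W], whose limit is related to [v] in the closure. *)
Lemma rel_closure_total Gam : rapidly_complete W -> rel_linear Gam ->
  rel_contractive Gam -> forall v, closure [set v' | exists w, Gam v' w] v ->
  exists w, rel_closure Gam v w.
Proof.
move=> cW lG cG v /closure_rnormP clv.
have d0 n : 0 < (2^-1 ^+ n : R) by rewrite exprn_gt0// invr_gt0.
have /choice[p pP] : forall n, exists p : V * W,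
    Gam p.1 p.2 /\ rnorm (v - p.1) < 2^-1 ^+ n.
  by move=> n; have [v' [w' vw'] vv'] := clv _ (d0 n); exists (v', w').
(* The constant 2 dominates the two approximation errors: [2^-1 ^+ n + 2^-1 ^+ n.+1 <= 2 * 2^-1 ^+
   n]. *)
have [||w wP] := cW 2 (fun n => (p n).2) => // [n|].
  have [p1 q1] := pP n.+1; have [p0 q0] := pP n.
  have := cG _ _ (lG (-1) _ _ _ _ p0 p1).
  rewrite !scaleN1r ![- _ + _]addrC => h; rewrite (le_trans h)//.
  rewrite (le_trans (rnorm_triangle v _ _))// [rnorm (_ - v)]rnorm_sub_sym.
  rewrite exprS in q1; move: (d0 n) q0 q1 => /=; lra.
exists w => e e0.
have [N HN] := geometric_small (2 * 2) e0.
have [pN qN] := pP N; exists (p N).1, (p N).2; split => //.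
  rewrite (lt_le_trans qN)// ltW// (le_lt_trans _ (HN N (leqnn _)))//.
  by rewrite ler_peMl ?(ltW (d0 _))//; lra.
by rewrite (le_lt_trans (wP N))// HN.
Qed.

End closed_relation.

Lemma rel_closureC (R : realType) (V W : normedModType R[i])
    (Gam : V -> W -> Prop) v w :
  rel_closure Gam v w <-> rel_closure (fun w v => Gam v w) w v.
Proof.
by split=> vw e e0; have [a [b [? ? ?]]] := vw e e0; exists b, a.
Qed.

Lemma opnorm_mul (R : realType) (V : normedModType R[i]) (f g : bop V V) :
  opnorm (f * g) <= opnorm f * opnorm g.
Proof.
apply: opnorm_le => x x1; rewrite (le_trans (opnormM f (g x)))//.
rewrite ler_wpM2l ?opnorm_ge0// (le_trans (opnormM g x))//.
by rewrite ler_piMr// opnorm_ge0.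
Qed.

Lemma rel_closure_mul (R : realType) (V W : normedModType R[i])
    (Gam : bop V V -> bop W W -> Prop) b c b' c' :
  (forall b c b' c', Gam b c -> Gam b' c' -> Gam (b * b') (c * c')) ->
  rel_closure Gam b c -> rel_closure Gam b' c' ->
  rel_closure Gam (b * b') (c * c').
Proof.
move=> mG bc bc' e e0.
pose M := opnorm b + opnorm b' + opnorm c + opnorm c' + 1.
have [[[hb hb'] hc] hc'] := (opnorm_ge0 b, opnorm_ge0 b', opnorm_ge0 c, opnorm_ge0 c').
have M0 : 0 < M by rewrite /M; lra.
(* The bound 1 keeps each approximant within 1 of the norm of its target; the error of a product is
   then at most [M * d], hence at most [e / 2]. *)
pose d := Num.min 1 (e / (2 * M)).
have d0 : 0 < d by rewrite lt_min ltr01 divr_gt0// mulr_gt0.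
have bnd (U : normedModType R[i]) (f f' g g' : bop U U) :
    opnorm f + opnorm f' + 1 <= M -> rnorm (f - g) < d -> rnorm (f' - g') < d ->
    rnorm (f * f' - g * g') < e.
  move=> fM fg fg'.
  have -> : f * f' - g * g' = (f - g) * f' + g * (f' - g').
    by rewrite mulrBl mulrBr addrA subrK.
  have g1 : opnorm g <= opnorm f + 1.
    have -> : g = (g - f) + f by rewrite subrK.
    rewrite (le_trans (opnormD _ _))// addrC lerD2l.
    have : rnorm (f - g) <= 1 by rewrite ltW// (lt_le_trans fg)// ge_min lexx.
    by rewrite rnorm_sub_sym.
  have h1 : rnorm ((f - g) * f') <= d * opnorm f'.
    rewrite (le_trans (opnorm_mul _ _))// ler_wpM2r ?opnorm_ge0//; exact: ltW.
  have h2 : rnorm (g * (f' - g')) <= (opnorm f + 1) * d.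
    rewrite (le_trans (opnorm_mul _ _))// ler_pM ?opnorm_ge0//; exact: ltW.
  rewrite (le_lt_trans (rnormD _ _))// (le_lt_trans (lerD h1 h2))//.
  rewrite mulrC -mulrDl (@le_lt_trans _ _ (M * d))//.
    by rewrite ler_wpM2r ?(ltW d0)//; lra.
  rewrite (@le_lt_trans _ _ (M * (e / (2 * M))))//.
    by rewrite ler_wpM2l ?(ltW M0)// ge_min lexx orbT.
  have -> : M * (e / (2 * M)) = e / 2 by field; rewrite gt_eqF.
  lra.
have [b1 [c1 [h1 b1b c1c]]] := bc d d0.
have [b2 [c2 [h2 b2b c2c]]] := bc' d d0.
exists (b1 * b2), (c1 * c2); split; [exact: mG| |].
- by apply: bnd => //; rewrite /M; lra.
- by apply: bnd => //; rewrite /M; lra.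
Qed.

(** * Strong measurability: a metric criterion and closure properties *)

Section strong_measurability.
Context d (T : measurableType d) (R : realType) (V : normedModType R[i]).
Implicit Types f : T -> V.

Definition separable_range f := exists s : nat -> V, forall x (e : R), 0 < e ->
  exists n, rnorm (f x - s n) < e.

Lemma enum_seqs (L : nat -> seq V) :
  exists s : nat -> V, forall n v, v \in L n -> exists k, s k = v.
Proof.
exists (fun k => if @choice.unpickle (nat * nat)%type k is Some p
    then nth 0 (L p.1) p.2 else 0).
by move=> n v vL; exists (choice.pickle (n, index v (L n))); rewrite choice.pickleK /= nth_index.
Qed.

Lemma strongly_measurable_dist f v : strongly_measurable f ->
  measurable_fun [set: T] (fun x => rnorm (f x - v)).
Proof.
move=> mf; apply: strongly_measurable_real.
apply: (strongly_measurable_comp (op := fun w => rnorm (w - v))) mf => w.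
apply: continuous_comp; last exact: rnorm_continuous.
by apply: cvgB; [exact: cvg_id|exact: cvg_cst].
Qed.

Lemma simple_fun_seq (s : T -> V) : simple_fun s ->
  exists L : seq V, forall x, s x \in L.
Proof.
move=> [/finite_seqP[L rL] _]; exists L => x.
have : range s (s x) by exists x.
by rewrite rL.
Qed.

Lemma strongly_measurable_separable f : strongly_measurable f -> separable_range f.
Proof.
move=> [s ss sf].
have /choice[L LP] : forall n, exists L : seq V, forall x, s n x \in L.
  by move=> n; exact: simple_fun_seq.
have [e eP] := enum_seqs L; exists e => x r r0.
have /cvg_rnormP/(_ r r0)[n _ /(_ n (leqnn n)) /= h] := sf x.
by have [k ek] := eP n _ (LP n x); exists k; rewrite ek.
Qed.

(** The point closest to [v] among [s 0, ..., s n]; a tie keeps the earlier point. *)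
Fixpoint nearest (s : nat -> V) (n : nat) (v : V) : V :=
  if n is m.+1 then
    if rnorm (v - s n) < rnorm (v - nearest s m v) then s n else nearest s m v
  else s 0.

Lemma nearestS s n v : rnorm (v - nearest s n.+1 v) =
  Num.min (rnorm (v - s n.+1)) (rnorm (v - nearest s n v)).
Proof. by rewrite /= /Order.min; case: ifP. Qed.

Lemma nearest_le s n m v : (n <= m)%N ->
  rnorm (v - nearest s m v) <= rnorm (v - s n).
Proof.
elim: m => [|m IH]; first by rewrite leqn0 => /eqP ->.
rewrite nearestS leq_eqVlt => /predU1P[->|]; first by rewrite ge_min lexx.
by rewrite ltnS => /IH h; rewrite ge_min h orbT.
Qed.

(** A form of the Pettis criterion with distances in place of functionals. Replacing [f x] by the
    nearest of the first points of a dense sequence gives functions with finitely many values; which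
    value is taken is decided by comparing measurable distances. *)
Lemma strongly_measurableP f : strongly_measurable f <->
  (forall v, measurable_fun [set: T] (fun x => rnorm (f x - v))) /\
  separable_range f.
Proof.
split=> [mf|[mf [s sP]]].
  by split; [move=> v; exact: strongly_measurable_dist|
             exact: strongly_measurable_separable].
have md n : measurable_fun [set: T] (fun x => rnorm (f x - nearest s n (f x))).
  elim: n => [|n IH]; first exact: mf.
  rewrite [X in measurable_fun _ X](_ : _ = (fun x =>
    Num.min (rnorm (f x - s n.+1)) (rnorm (f x - nearest s n (f x))))).
    exact: measurable_minr.
  by apply/funext => x; exact: nearestS.
exists (fun n x => nearest s n (f x)).
  elim=> [|n IH]; first exact: simple_fun_cst.
  pose b x := rnorm (f x - s n.+1) < rnorm (f x - nearest s n (f x)).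
  have sb : simple_fun b.
    split=> [|c]; first exact: finite_finset.
    rewrite -[X in measurable X]setTI.
    exact: (measurable_fun_ltr (mf _) (md n)).
  exact: (simple_fun2 (fun (c : bool) v => if c then s n.+1 else v) sb IH).
move=> x; apply/cvg_rnormP => e e0; have [n nP] := sP x e e0.
exists n => // m /= nm.
exact: le_lt_trans (nearest_le _ _ nm) nP.
Qed.

End strong_measurability.

Section strong_measurability_closure.
Context d (T : measurableType d) (R : realType) (V : normedModType R[i]).

Lemma separable_rangeP (f : T -> V) (s : nat -> nat -> V) :
  (forall x (e : R), 0 < e -> exists m n, rnorm (f x - s m n) < e) ->
  separable_range f.
Proof.
move=> sP.
exists (fun k => if @choice.unpickle (nat * nat)%type k is Some p
  then s p.1 p.2 else 0) => x e e0.
have [m [n mn]] := sP x e e0.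
by exists (choice.pickle (m, n)); rewrite choice.pickleK.
Qed.

(** A diagonal choice among simple approximations of the [f_ n] need not converge at every point,
    whereas both halves of [strongly_measurableP] pass to pointwise limits. *)
Lemma strongly_measurable_cvg (f_ : nat -> T -> V) (f : T -> V) :
  (forall n, strongly_measurable (f_ n)) ->
  (forall x, f_ n x @[n --> \oo] --> f x) -> strongly_measurable f.
Proof.
move=> mf ff; apply/strongly_measurableP; split=> [v|].
  apply: (@measurable_fun_cvg _ _ _ _ (fun n x => rnorm (f_ n x - v))).
    by move=> n; exact: strongly_measurable_dist.
  move=> x _; apply: (@continuous_cvg _ _ _ _ _ _ (fun w => rnorm (w - v)));
    last exact: ff.
  apply: continuous_comp; last exact: rnorm_continuous.
  by apply: cvgB; [exact: cvg_id|exact: cvg_cst].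
have /choice[s sP] := fun n => strongly_measurable_separable (mf n).
apply: (separable_rangeP (s := s)) => x e e0.
have e20 : 0 < e / 2 by rewrite divr_gt0.
have /cvg_rnormP/(_ _ e20)[m _ /(_ m (leqnn m)) /= h] := ff x.
have [n nP] := sP m x _ e20; exists m, n.
rewrite (le_lt_trans (rnorm_triangle (f_ m x) _ _))// [ltRHS](splitr e).
exact: ltrD.
Qed.

Lemma strongly_measurable_precomp d' (S : measurableType d') (phi : S -> T)
    (f : T -> V) : measurable_fun [set: S] phi ->
  strongly_measurable f -> strongly_measurable (f \o phi).
Proof.
move=> mphi [s ss sf]; exists (fun n => s n \o phi) => [n|x]; last exact: sf.
split=> [|v]; last by rewrite comp_preimage -[X in measurable X]setTI;
  apply: mphi => //; exact: (ss n).2.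
by apply: sub_finite_set (ss n).1 => _ [x _ <-]; exists (phi x).
Qed.

Lemma strongly_measurable_if (Q : set T) (f : T -> V) : measurable Q ->
  strongly_measurable f -> strongly_measurable (fun x => if x \in Q then f x else 0).
Proof.
move=> mQ [s ss sf]; exists (fun n x => if x \in Q then s n x else 0) => [n|x].
  have sQ : simple_fun (mem Q : T -> bool).
    split=> [|b]; first exact: finite_finset.
    have -> : (mem Q : T -> bool) @^-1` [set b] = if b then Q else ~` Q.
      apply/seteqP; case: b; split=> x /=.
      - by move=> xQ; apply: set_mem.
      - by move=> Qx; apply: mem_set.
      - by move=> xQ /mem_set; rewrite xQ.
      - by move=> nQx; apply/negbTE/negP => /set_mem.
    by case: b => //; exact: measurableC.
  exact: (simple_fun2 (fun (b : bool) v => if b then v else 0) sQ (ss n)).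
by case: ifP => _; [exact: sf|exact: cvg_cst].
Qed.

Lemma strongly_measurable_real_scale (rho : T -> R) (f : T -> V) :
  measurable_fun [set: T] rho -> strongly_measurable f ->
  strongly_measurable (fun x => (rho x)%:C *: f x).
Proof.
move=> mrho mf.
have cC : continuous (fun r : R => r%:C : R[i]^o).
  move=> r; apply/cvg_rnormP => e e0.
  have /cvgrPdist_lt/(_ e e0) : (fun s : R => s) @ r --> r by exact: cvg_id.
  apply: filterS => s rs; rewrite -[_ - _](@rmorphB _ _ (@real_complex R)) /rnorm normc_def /=.
  rewrite expr0n addr0 sqrtr_sqr.
  exact: rs.
have mC : strongly_measurable (fun x => (rho x)%:C : R[i]^o).
  apply/strongly_measurableP; split=> [v|].
    apply: (measurableT_comp (f := fun r : R => rnorm (r%:C - v : R[i]^o))) mrho.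
    apply: continuous_measurable_fun => r.
    apply: (continuous_comp (f := fun r : R => r%:C - v : R[i]^o)).
      by apply: cvgB; [exact: cC|exact: cvg_cst].
    exact: rnorm_continuous.
  (* The embedded rationals, with 0 at codes that decode to nothing, approximate every real
     value. *)
  exists (fun n => ((ratr (if @choice.unpickle rat n is Some q then q else 0) : R)%:C)).
  move=> x e e0.
  have [q] : exists q : rat, `|rho x - ratr q| < e.
    have /rat_in_itvoo[q] : rho x - e < rho x + e by lra.
    rewrite in_itv /= => /andP[q1 q2]; exists q.
    by rewrite ltr_norml; apply/andP; split; lra.
  move=> qe; exists (choice.pickle q); rewrite choice.pickleK.
  rewrite -[_ - _](@rmorphB _ _ (@real_complex R)) /rnorm normc_def /=.
  by rewrite expr0n addr0 sqrtr_sqr.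
apply: (@strongly_measurable2 _ _ _ _ _ (fun (k : R[i]^o) v => k *: v)) mC mf.
by move=> k v; exact: scale_continuous.
Qed.

End strong_measurability_closure.

(** * Countable chain condition and separable ranges of continuous maps *)

Lemma sigma_finite_cover d (T : measurableType d) (R : realType)
    (mu : {measure set T -> \bar R}) : sigma_finite [set: T] mu ->
  exists F : nat -> set T,
  [/\ forall n, measurable (F n), forall n, (mu (F n) < +oo)%E,
      trivIset [set: nat] F & \bigcup_n F n = [set: T]].
Proof.
move=> [F FT /all_and2[mF Foo]].
exists (seqDU F); split.
- by move=> n; apply: measurableD => //; exact: bigsetU_measurable.
- move=> n; apply: le_lt_trans (Foo n); apply: le_measure; rewrite ?inE//.
    by apply: measurableD => //; exact: bigsetU_measurable.
  exact: subDsetl.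
- exact: trivIset_seqDU.
- by rewrite -seqDU_bigcup_eq -FT.
Qed.

Section countable_chain_condition.
Context (R : realType) (X : ptopologicalType).
Context (mu : {sigma_finite_measure set (borel X) -> \bar R}).
Hypothesis mu_support : measure_support mu = [set: X].

Lemma borel_open (U : set X) : open U -> measurable (U : set (borel X)).
Proof. by move=> oU; exact: sub_sigma_algebra. Qed.

Lemma open_measure_gt0 (U : set X) : open U -> U !=set0 -> (0 < mu U)%E.
Proof.
move=> oU [x Ux]; have : measure_support mu x by rewrite mu_support.
by apply.
Qed.

Lemma positive_part (F : nat -> set (borel X)) (U : set (borel X)) :
  (forall n, measurable (F n)) -> \bigcup_n F n = [set: X] ->
  measurable U -> (0 < mu U)%E -> exists n, (0 < mu (U `&` F n))%E.
Proof.
move=> mF FT mU U0; apply: contrapT => h.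
have /(@negligible_bigcup _ _ _ mu) : forall n, mu.-negligible (U `&` F n).
  move=> n; apply/negligibleP; first exact: measurableI.
  apply/eqP; rewrite eq_le measure_ge0 andbT leNgt; apply/negP => h'.
  by apply: h; exists n.
rewrite -setI_bigcupr FT setIT => /(negligibleP mu mU) mU0.
by rewrite mU0 ltxx in U0.
Qed.

(** By full support each [U i] meets some piece [F n] of finite measure in more than [1 / (k + 1)]
    for some [k]. For fixed [n] and [k] only finitely many disjoint sets can do so. *)
Lemma disjoint_opens_countable (I : choiceType) (S : set I) (U : I -> set X) :
  (forall i, S i -> open (U i)) -> (forall i, S i -> U i !=set0) ->
  trivIset S U -> countable S.
Proof.
move=> oU U0 tU; have [F [mF Foo tF FT]]  := @sigma_finite_cover _ _ _ mu (sigma_finiteT mu).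
pose S_ n k := [set i | S i /\ ((k.+1%:R^-1)%:E < mu (U i `&` F n))%E].
have -> : S = \bigcup_n \bigcup_k S_ n k.
  apply/seteqP; split=> [i Si|i [n _ [k _ []]]//].
  have [n n0] := positive_part mF FT (borel_open (oU i Si))
    (open_measure_gt0 (oU i Si) (U0 i Si)).
  exists n => //.
  have fin : mu (U i `&` F n) \is a fin_num.
    rewrite ge0_fin_numE ?measure_ge0//; apply: le_lt_trans (Foo n).
    apply: le_measure; rewrite ?inE//.
      by apply: measurableI => //; apply: borel_open; exact: oU.
  have f0 : 0 < fine (mu (U i `&` F n)) by rewrite -lte_fin fineK.
  have [k kP] := ltr_add_invr f0.
  by exists k => //; split => //; rewrite -(fineK fin) lte_fin -[ltLHS]add0r.
apply: bigcup_countable => // n _; apply: bigcup_countable => // k _.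
apply: finite_set_countable; apply: contrapT => infS.
have fin : mu (F n) \is a fin_num by rewrite ge0_fin_numE ?measure_ge0//; exact: Foo.
(* [N] disjoint pieces, each of measure above [1 / (k + 1)], would overfill [F n]. *)
have [N NP] : exists N : nat, fine (mu (F n)) < N%:R * k.+1%:R^-1.
  exists (Num.bound (fine (mu (F n)) * k.+1%:R)).
  by rewrite ltr_pdivlMr//; apply: archi_boundP; rewrite mulr_ge0// fine_ge0.
have [B BS BN] := infinite_set_fset N infS.
have mUF i : i \in B -> measurable (U i `&` F n : set (borel X)).
  move=> iB; apply: measurableI => //; apply: borel_open; apply: oU.
  by case: (BS i iB).
have tUF : trivIset [set` B] (fun i => U i `&` F n).
  by apply: trivIset_setIr; apply: sub_trivIset tU => i /BS[].
have := measure_fbigsetU mu mUF tUF => mB.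
have : (mu (\big[setU/set0]_(i <- B) (U i `&` F n)) <= mu (F n))%E.
  apply: le_measure; rewrite ?inE//.
    by rewrite -bigcup_fset; apply: fin_bigcup_measurable.
  by rewrite -bigcup_fset => x [i _ []].
rewrite mB leNgt => /negP; apply; rewrite -(fineK fin).
apply: (@lt_le_trans _ _ ((N%:R * k.+1%:R^-1)%:E)); first by rewrite lte_fin.
apply: (@le_trans _ _ (\sum_(i <- B) (k.+1%:R^-1)%:E)%E).
  rewrite sumEFin lee_fin big_const_seq count_predT iter_addr_0 -[leRHS]mulr_natl.
  by rewrite ler_wpM2r ?invr_ge0// ler_nat.
rewrite big_seq [leRHS]big_seq; apply: lee_sum => i iB.
by have [_ /ltW] := BS i iB.
Qed.

Lemma countable_enum (I : pointedType) (S : set I) : countable S ->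
  exists e : nat -> I, forall i, S i -> exists n, e n = i.
Proof.
move=> /countable_injP[f finj].
exists (fun n => xget point (S `&` f @^-1` [set n])) => i Si; exists (f i).
case: xgetP => [j _ [Sj /= fji]|/(_ i)]; last by case.
by apply: finj; rewrite ?inE.
Qed.

(** At each scale [r] a maximal set of points whose images are [r]-separated is countable, since the
    preimages of the balls of radius [r / 2] around those images are disjoint, open and nonempty.
    Maximality makes the images [r]-dense in the range. *)
Lemma continuous_separable_range (V : normedModType R[i]) (f : X -> V) :
  continuous f -> separable_range (f : borel X -> V).
Proof.
move=> cf.
have /choice[s sP] : forall m, exists s : nat -> X, forall x,
    exists n, rnorm (f x - f (s n)) < 2^-1 ^+ m.
  move=> m; set r := 2^-1 ^+ m : R.
  have r0 : 0 < r by rewrite exprn_gt0// invr_gt0.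
  pose sep (S : set X) := forall x y, S x -> S y -> x != y -> r <= rnorm (f x - f y).
  have [S [sepS maxS]] : exists S, sep S /\ forall B, S `<` B -> ~ sep B.
    apply: Zorn_bigcup => F FP tF x y [A FA Ax] [B FB By].
    have [AB|BA] := tF A B FA FB; first by apply: (FP B FB) => //; exact: AB.
    by apply: (FP A FA) => //; exact: BA.
  have cS : countable S.
    pose U x := f @^-1` [set v | rnorm (f x - v) < r / 2].
    apply: (@disjoint_opens_countable _ S U).
    - move=> x _; move: (cf) => /continuousP; apply.
      rewrite openE => v /= vP; apply/nbhs_rnormP.
      exists (r / 2 - rnorm (f x - v)); first by rewrite subr_gt0.
      move=> w vw; rewrite /= (le_lt_trans (rnorm_triangle v _ _))//; lra.
    - by move=> x _; exists x; rewrite /U /= subrr rnorm0 divr_gt0.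
    - move=> x y Sx Sy [z [xz yz]]; apply/eqP; apply: contrapT => /negP xy.
      have := sepS x y Sx Sy xy; rewrite leNgt => /negP; apply.
      rewrite (le_lt_trans (rnorm_triangle (f z) _ _))// [rnorm (f z - _)]rnorm_sub_sym.
      by move: xz yz; rewrite /U/=; lra.
  have [e eP] := countable_enum cS; exists e => x.
  suff [y Sy xy] : exists2 y, S y & rnorm (f x - f y) < r.
    by have [n en] := eP y Sy; exists n; rewrite en.
  apply: contrapT => far.
  have xfar y : S y -> r <= rnorm (f x - f y).
    by move=> Sy; rewrite leNgt; apply/negP => h; apply: far; exists y.
  have nSx : ~ S x by move=> /xfar; rewrite subrr rnorm0 leNgt r0.
  (* A point whose image is far from all images of [S] could be added to [S], against maximality. *)
  apply: (maxS (x |` S)).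
    split; last by move=> h; apply: nSx; apply: h; left.
    by move=> y Sy; right.
  move=> y z [->|Sy] [->|Sz]; first by rewrite eqxx.
  - by move=> _; exact: xfar.
  - by move=> _; rewrite rnorm_sub_sym; exact: xfar.
  - exact: sepS.
apply: (separable_rangeP (s := fun m n => f (s m n))) => x e e0.
have [m mP] := geometric_small 1 e0; have [n nP] := sP m x.
by exists m, n; rewrite (lt_trans nP)// -[ltLHS]mul1r mP.
Qed.

Lemma continuous_borel_measurable (f : X -> R) : continuous f ->
  measurable_fun [set: borel X] (f : borel X -> R).
Proof.
move=> /continuousP cf; apply: (measurability _ (RGenOpens.measurableE R)).
move=> _ [_ [a [b ->] <-]]; rewrite setTI; apply: borel_open.
exact/cf/interval_open.
Qed.

Lemma continuous_strongly_measurable (V : normedModType R[i]) (f : X -> V) :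
  continuous f -> strongly_measurable (f : borel X -> V).
Proof.
move=> cf; apply/strongly_measurableP; split; last exact: continuous_separable_range.
move=> v; apply: continuous_borel_measurable => x.
apply: (continuous_comp (f := fun x => f x - v)).
  by apply: cvgB; [exact: cf|exact: cvg_cst].
exact: rnorm_continuous.
Qed.

End countable_chain_condition.

(** * Densities of sigma-finite measures *)

Section density.
Context d (T : measurableType d) (R : realType).
Implicit Types (nu : {measure set T -> \bar R}) (rho : T -> R).

(** The condition inside [rn_derivative], named so that existence of one density specifies the
    chosen one. *)
Definition is_density (nu mu : set T -> \bar R) rho :=
  [/\ measurable_fun [set: T] rho, forall x, 0 <= rho x &
      forall Q, measurable Q -> nu Q = (\int[mu]_(x in Q) (rho x)%:E)%E].

(** The Radon-Nikodym theorem is applied to the finite restrictions of [nu] to the pieces [F n], and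
    the derivatives are glued along the index of the piece containing the point. *)
Lemma density_exists nu (mu : {sigma_finite_measure set T -> \bar R}) :
  sigma_finite [set: T] nu -> nu `<< mu -> exists rho, is_density nu mu rho.
Proof.
move=> /sigma_finite_cover[F [mF Foo tF FT]] numu.
have /choice[f fP] : forall n, exists f : T -> \bar R,
    [/\ forall x, (0 <= f x)%E, forall x, f x \is a fin_num,
        measurable_fun [set: T] f &
        forall A, measurable A -> nu (A `&` F n) = (\int[mu]_(x in A) f x)%E].
  move=> n.
  have [|f [f0 ffin /measurable_int mf fint]] :=
      @radon_nikodym_sigma_finite _ _ _ mu (mfrestr (mF n) (Foo n)).
    apply: null_dominates_trans numu.
    by move=> N N0 A mA AN; apply: N0; [exact: measurableI|exact: subIset (or_introl AN)].
  by exists f; split.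
have /choice[idx idxP] : forall x, exists n, F n x.
  by move=> x; have : [set: T] x by []; rewrite -FT => -[n _ Fx]; exists n.
have idxE x n : F n x -> idx x = n.
  by move=> Fx; apply: (tF _ _ I I); exists x.
pose rho x := fine (f (idx x) x).
have rhoE n x : F n x -> (rho x)%:E = f n x.
  by move=> Fx; rewrite /rho (idxE x n Fx) fineK//; have [] := fP n.
have mrho : measurable_fun [set: T] rho.
  move=> _ Y mY; rewrite setTI.
  have -> : rho @^-1` Y = \bigcup_n (F n `&` (fine \o f n) @^-1` Y).
    apply/seteqP; split=> [x Yx|x [n _ [Fx]]].
      by exists (idx x).
    by rewrite /= /rho (idxE x n Fx).
  apply: bigcup_measurable => n _; apply: measurableI => //.
  have [_ _ mf _] := fP n.
  rewrite -[X in measurable X]setTI.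
  exact: (measurableT_comp (fine_measurable measurableT) mf).
have rho0 x : 0 <= rho x by rewrite fine_ge0//; have [] := fP (idx x).
exists rho; split => // Q mQ.
have QE : Q = \bigcup_n (Q `&` F n) by rewrite -setI_bigcupr FT setIT.
have mQF n : measurable (Q `&` F n) by exact: measurableI.
have tQF : trivIset [set: nat] (fun n => Q `&` F n) by exact: trivIset_setIl.
rewrite [in LHS]QE measure_semi_bigcup//; last by rewrite -QE.
rewrite [in RHS]QE ge0_integral_bigcup//; last 2 first.
- by apply/measurable_EFinP; exact: measurable_funTS.
- by move=> x _; rewrite lee_fin.
apply: eq_eseriesr => n _; have [_ _ _ fint] := fP n.
rewrite -[in LHS](setIid (F n)) setIA fint//.
by apply: eq_integral => x /set_mem[_ /rhoE].
Qed.

Import HBNNSimple.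

Lemma density_integral nu (mu : {measure set T -> \bar R}) rho
    (phi : T -> \bar R) : is_density nu mu rho ->
  measurable_fun [set: T] phi -> (forall x, (0 <= phi x)%E) ->
  (\int[nu]_x phi x = \int[mu]_x (phi x * (rho x)%:E))%E.
Proof.
move=> [mrho rho0 nuE] mphi phi0; pose h := nnsfun_approx measurableT mphi.
have mrhoE : measurable_fun [set: T] (EFin \o rho) by exact/measurable_EFinP.
have mh n : measurable_fun [set: T] (EFin \o h n) by exact/measurable_EFinP.
have hphi x : limn (fun n => (h n x)%:E) = phi x.
  by apply/cvg_lim => //; exact: cvg_nnsfun_approx.
have hrphi x : limn (fun n => (h n x)%:E * (rho x)%:E)%E = (phi x * (rho x)%:E)%E.
  by apply/cvg_lim => //; apply: cvgeZr => //; exact: cvg_nnsfun_approx.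
have hnd x : {homo (fun n => h n x) : n m / (n <= m)%N >-> n <= m}.
  by move=> n m nm; have /lefP := nd_nnsfun_approx measurableT mphi nm; exact.
transitivity (limn (fun n => \int[nu]_x (h n x)%:E)%E).
  rewrite -monotone_convergence//.
  - by apply: eq_integral => x _; rewrite hphi.
  - by move=> n x _; rewrite lee_fin.
  - by move=> x _ n m nm; rewrite lee_fin hnd.
transitivity (limn (fun n => \int[mu]_x ((h n x)%:E * (rho x)%:E))%E); last first.
  rewrite -monotone_convergence//.
  - by apply: eq_integral => x _; rewrite hrphi.
  - by move=> n; exact: (emeasurable_funM (mh n) mrhoE).
  - by move=> n x _; rewrite mule_ge0 ?lee_fin.
  - by move=> x _ n m nm; rewrite lee_wpmul2r ?lee_fin ?hnd.
congr (limn _); apply/funext => n.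
have hE x : (h n x)%:E = (\sum_(y \in range (h n)) (y * \1_(h n @^-1` [set y]) x)%:E)%E.
  by rewrite /= fimfunE -fsumEFin.
have mind y : measurable_fun [set: T] (fun x => (y * \1_(h n @^-1` [set y]) x)%:E).
  by apply/measurable_EFinP; exact: measurable_funM.
have ind0 y x : (0 <= (y * \1_(h n @^-1` [set y]) x)%:E)%E.
  exact: nnfun_muleindic_ge0.
under eq_integral do rewrite hE.
under [RHS]eq_integral do rewrite hE ge0_mule_fsuml//.
rewrite !ge0_integral_fsum//; last 2 first.
- by move=> y; exact: (emeasurable_funM (mind y) mrhoE).
- by move=> y x _; rewrite mule_ge0// lee_fin.
apply: eq_fsbigr => y /set_mem[z _ hz].
have y0 : (0 <= y) by rewrite -hz.
have mA : measurable (h n @^-1` [set y]) by exact: measurable_funPTI.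
rewrite integralZl_indic_nnsfun// integral_indic// setIT nuE//.
under [RHS]eq_integral do rewrite EFinM -muleA.
rewrite ge0_integralZl//; last 2 first.
- by apply: emeasurable_funM => //; exact/measurable_EFinP.
- by move=> x _; rewrite mule_ge0 ?lee_fin.
congr (_ * _)%E; rewrite integral_mkcond; apply: eq_integral => x _.
by rewrite epatch_indic /= muleC.
Qed.

(** On a piece of finite [nu]-measure both densities are integrable with equal integrals over
    measurable subsets, so they agree almost everywhere there; the exceptional sets are countably
    many. *)
Lemma density_unique nu (mu : {measure set T -> \bar R}) rho rho' :
  sigma_finite [set: T] nu -> is_density nu mu rho -> is_density nu mu rho' ->
  ae_eq mu [set: T] rho rho'.
Proof.
move=> /sigma_finite_cover[F [mF Foo tF FT]] [mr r0 rE] [mr' r0' rE'].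
have aeF n : ae_eq mu (F n) (EFin \o rho) (EFin \o rho').
  apply: integral_ae_eq => //.
  - apply/integrableP; split; first by apply/measurable_EFinP; exact: measurable_funTS.
    rewrite (eq_integral (EFin \o rho)); first by rewrite -rE.
    by move=> x _; rewrite gee0_abs// lee_fin.
  - by apply/measurable_EFinP; exact: measurable_funTS.
  - by move=> Q QF mQ; rewrite -rE// -rE'.
have /negligible_bigcup : forall n, mu.-negligible (~` [set x | F n x -> (rho x)%:E = (rho' x)%:E]).
  by move=> n; exact: aeF.
apply: negligibleS => x /= nxx; have : [set: T] x by [].
rewrite -FT => -[n _ Fx]; exists n => //= h; apply: nxx => _.
by have [] := h Fx.
Qed.

End density.

(** * Operators on classes of functions given by a formula *)

Section total_constructors.
Context (R : realType).

Lemma mkopE (V W : normedModType R[i]) (f : V -> W) :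
  bounded_linear f -> forall x, mkop f x = f x.
Proof. by move=> /bop_predP bf x; rewrite /mkop (insubdK _ bf). Qed.

Lemma mkl1E (G : choiceType) (V : normedModType R[i]) (xi : G -> V) :
  (esum_norm xi < +oo)%E -> forall g, mkl1 xi g = xi g.
Proof. by move=> /l1fun_predP h g; rewrite /mkl1 (insubdK _ h). Qed.

Lemma bop_opp (V W : normedModType R[i]) (f : bop V W) x : f (- x) = - f x.
Proof. by rewrite -(scaleN1r x) bop_scale scaleN1r. Qed.

Lemma bop_sub (V W : normedModType R[i]) (f : bop V W) x y :
  f (x - y) = f x - f y.
Proof. by rewrite bop_add bop_opp. Qed.

Context d (T : measurableType d) (mu : {measure set T -> \bar R}).
Context (E : normedModType R[i]).

Lemma mkL1E (f : T -> E) : bochner_integrable mu f ->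
  ae_eq mu [set: T] (mkL1 mu f) f.
Proof.
move=> /bochner_predP bf; have := L1_reprK (insubd 0 f : bochner mu E).
by rewrite (insubdK _ bf).
Qed.

Lemma ae_eq_eqfun (f g : T -> E) : f =1 g -> ae_eq mu [set: T] f g.
Proof. by move=> fg; apply: filterE => x _; exact: fg. Qed.

Lemma rnorm_L1 (u : L1 mu E) : (rnorm u)%:E = int_norm mu u.
Proof. by rewrite rnorm_L1E L1normE. Qed.

Lemma rnorm_L1_ae (u : L1 mu E) (f : T -> E) : strongly_measurable f ->
  ae_eq mu [set: T] u f -> (rnorm u)%:E = int_norm mu f.
Proof.
move=> mf uf; rewrite rnorm_L1; apply: ae_eq_int_norm => //.
by case: (L1P u).
Qed.

Lemma L1_strongly_measurable (u : L1 mu E) : strongly_measurable u.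
Proof. by case: (L1P u). Qed.

Lemma L1_ext (u v : L1 mu E) (f : T -> E) :
  ae_eq mu [set: T] u f -> ae_eq mu [set: T] v f -> u = v.
Proof. by move=> uf vf; apply/L1_eqP; apply: ae_eq_trans uf (ae_eq_sym vf). Qed.

Section L1_operator.
Variables (K : (T -> E) -> (T -> E)) (M : R).
Hypothesis K_linear : forall (k : R[i]) f g x,
  K (fun x => k *: f x + g x) x = k *: K f x + K g x.
Hypothesis K_ae : forall f g, ae_eq mu [set: T] f g -> ae_eq mu [set: T] (K f) (K g).
Hypothesis K_measurable : forall f, strongly_measurable f -> strongly_measurable (K f).
Hypothesis K_bounded : forall f, strongly_measurable f ->
  (int_norm mu (K f) <= M%:E * int_norm mu f)%E.

Let M0 (u : L1 mu E) : (int_norm mu (K u) < +oo)%E.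
Proof.
apply: le_lt_trans (K_bounded (L1_strongly_measurable u)) _.
by rewrite -rnorm_L1 -EFinM ltry.
Qed.

Lemma K_integrable (u : L1 mu E) : bochner_integrable mu (K u).
Proof. by split=> //; apply: K_measurable; exact: L1_strongly_measurable. Qed.

(** The representative of [k *: u + v] agrees with the combination of the representatives only
    almost everywhere, so the pointwise linearity of [K] reaches classes by way of [K_ae]. *)
Lemma L1_operator_bounded_linear :
  bounded_linear (fun u : L1 mu E => mkL1 mu (K u)).
Proof.
have lin (k : R[i]) (u v : L1 mu E) : mkL1 mu (K (k *: u + v : L1 mu E)) =
    k *: mkL1 mu (K u) + mkL1 mu (K v).
  apply: (L1_ext (f := fun x => k *: K u x + K v x)).
    apply: (ae_eq_trans (mkL1E (K_integrable _))).
    have uv : ae_eq mu [set: T] (k *: u + v : L1 mu E) (fun x => k *: u x + v x).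
      apply: (ae_eq_trans (L1DE _ _)); apply: filterS (L1ZE k u) => x h _.
      by rewrite h.
    apply: (ae_eq_trans (K_ae uv)); apply: ae_eq_eqfun => x; exact: K_linear.
  apply: (ae_eq_trans (L1DE _ _)).
  apply: (filterS3 _ _ (L1ZE k (mkL1 mu (K u))) (mkL1E (K_integrable u))
    (mkL1E (K_integrable v))) => x h1 h2 h3 _.
  by rewrite h1// h2// h3.
split; first exact: lin.
have bnd (u : L1 mu E) : rnorm (mkL1 mu (K u)) <= M * rnorm u.
  rewrite -lee_fin EFinM (rnorm_L1 u).
  rewrite (rnorm_L1_ae (K_measurable (L1_strongly_measurable u))
    (mkL1E (K_integrable u))).
  exact: K_bounded (L1_strongly_measurable u).
by exists M; exact: bnd.
Qed.

Lemma L1_operatorE (u : L1 mu E) :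
  ae_eq mu [set: T] (mkop (fun u : L1 mu E => mkL1 mu (K u)) u : L1 mu E)
    (K u).
Proof.
by rewrite (mkopE L1_operator_bounded_linear); exact: mkL1E (K_integrable u).
Qed.

End L1_operator.
End total_constructors.

(** * Multiplication by operator-valued functions *)

Section multiplication.
Context (R : realType) (X : ptopologicalType) (E : normedModType R[i]).
Context (mu : {sigma_finite_measure set (borel X) -> \bar R}).
Hypothesis mu_support : measure_support mu = [set: X].
Local Notation A := (cbfun X (bop E E)).

Lemma strongly_measurable_sum (I : Type) (r : seq I) (f : I -> borel X -> E) :
  (forall i, strongly_measurable (f i)) ->
  strongly_measurable (fun x => \sum_(i <- r) f i x).
Proof.
move=> mf; elim: r => [|i r IH].
  by under eq_fun do rewrite big_nil; exact: strongly_measurable_cst.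
under eq_fun do rewrite big_cons.
exact: (strongly_measurableD (mf i) IH).
Qed.

Lemma continuous_eval (a : A) (v : E) : continuous (fun x => a x v).
Proof.
move=> x; apply/continuous_rnormP => e e0.
have [ca _] := cbfunP a.
have v1 : 0 < rnorm v + 1 by rewrite ltr_wpDl ?rnorm_ge0.
have /continuous_rnormP/(_ _ (divr_gt0 e0 v1)) := ca x.
apply: filterS => y axy.
rewrite (le_lt_trans (opnormM (a x - a y) v))//.
rewrite (@le_lt_trans _ _ (opnorm (a x - a y) * (rnorm v + 1)))//.
  by rewrite ler_wpM2l ?opnorm_ge0// lerDl.
by rewrite -ltr_pdivlMr.
Qed.

(** For a fixed vector [v] the function [a x v] is continuous in [x], hence strongly measurable.
    Simple [f] reduce to finitely many such functions cut off to level sets, and general [f] follow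
    by pointwise limits. *)
Lemma strongly_measurable_mult (a : A) (f : borel X -> E) :
  strongly_measurable f -> strongly_measurable (fun x : borel X => a x (f x)).
Proof.
move=> [s ss sf]; apply: (strongly_measurable_cvg (f_ := fun n (x : borel X) => a x (s n x))).
  move=> n; have [L LP] := simple_fun_seq (ss n).
  have -> : (fun x : borel X => a x (s n x)) = (fun x =>
      \sum_(v <- undup L) if x \in (s n @^-1` [set v]) then a x v else 0).
    apply/funext => x; rewrite (bigD1_seq (s n x)) ?undup_uniq ?mem_undup//=.
    rewrite mem_set// big1 ?addr0// => v vs; case: ifPn => // /set_mem /= sv.
    by rewrite sv eqxx in vs.
  apply: strongly_measurable_sum => v; apply: strongly_measurable_if.
    exact: (ss n).2.
  have h := continuous_strongly_measurable mu_support (@continuous_eval a v).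
  exact h.
move=> x; apply/cvg_rnormP => e e0.
have a1 : 0 < opnorm (a x) + 1 by rewrite ltr_wpDl ?opnorm_ge0.
have /cvg_rnormP/(_ _ (divr_gt0 e0 a1)) := sf x.
apply: filterS => n h.
rewrite -bop_sub (le_lt_trans (opnormM _ _))//.
rewrite (@le_lt_trans _ _ ((opnorm (a x) + 1) * rnorm (f x - s n x)))//.
  by rewrite ler_wpM2r ?rnorm_ge0// lerDl.
by rewrite mulrC -ltr_pdivlMr.
Qed.

Lemma int_norm_mult (a : A) (f : borel X -> E) : strongly_measurable f ->
  (int_norm mu (fun x : borel X => a x (f x)) <= (supnorm a)%:E * int_norm mu f)%E.
Proof.
move=> mf; rewrite -ge0_integralZl_EFin ?supnorm_ge0//; last 2 first.
- by move=> x _; rewrite lee_fin rnorm_ge0.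
- exact: measurable_rnorm.
apply: ge0_le_integral => //.
- by move=> x _; rewrite lee_fin rnorm_ge0.
- exact/measurable_rnorm/strongly_measurable_mult.
- by apply: measurable_funeM; exact: measurable_rnorm.
- move=> x _; rewrite -EFinM lee_fin (le_trans (opnormM _ _))//.
  by have := supnorm_ge a x; apply: ler_wpM2r; exact: rnorm_ge0.
Qed.

Lemma mult_opE (a : A) (u : L1 mu E) :
  ae_eq mu [set: borel X] (mult_op E mu a u : L1 mu E) (fun x : borel X => a x (u x)).
Proof.
apply: (L1_operatorE (K := fun f (x : borel X) => a x (f x)) (M := supnorm a)).
- by move=> k f g x; rewrite bop_linear.
- by move=> f g; apply: filterS => x fg _; rewrite fg.
- exact: strongly_measurable_mult.
- exact: int_norm_mult.
Qed.

End multiplication.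

(** * Push-forwards, the density cocycle and translation operators *)

Section pushforward.
Context d1 d2 (T : measurableType d1) (S : measurableType d2) (R : realType).
Variables (mu : {measure set T -> \bar R}) (phi : T -> S).
Hypothesis mphi : measurable_fun [set: T] phi.

(** The definitions mention a bare set function; this gives a bundled measure equal to it, together
    with the change of variables. *)
Lemma pushforward_measure : exists nu : {measure set S -> \bar R},
  (nu : set S -> \bar R) = pushforward mu phi /\
  forall f : S -> \bar R, measurable_fun [set: S] f -> (forall y, (0 <= f y)%E) ->
    (\int[nu]_y f y = \int[mu]_x f (phi x))%E.
Proof.
exists (measure_function_pushforward__canonical__measure_function_Measure mu mphi).
split=> // f mf f0.
have f0' : {in [set: S], forall y, (0 <= f y)%E} by move=> y _.
have := ge0_integral_pushforward mphi mu measurableT mf f0'.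
by rewrite preimage_setT.
Qed.

End pushforward.

Section translation.
Context (R : realType) (X : ptopologicalType) (G : groupType).
Context (mu : {sigma_finite_measure set (borel X) -> \bar R}) (t : G -> X -> X).
Hypothesis ht : homeo_action t.
Hypothesis pt : preserves_class mu t.

Lemma action1 x : t 1%g x = x.
Proof.
have [h [tK _ _ _]] := ht.1 1%g; apply: (can_inj tK).
by rewrite -[LHS]/((t 1%g \o t 1%g) x) -ht.2 mulg1.
Qed.

Lemma actionM g h x : t (g * h)%g x = t g (t h x).
Proof. by rewrite ht.2. Qed.

Lemma actionK g : cancel (t g) (t g^-1%g).
Proof. by move=> x; rewrite -actionM mulVg action1. Qed.

Lemma actionVK g : cancel (t g^-1%g) (t g).
Proof. by move=> x; rewrite -actionM mulgV action1. Qed.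

Lemma action_continuous g : continuous (t g).
Proof. by have [h []] := ht.1 g. Qed.

Lemma action_measurable g : measurable_fun [set: borel X] (t g : borel X -> borel X).
Proof.
apply: (@measurability _ _ (borel X) (borel X) setT (t g) (@open X)) => //.
move=> _ [B oB <-]; rewrite setTI.
apply: borel_open; move: (@action_continuous g) => /continuousP; exact.
Qed.

Lemma measurable_preimage_action g (Q : set (borel X)) : measurable Q ->
  measurable (t g @^-1` Q : set (borel X)).
Proof.
by move=> mQ; rewrite -[X in measurable X]setTI; exact: action_measurable.
Qed.

Definition density g : X -> R :=
  rn_derivative (pushforward mu (t g : borel X -> borel X)) mu.

Lemma sigma_finite_translate g (nu : {measure set (borel X) -> \bar R}) :
  (nu : set (borel X) -> \bar R) = pushforward mu (t g : borel X -> borel X) ->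
  sigma_finite [set: borel X] nu.
Proof.
move=> nuE; have /sigma_finite_cover[F [mF Foo _ FT]] :
  sigma_finite [set: borel X] mu by exact: sigma_finiteT.
exists (fun n => t g^-1%g @^-1` F n).
  by rewrite -preimage_bigcup FT preimage_setT.
move=> n; split; first exact: measurable_preimage_action.
rewrite nuE /pushforward -comp_preimage.
rewrite (_ : t g^-1%g \o t g = id) ?preimage_id//; first exact: Foo.
by apply/funext => x; exact: actionK.
Qed.

Lemma densityP g :
  is_density (pushforward mu (t g : borel X -> borel X)) mu (density g).
Proof.
have [nu [nuE _]] := pushforward_measure mu (action_measurable g).
have [|rho rhoP] := density_exists (sigma_finite_translate nuE) (mu := mu).
  by rewrite nuE; exact: pt.
rewrite nuE in rhoP.
rewrite /density /rn_derivative; case: xgetP => [r _ //|/(_ rho)]; exact.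
Qed.

Lemma density_ge0 g x : 0 <= density g x.
Proof. by case: (densityP g). Qed.

Lemma density_measurable g : measurable_fun [set: borel X] (density g : borel X -> R).
Proof. by case: (densityP g). Qed.

(** Both sides integrate [phi] against the push-forward of [mu]. This is the reason the translation
    operators are isometric. *)
Lemma integral_translation g (phi : borel X -> \bar R) :
  measurable_fun [set: borel X] phi -> (forall x, (0 <= phi x)%E) ->
  (\int[mu]_x (phi x * (density g x)%:E) = \int[mu]_x phi (t g x))%E.
Proof.
move=> mphi phi0; have [nu [nuE nuI]] := pushforward_measure mu (action_measurable g).
have dP := densityP g; rewrite -nuE in dP.
by rewrite -(density_integral dP mphi phi0) nuI.
Qed.

Lemma ae_translation g (P : X -> Prop) :
  {ae mu, forall x, P x} -> {ae mu, forall x, P (t g x)}.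
Proof.
move=> [A [mA A0 PA]]; exists (t g @^-1` A); split.
- exact: measurable_preimage_action.
- have : mu.-null_set A.
    move=> B mB BA; apply/eqP; rewrite eq_le measure_ge0 andbT -A0.
    by rewrite le_measure ?inE.
  by move=> /(pt g)/(_ A mA (@subset_refl _ A)).
- by move=> x nP; apply: PA.
Qed.

Lemma ae_eq_translation g (V : Type) (f f' : borel X -> V) :
  ae_eq mu [set: borel X] f f' ->
  ae_eq mu [set: borel X] (fun x : borel X => f (t g x)) (fun x : borel X => f' (t g x)).
Proof. exact: (@ae_translation g (fun x => [set: borel X] x -> f x = f' x)). Qed.

(** The chain rule for densities, which makes [T] multiplicative. Each density is an arbitrary
    choice, so the identity comes from uniqueness: both sides are densities of the push-forward
    under [t (g * h)]. *)
Lemma density_mul g h : ae_eq mu [set: borel X] (density (g * h)%g)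
  (fun x : borel X => density g x * density h (t g^-1%g x)).
Proof.
have [nu [nuE _]] := pushforward_measure mu (action_measurable (g * h)%g).
apply: (density_unique (sigma_finite_translate nuE)).
  by rewrite nuE; exact: densityP.
rewrite nuE; have mhg : measurable_fun [set: borel X]
    (fun x : borel X => density h (t g^-1%g x)).
  exact: (measurableT_comp (density_measurable h) (action_measurable g^-1%g)).
split=> [|x|Q mQ].
- exact: (measurable_funM (density_measurable g) mhg).
- by rewrite mulr_ge0// density_ge0.
have mind : measurable_fun [set: borel X] (fun x : borel X => (\1_Q x)%:E : \bar R).
  by apply/measurable_EFinP; exact: measurable_indic.
(* A change of variables by [t g] absorbs [density g], and a second one by [t h] absorbs
   [density h]. *)
transitivity (\int[mu]_x ((\1_Q x * density h (t g^-1%g x))%:E * (density g x)%:E))%E; last first.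
  rewrite [RHS]integral_mkcond; apply: eq_integral => x _.
  by rewrite epatch_indic /= -!EFinM; congr EFin; ring.
rewrite (integral_translation g); last 2 first.
- apply/measurable_EFinP; apply: measurable_funM => //.
- by move=> x; rewrite lee_fin mulr_ge0// density_ge0.
transitivity (\int[mu]_x ((\1_Q (t g x))%:E * (density h x)%:E))%E; last first.
  by apply: eq_integral => x _; rewrite actionK EFinM.
rewrite (integral_translation h (phi := fun x => (\1_Q (t g x))%:E)); last 2 first.
- exact: (measurableT_comp mind (action_measurable g)).
- by move=> x; rewrite lee_fin.
have mgh := measurable_preimage_action (g * h)%g mQ.
transitivity (\int[mu]_x (\1_(t (g * h)%g @^-1` Q) x)%:E)%E.
  by rewrite integral_indic// setIT.
by apply: eq_integral => x _; rewrite -actionM.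
Qed.

Lemma density1 : ae_eq mu [set: borel X] (density 1%g) (fun=> 1).
Proof.
have [nu [nuE _]] := pushforward_measure mu (action_measurable 1%g).
apply: (density_unique (sigma_finite_translate nuE)).
  by rewrite nuE; exact: densityP.
rewrite nuE; split => // Q mQ; rewrite integral_cst// mul1e /pushforward.
congr (mu _); apply/seteqP; split=> x /=; by rewrite action1.
Qed.

Context (E : normedModType R[i]).
Local Notation D := (L1 mu E).

Lemma strongly_measurable_translate g (f : borel X -> E) :
  strongly_measurable f ->
  strongly_measurable (fun x : borel X => (density g x)%:C *: f (t g^-1%g x)).
Proof.
move=> mf; apply: strongly_measurable_real_scale; first exact: density_measurable.
exact: (strongly_measurable_precomp (action_measurable g^-1%g) mf).
Qed.

Lemma int_norm_translate g (f : borel X -> E) : strongly_measurable f ->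
  int_norm mu (fun x : borel X => (density g x)%:C *: f (t g^-1%g x)) =
  int_norm mu f.
Proof.
move=> mf; transitivity (\int[mu]_x ((rnorm (f (t g^-1%g x)))%:E * (density g x)%:E))%E.
  apply: eq_integral => x _.
  by rewrite rnormZ rnorm_real ?density_ge0// mulrC EFinM.
rewrite (integral_translation g (phi := fun x => (rnorm (f (t g^-1%g x)))%:E)).
- by apply: eq_integral => x _; rewrite actionK.
- exact: (measurableT_comp (measurable_rnorm mf) (action_measurable g^-1%g)).
- by move=> x; rewrite lee_fin rnorm_ge0.
Qed.

Lemma translation_opE g (u : D) :
  ae_eq mu [set: borel X] (translation_op E mu t g u : D)
    (fun x : borel X => (density g x)%:C *: u (t g^-1%g x)).
Proof.
apply: (L1_operatorE (M := 1)
  (K := fun f (x : borel X) => (density g x)%:C *: f (t g^-1%g x))).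
- by move=> k f f' x; rewrite scalerDr !scalerA mulrC.
- by move=> f f' /(ae_eq_translation g^-1%g); apply: filterS => x ff' _; rewrite ff'.
- exact: strongly_measurable_translate.
- by move=> f mf; rewrite int_norm_translate// mul1e.
Qed.

Lemma rnorm_translation g (u : D) : rnorm (translation_op E mu t g u : D) = rnorm u.
Proof.
have mu_ := L1_strongly_measurable u; apply: EFin_inj.
rewrite (rnorm_L1_ae (strongly_measurable_translate g mu_) (translation_opE g u)).
by rewrite int_norm_translate// rnorm_L1.
Qed.

Lemma translation_opM g h :
  translation_op E mu t (g * h)%g = translation_op E mu t g * translation_op E mu t h.
Proof.
apply: bop_ext => u; pose v : D := translation_op E mu t h u.
rewrite -[RHS]/(translation_op E mu t g v).
apply: (L1_ext (translation_opE (g * h)%g u)).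
apply: (ae_eq_trans (translation_opE g v)).
apply: (filterS2 _ _ (ae_eq_translation g^-1%g (translation_opE h u))
  (density_mul g h)) => x h1 h2 _.
by rewrite h2// h1// scalerA -rmorphM invgM actionM.
Qed.

Lemma translation_op1 : translation_op E mu t 1%g = 1.
Proof.
apply: bop_ext => u; rewrite -[RHS]/u.
apply: (L1_ext (translation_opE 1%g u)); apply: filterS density1 => x h _.
by rewrite h// scale1r invg1 action1.
Qed.

End translation.

(** * The algebra of coefficients and the covariance relations *)

Section bounded_continuous_algebra.
Context (R : realType) (X : ptopologicalType).

Lemma cb_precomp_subproof (W : normedModType R[i]) (phi : X -> X)
    (cphi : continuous phi) (a : cbfun X W) : a \o phi \in @cbfun_pred R X W.
Proof.
have [ca [M aM]] := cbfunP a; apply/cbfun_predP; split.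
  by move=> x; apply: continuous_comp; [exact: cphi|exact: ca].
by exists M => x; exact: aM.
Qed.

Definition cb_precomp (W : normedModType R[i]) (phi : X -> X)
  (cphi : continuous phi) (a : cbfun X W) : cbfun X W :=
  CbFun (cb_precomp_subproof cphi a).

Context (E : normedModType R[i]).
Local Notation A := (cbfun X (bop E E)).

Lemma cb_mul_subproof (a b : A) : (fun x => a x * b x) \in @cbfun_pred R X (bop E E).
Proof.
have [ca _] := cbfunP a; have [cb _] := cbfunP b.
apply/cbfun_predP; split; last first.
  exists (supnorm a * supnorm b) => x.
  rewrite (le_trans (opnorm_mul (a x) (b x)))// ler_pM ?opnorm_ge0//.
    exact: (supnorm_ge a x).
  exact: (supnorm_ge b x).
move=> x; apply/continuous_rnormP => e e0.
pose M := supnorm a + supnorm b + 1.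
have a0 := supnorm_ge0 a; have b0 := supnorm_ge0 b.
have M0 : 0 < M by rewrite /M; lra.
have d0 : 0 < e / (2 * M) by rewrite divr_gt0// mulr_gt0.
have /continuous_rnormP/(_ _ d0) := ca x; have /continuous_rnormP/(_ _ d0) := cb x.
apply: filterS2 => y bxy axy.
have -> : a x * b x - a y * b y = (a x - a y) * b x + a y * (b x - b y).
  by rewrite mulrBl mulrBr addrA subrK.
have h1 : rnorm ((a x - a y) * b x) <= e / (2 * M) * supnorm b.
  rewrite (le_trans (opnorm_mul _ _))// ler_pM ?opnorm_ge0//; first exact: ltW.
  exact: (supnorm_ge b x).
have h2 : rnorm (a y * (b x - b y)) <= supnorm a * (e / (2 * M)).
  rewrite (le_trans (opnorm_mul _ _))// ler_pM ?opnorm_ge0//; last exact: ltW.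
  exact: (supnorm_ge a y).
rewrite (le_lt_trans (rnormD _ _))// (le_lt_trans (lerD h1 h2))//.
rewrite (mulrC (supnorm a)) -mulrDr (@le_lt_trans _ _ (e / (2 * M) * M))//.
  by rewrite ler_wpM2l ?(ltW d0)//; rewrite /M; lra.
have -> : e / (2 * M) * M = e / 2 by field; rewrite gt_eqF.
lra.
Qed.

Definition cb_mul (a b : A) : A := CbFun (cb_mul_subproof a b).

Lemma cb_one_subproof : (fun=> 1) \in @cbfun_pred R X (bop E E).
Proof.
apply/cbfun_predP; split; first by move=> x; exact: cvg_cst.
by exists (rnorm (1 : bop E E)).
Qed.

Definition cb_one : A := CbFun cb_one_subproof.

End bounded_continuous_algebra.

Lemma right_left_inverse (K : pzRingType) (f h h' : K) :
  h' * f = 1 -> f * h = 1 -> h = h'.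
Proof. by move=> h'f fh; rewrite -[h]mul1r -h'f -mulrA fh mulr1. Qed.

Lemma conj_of_commute (K : pzRingType) (f h m m' : K) :
  f * m = m' * f -> f * h = 1 -> f * m * h = m'.
Proof. by move=> -> fh; rewrite -mulrA fh mulr1. Qed.

Lemma bop_linE (R : realType) (V W : normedModType R[i]) (k : R[i])
  (f f' : bop V W) x : (k *: f + f') x = k *: f x + f' x.
Proof. by []. Qed.

Lemma cbfun_linE (R : realType) (X : ptopologicalType) (V : normedModType R[i])
  (k : R[i]) (a b : cbfun X V) x : (k *: a + b) x = k *: a x + b x.
Proof. by []. Qed.

Section operator_identities.
Context (R : realType) (X : ptopologicalType) (G : groupType) (E : normedModType R[i]).
Context (mu : {sigma_finite_measure set (borel X) -> \bar R}) (t : G -> X -> X).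
Hypothesis mu_support : measure_support mu = [set: X].
Hypothesis ht : homeo_action t.
Hypothesis pt : preserves_class mu t.
Local Notation D := (L1 mu E).
Local Notation A := (cbfun X (bop E E)).
Local Notation T := (translation_op E mu t).
Local Notation M := (mult_op E mu).

(** The inverse of the automorphism [hat_op g], which is [shift g^-1] on coefficients. It appears
    when a coefficient is moved to the right of [T g], and it reverses products of group
    elements. *)
Definition shift g (a : A) : A := cb_precomp (@action_continuous X G t ht g) a.

Lemma shiftE g (a : A) x : shift g a x = a (t g x).
Proof. by []. Qed.

Lemma shift_shift g h (a : A) : shift g (shift h a) = shift (h * g)%g a.
Proof. by apply: cbfun_ext => x; rewrite !shiftE actionM. Qed.

Lemma shift1 (a : A) : shift 1%g a = a.
Proof. by apply: cbfun_ext => x; rewrite shiftE (action1 ht). Qed.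

Lemma supnorm_shift g (a : A) : supnorm (shift g a) <= supnorm a.
Proof. by apply: supnorm_le => x; rewrite shiftE; exact: supnorm_ge. Qed.

Lemma mult_op_translation (a : A) g : M a * T g = T g * M (shift g a).
Proof.
apply: bop_ext => u; pose v : D := T g u; pose w : D := M (shift g a) u.
rewrite -[LHS]/(M a v) -[RHS]/(T g w).
have vE : ae_eq mu [set: borel X] v _ := translation_opE ht pt g u.
have wE : ae_eq mu [set: borel X] w _ := mult_opE mu_support (shift g a) u.
clearbody v w; apply: (L1_ext (mult_opE mu_support a v)).
apply: (ae_eq_trans (translation_opE ht pt g w)).
apply: (filterS2 _ _ vE (ae_eq_translation ht pt g^-1%g wE)) => x h1 h2 _.
by rewrite h1// h2// shiftE (actionVK ht) bop_scale.
Qed.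

Lemma mult_opM (a b : A) : M (cb_mul a b) = M a * M b.
Proof.
apply: bop_ext => u; pose v : D := M b u; rewrite -[RHS]/(M a v).
have vE : ae_eq mu [set: borel X] v _ := mult_opE mu_support b u.
clearbody v; apply: (L1_ext (mult_opE mu_support (cb_mul a b) u)).
apply: (ae_eq_trans (mult_opE mu_support a v)).
by apply: filterS vE => x h _; rewrite h.
Qed.

Lemma mult_op1 : M (cb_one X E) = 1.
Proof.
apply: bop_ext => u; rewrite -[RHS]/u.
by apply: (L1_ext (mult_opE mu_support (cb_one X E) u)); exact: ae_eq_eqfun.
Qed.

Lemma mult_op_linear : linear M.
Proof.
suff lin (k : R[i]) (a b : A) (u v w : D) : v = M a u -> w = M b u ->
    (M (k *: a + b) u : D) = k *: v + w.
  move=> k a b; apply: bop_ext => u.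
  apply: etrans (lin k a b u _ _ erefl erefl) _.
  exact: (esym (bop_linE k (M a) (M b) u)).
move=> va wb.
have vE : ae_eq mu [set: borel X] v (fun x : borel X => a x (u x)).
  by rewrite va; exact: mult_opE.
have wE : ae_eq mu [set: borel X] w (fun x : borel X => b x (u x)).
  by rewrite wb; exact: mult_opE.
apply: (L1_ext (mult_opE mu_support (k *: a + b) u)).
apply: (ae_eq_trans (L1DE (k *: v) w)).
apply: (filterS3 _ _ (L1ZE k v) vE wE) => x h1 h2 h3 _.
apply: etrans (congr1 (fun z => z + w x) (h1 I)) _.
apply: etrans (congr2 (fun z z' => k *: z + z') (h2 I) (h3 I)) _.
rewrite -bop_linE.
exact: (congr1 (fun f : bop E E => f (u x)) (esym (cbfun_linE k a b x))).
Qed.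

Lemma rnorm_mult_op (a : A) (u : D) :
  (rnorm (M a u))%:E = int_norm mu (fun x : borel X => a x (u x)).
Proof.
apply: (rnorm_L1_ae (strongly_measurable_mult mu_support a (L1_strongly_measurable u))).
exact: mult_opE.
Qed.

Lemma opnorm_mult_op (a : A) : opnorm (M a) <= supnorm a.
Proof.
apply: opnorm_le => u u1; rewrite -lee_fin rnorm_mult_op.
apply: le_trans (int_norm_mult mu_support a (L1_strongly_measurable u)) _.
by rewrite -rnorm_L1 -EFinM lee_fin ler_piMr// supnorm_ge0.
Qed.

Lemma translation_opV g : T g * T g^-1%g = 1.
Proof. by rewrite -(translation_opM ht pt E g g^-1%g) mulgV translation_op1. Qed.

(** [op_inv] picks some two-sided inverse, and inverses in a ring are unique. *)
Lemma op_inv_translation g : op_inv (T g) = T g^-1%g.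
Proof.
have TV : T g^-1%g * T g = 1 by rewrite -{2}[g]invgK translation_opV.
rewrite /op_inv; case: xgetP => [h _ [Th _]|/(_ (T g^-1%g))]; last first.
  by case; split; [exact: translation_opV|].
exact: right_left_inverse TV Th.
Qed.

Lemma hat_mult_op g (a : A) : hat_op t g (M a) = M (shift g^-1%g a).
Proof.
rewrite /hat_op op_inv_translation.
have := mult_op_translation (shift g^-1%g a) g.
rewrite shift_shift mulVg shift1 => h.
exact: conj_of_commute (esym h) (translation_opV g).
Qed.

Lemma translation_mult_op g (a : A) : T g * M a = M (shift g^-1%g a) * T g.
Proof.
have := mult_op_translation (shift g^-1%g a) g.
by rewrite shift_shift mulVg shift1 => h; exact: esym h.
Qed.

End operator_identities.

(** * The regular representation *)

Section l1_operators.
Context (R : realType) (G : groupType) (V : normedModType R[i]).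
Local Notation H := (l1fun G V).

Lemma diagonal_l1 (C : R) (B : G -> bop V V) (xi : H) : 0 <= C ->
  (forall g, opnorm (B g) <= C) ->
  (esum_norm (fun g => B g (xi g)) <= (C * rnorm xi)%:E)%E.
Proof.
move=> C0 BC; apply/esum_norm_leP => F.
have /l1norm_leP/(_ F) h := lexx (rnorm xi).
rewrite (le_trans _ (ler_wpM2l C0 h))// mulr_sumr; apply: ler_sum => g _.
by rewrite (le_trans (opnormM _ _))// ler_wpM2r ?rnorm_ge0.
Qed.

(** The uniform bound makes each image family summable and the operator bounded, so neither [mkl1]
    nor [mkop] falls back to its default 0. *)
Lemma diagonal_opE (C : R) (B : G -> bop V V) : 0 <= C ->
  (forall g, opnorm (B g) <= C) -> forall (xi : H) g,
  (mkop (fun xi : H => mkl1 (fun g => B g (xi g))) xi : H) g = B g (xi g).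
Proof.
move=> C0 BC.
have fin (xi : H) : (esum_norm (fun g => B g (xi g)) < +oo)%E.
  exact: le_lt_trans (diagonal_l1 xi C0 BC) (ltry _).
have bl : bounded_linear (fun xi : H => mkl1 (fun g => B g (xi g))).
  split=> [k xi eta|].
    apply: l1fun_ext => g; rewrite (mkl1E (fin _)).
    by rewrite -[RHS]/(k *: mkl1 _ g + mkl1 _ g) !(mkl1E (fin _)) bop_linear.
  exists C => xi; rewrite -lee_fin rnorm_l1funE l1normE.
  have -> : (mkl1 (fun g => B g (xi g)) : G -> V) = fun g => B g (xi g).
    by apply/funext; exact: mkl1E (fin xi).
  exact: diagonal_l1.
by move=> xi g; rewrite (mkopE bl); exact: mkl1E (fin xi) g.
Qed.

Lemma reindex_l1 (g0 : G) (xi : H) :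
  (esum_norm (fun g => xi (g * g0)%g) <= (rnorm xi)%:E)%E.
Proof.
apply/esum_norm_leP => F.
have inj : {in F &, injective (fun g => (g * g0)%g)} by move=> g h _ _; exact: mulIg.
have /l1norm_leP/(_ [fset (g * g0)%g | g in F]%fset) := lexx (rnorm xi).
by rewrite big_imfset.
Qed.

Lemma reg_opE (g0 : G) (xi : H) g : (reg_op G V g0 xi : H) g = xi (g * g0)%g.
Proof.
have fin (eta : H) : (esum_norm (fun g => eta (g * g0)%g) < +oo)%E.
  exact: le_lt_trans (reindex_l1 g0 eta) (ltry _).
have bl : bounded_linear (fun eta : H => mkl1 (fun g => eta (g * g0)%g)).
  split=> [k eta eta'|].
    apply: l1fun_ext => h; rewrite (mkl1E (fin _)).
    by rewrite -[RHS]/(k *: mkl1 _ h + mkl1 _ h) !(mkl1E (fin _)).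
  exists 1 => eta; rewrite mul1r -lee_fin rnorm_l1funE l1normE.
  have -> : (mkl1 (fun g => eta (g * g0)%g) : G -> V) = fun g => eta (g * g0)%g.
    by apply/funext; exact: mkl1E (fin eta).
  exact: reindex_l1.
by rewrite /reg_op (mkopE bl); exact: mkl1E (fin xi) g.
Qed.

Lemma reg_opM g h : reg_op G V (g * h)%g = reg_op G V g * reg_op G V h.
Proof.
apply: bop_ext => xi; apply: l1fun_ext => k.
rewrite -[RHS]/((reg_op G V g (reg_op G V h xi) : H) k).
by rewrite !reg_opE mulgA.
Qed.

Lemma reg_op1 : reg_op G V 1%g = 1.
Proof. by apply: bop_ext => xi; apply: l1fun_ext => k; rewrite reg_opE mulg1. Qed.

End l1_operators.

Lemma l1fun_linE (R : realType) (G : choiceType) (V : normedModType R[i])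
  (k : R[i]) (xi eta : l1fun G V) g : (k *: xi + eta) g = k *: xi g + eta g.
Proof. by []. Qed.

Section bar_operators.
Context (R : realType) (X : ptopologicalType) (G : groupType) (E : normedModType R[i]).
Context (mu : {sigma_finite_measure set (borel X) -> \bar R}) (t : G -> X -> X).
Hypothesis mu_support : measure_support mu = [set: X].
Hypothesis ht : homeo_action t.
Hypothesis pt : preserves_class mu t.
Local Notation D := (L1 mu E).
Local Notation A := (cbfun X (bop E E)).
Local Notation H := (l1fun G D).
Local Notation M := (mult_op E mu).
Local Notation bar := (bar_op E mu t).
Local Notation V := (reg_op G D).
Local Notation shift := (shift ht).

Lemma bar_opE (a : A) (xi : H) g :
  (bar a xi : H) g = M (shift g^-1%g a) (xi g).
Proof.
rewrite /bar_op; under eq_fun do under eq_fun do rewrite (hat_mult_op mu_support ht pt).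
apply: (diagonal_opE (supnorm_ge0 a)) => h.
exact: le_trans (opnorm_mult_op mu_support _) (supnorm_shift ht _ _).
Qed.

Lemma bar_op_linear : linear bar.
Proof.
move=> k a b; apply: bop_ext => xi; apply: l1fun_ext => g.
have h c := bar_opE c xi g; apply: etrans (h _) _.
have e : shift g^-1%g (k *: a + b) = k *: shift g^-1%g a + shift g^-1%g b.
  exact: cbfun_ext.
have {}e := etrans (congr1 M e) (mult_op_linear mu_support k _ _).
apply: etrans (congr1 (fun f : bop D D => f (xi g)) e) _.
apply: etrans (bop_linE k _ _ (xi g)) _.
apply: etrans (congr2 (fun x y : D => k *: x + y) (esym (h a)) (esym (h b))) _.
apply: etrans (esym (l1fun_linE k (bar a xi) (bar b xi) g)) _.
exact: (congr1 (fun eta : H => eta g) (esym (bop_linE k (bar a) (bar b) xi))).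
Qed.

Lemma bar_opM (a b : A) : bar (cb_mul a b) = bar a * bar b.
Proof.
apply: bop_ext => xi; apply: l1fun_ext => g.
apply: etrans (bar_opE _ xi g) (esym _).
apply: etrans (bar_opE a (bar b xi) g) _.
apply: etrans (congr1 (M _) (bar_opE b xi g)) _.
have e : shift g^-1%g (cb_mul a b) = cb_mul (shift g^-1%g a) (shift g^-1%g b).
  exact: cbfun_ext.
have {}e := etrans (congr1 M e) (mult_opM mu_support _ _).
exact: (congr1 (fun f : bop D D => f (xi g)) (esym e)).
Qed.

Lemma bar_op1 : bar (cb_one X E) = 1.
Proof.
apply: bop_ext => xi; apply: l1fun_ext => g.
apply: etrans (bar_opE _ xi g) _.
have e : shift g^-1%g (cb_one X E) = cb_one X E by exact: cbfun_ext.
have {}e := etrans (congr1 M e) (mult_op1 E mu_support).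
exact: (congr1 (fun f : bop D D => f (xi g)) e).
Qed.

Lemma reg_bar_op g (a : A) : V g * bar a = bar (shift g^-1%g a) * V g.
Proof.
apply: bop_ext => xi; apply: l1fun_ext => k.
apply: etrans (reg_opE g (bar a xi) k) _; apply: etrans (bar_opE a xi _) _.
apply: esym; apply: etrans (bar_opE _ (V g xi) k) _.
apply: etrans (congr1 (M _) (reg_opE g xi k)) _.
by rewrite (shift_shift ht) invgM.
Qed.

End bar_operators.

(** * Completeness of the Bochner space *)

Lemma geometric_partial_sum (R : realType) (C : R) n : 0 <= C ->
  \sum_(0 <= k < n) C * 2^-1 ^+ k <= 2 * C.
Proof.
move=> C0; have -> : \sum_(0 <= k < n) C * 2^-1 ^+ k = 2 * C - 2 * C * 2^-1 ^+ n.
  elim: n => [|n IH]; first by rewrite big_geq// expr0 mulr1 subrr.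
  by rewrite big_nat_recr//= IH exprS; lra.
by rewrite gerBl !mulr_ge0// exprn_ge0// invr_ge0.
Qed.

Section summable_variation.
Context (R : realType) (V : normedModType R[i]).

Lemma rnorm_telescope (u : nat -> V) N m : (N <= m)%N ->
  rnorm (u m - u N) <=
  \sum_(0 <= k < m) rnorm (u k.+1 - u k) - \sum_(0 <= k < N) rnorm (u k.+1 - u k).
Proof.
move=> /subnK <-; elim: (m - N)%N => [|n IH]; first by rewrite !subrr rnorm0.
rewrite addSn (le_trans (rnorm_triangle (u (n + N)%N) _ _))//.
by rewrite [in leRHS]big_nat_recr//= addrAC addrC lerD.
Qed.

End summable_variation.

Lemma summable_variation_cvg (R : realType) (E : completeNormedModType R[i])
    (u : nat -> E) :
  (\sum_(0 <= n <oo) (rnorm (u n.+1 - u n))%:E < +oo)%E -> cvg (u @ \oo).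
Proof.
move=> fin; pose s n := \sum_(0 <= k < n) rnorm (u k.+1 - u k).
set S := (\sum_(0 <= n <oo) _)%E in fin.
have sS n : ((s n)%:E <= S)%E.
  rewrite -sumEFin; apply: nneseries_lim_ge => k _ _.
  by rewrite lee_fin rnorm_ge0.
have Sfin : S \is a fin_num.
  rewrite ge0_fin_numE//; apply: le_trans (sS 0%N).
  by rewrite lee_fin /s big_geq.
have /cvg_ex[l sl] : cvg (s @ \oo).
  apply: nondecreasing_is_cvgn.
    move=> n m nm; rewrite /s -subr_ge0; apply: le_trans (rnorm_telescope u nm).
    exact: rnorm_ge0.
  by exists (fine S) => _ [n _ <-]; rewrite -lee_fin fineK.
apply: cauchy_rnorm_cvg => e e0.
have /cvgrPdist_lt/(_ _ (divr_gt0 e0 (ltr0n R 2)))[N _ HN] := sl.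
exists N => m Nm; rewrite (le_lt_trans (rnorm_telescope u Nm))//.
have := HN m Nm; have := HN N (leqnn N); rewrite /= !ltr_norml /s.
by move=> /andP[h1 h2] /andP[h3 h4]; lra.
Qed.

Section riesz_fischer.
Context d (T : measurableType d) (R : realType) (mu : {measure set T -> \bar R}).
Context (E : completeNormedModType R[i]).

Lemma int_norm_fatou (M : R) (f : nat -> T -> E) (g : T -> E) :
  (forall n, strongly_measurable (f n)) ->
  (forall x, f n x @[n --> \oo] --> g x) ->
  (forall n, (int_norm mu (f n) <= M%:E)%E) -> (int_norm mu g <= M%:E)%E.
Proof.
move=> mf fg fM.
have gE x : (rnorm (g x))%:E = limn_einf (fun n => (rnorm (f n x))%:E).
  have h : (rnorm (f n x))%:E @[n --> \oo] --> (rnorm (g x))%:E.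
    apply: cvg_EFin; first exact: nearW.
    by apply: continuous_cvg; [exact: rnorm_continuous|exact: fg].
  by rewrite (cvg_limn_einf_sup h).1.
rewrite /int_norm; under eq_integral do rewrite gE.
apply: le_trans (fatou _ _ _ _) _ => //.
- by move=> n; exact: measurable_rnorm.
- by move=> n x _; rewrite lee_fin rnorm_ge0.
rewrite limn_einf_lim; apply: lime_le; first exact: is_cvg_einfs.
apply: nearW => n; apply: le_trans (fM n).
by apply: ereal_inf_lbound; exists n => /=.
Qed.

(** The sum of the pointwise increments has integral at most [2 * C], so almost every point has
    finite variation and the functions converge there. The rate in norm then comes from Fatou. *)
Lemma rapidly_complete_L1 : rapidly_complete (L1 mu E).
Proof.
move=> C u C0 uC.
pose f n : T -> E := (u n : L1 mu E).
have mf n : strongly_measurable (f n) by exact: L1_strongly_measurable.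
have mdf n m : strongly_measurable (fun x => f m x - f n x).
  apply: (@strongly_measurable2 _ _ _ _ _ (fun v w : E => v - w)) => // v w.
  exact: sub_continuous.
have normf n m : (rnorm (u m - u n))%:E = int_norm mu (fun x => f m x - f n x).
  apply: (rnorm_L1_ae (mdf n m)).
  have mN : ae_eq mu [set: T] (- u n : L1 mu E) (fun x => - f n x).
    by rewrite -scaleN1r; apply: filterS (L1ZE (-1) (u n)) => x h _; rewrite h// scaleN1r.
  apply: (ae_eq_trans (L1DE (u m) (- u n))).
  by apply: filterS mN => x h _; rewrite h.
pose S x := (\sum_(0 <= n <oo) (rnorm (f n.+1 x - f n x))%:E)%E.
have mS : measurable_fun [set: T] S.
  apply: ge0_emeasurable_sum => [n x _ _|n _]; first by rewrite lee_fin rnorm_ge0.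
  exact: (measurable_rnorm (mdf n n.+1)).
have S0 x : (0 <= S x)%E.
  by apply: nneseries_ge0 => n _ _; rewrite lee_fin rnorm_ge0.
have intS : (\int[mu]_x S x <= (2 * C)%:E)%E.
  rewrite integral_nneseries//; last 2 first.
  - by move=> n; exact: (measurable_rnorm (mdf n n.+1)).
  - by move=> n x _; rewrite lee_fin rnorm_ge0.
  apply: lime_le.
    by apply: is_cvg_nneseries => n _ _; apply: integral_ge0 => x _;
      rewrite lee_fin rnorm_ge0.
  apply: nearW => n; apply: (@le_trans _ _ (\sum_(0 <= k < n) (C * 2^-1 ^+ k)%:E)%E).
    by apply: lee_sum => k _; rewrite -/(int_norm _ _) -normf lee_fin; exact: uC.
  by rewrite sumEFin lee_fin geometric_partial_sum.
have aeS : {ae mu, forall x, (S x < +oo)%E}.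
  have : mu.-integrable [set: T] S.
    apply/integrableP; split => //; under eq_integral do rewrite gee0_abs//.
    exact: le_lt_trans intS (ltry _).
  move=> /(integrable_ae measurableT); apply: filterS => x /(_ I).
  by rewrite ge0_fin_numE.
pose Q := [set x | (S x < +oo)%E].
have mQ : measurable Q.
  by rewrite -[X in measurable X]setTI; exact: emeasurable_fun_infty_o.
(* Strong measurability asks for convergence at every point, so the functions are set to 0 where the
   variation is infinite. *)
pose f' n x := if x \in Q then f n x else 0.
have mf' n : strongly_measurable (f' n) by exact: strongly_measurable_if.
have f'f n : ae_eq mu [set: T] (f' n) (f n).
  by apply: filterS aeS => x Sx _; rewrite /f' mem_set.
have cf' x : cvg (f' n x @[n --> \oo]).
  have [xQ|xQ] := boolP (x \in Q); last first.
    have -> : f'^~ x = (fun=> 0) by apply/funext => n; rewrite /f' (negbTE xQ).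
    exact: is_cvg_cst.
  have -> : f'^~ x = f^~ x by apply/funext => n; rewrite /f' xQ.
  exact: summable_variation_cvg (set_mem xQ).
pose g x : E := lim (f' n x @[n --> \oo]).
have f'g x : f' n x @[n --> \oo] --> g x by exact: cf'.
have mg : strongly_measurable g := strongly_measurable_cvg mf' f'g.
have mdg n : strongly_measurable (fun x => g x - f' n x).
  apply: (@strongly_measurable2 _ _ _ _ _ (fun v w : E => v - w)) => // v w.
  exact: sub_continuous.
have gf n : (int_norm mu (fun x => g x - f' n x)%R <= (2 * C * 2^-1 ^+ n)%:E)%E.
  (* The limit is taken in [m] with [n] fixed, through differences whose norms [rapid_partial]
     bounds uniformly in [m]. *)
  apply: (int_norm_fatou (f := fun m x => f' (m + n)%N x - f' n x)).
  - move=> m; apply: (@strongly_measurable2 _ _ _ _ _ (fun v w : E => v - w)) => // v w.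
    exact: sub_continuous.
  - by move=> x; apply: cvgB; [rewrite (cvg_shiftn n (f'^~ x))|exact: cvg_cst].
  - move=> m; rewrite (@ae_eq_int_norm _ _ _ _ _ _ (fun x => f (m + n)%N x - f n x))//.
    + rewrite -normf lee_fin (le_trans (rapid_partial C0 uC (leq_addl m n)))//.
      by rewrite gerBl !mulr_ge0// exprn_ge0// invr_ge0.
    + apply: (@strongly_measurable2 _ _ _ _ _ (fun v w : E => v - w)) => // v w.
      exact: sub_continuous.
    + by apply: filterS2 (f'f (m + n)%N) (f'f n) => x h h' _; rewrite h// h'.
have gI : bochner_integrable mu g.
  split=> //; have -> : g = (fun x => g x - f' 0%N x) + f' 0%N.
    by apply/funext => x; rewrite /= subrK.
  apply: le_lt_trans (int_normD _ (mdg 0%N) (mf' 0%N)) _.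
  rewrite lte_add_pinfty//; first exact: le_lt_trans (gf 0%N) (ltry _).
  by rewrite (ae_eq_int_norm (mf' 0%N) (mf 0%N) (f'f 0%N)) -rnorm_L1 ltry.
exists (mkL1 mu g) => n; rewrite -lee_fin; apply: le_trans (gf n).
have mN : ae_eq mu [set: T] (- u n : L1 mu E) (fun x => - f n x).
  by rewrite -scaleN1r; apply: filterS (L1ZE (-1) (u n)) => x h _; rewrite h// scaleN1r.
rewrite (rnorm_L1_ae (mdg n))//.
apply: (ae_eq_trans (L1DE (mkL1 mu g) (- u n))).
by apply: (filterS3 _ _ (mkL1E gI) mN (f'f n)) => x h1 h2 h3 _; rewrite h1// h2// h3.
Qed.

End riesz_fischer.

(** * Norms of finite sums of weighted translations *)

Lemma ler_sum_fsub (R : realType) (I : choiceType) (F F' : {fset I}) (f : I -> R) :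
  (forall i, 0 <= f i) -> {subset F <= F'} ->
  \sum_(i <- F) f i <= \sum_(i <- F') f i.
Proof.
move=> f0 FF'; rewrite [leRHS](big_fsetID _ (fun i => i \in F))/=.
have -> : [fset x in F' | x \in F]%fset = F.
  by apply/fsetP => i; rewrite !inE andbC; apply: andb_idr; exact: FF'.
by rewrite lerDl sumr_ge0.
Qed.

Lemma bop_sumE (R : realType) (V W : normedModType R[i]) (I : Type) (r : seq I)
    (f : I -> bop V W) x : (\sum_(i <- r) f i) x = \sum_(i <- r) f i x.
Proof. by elim: r => [|i r IH]; rewrite ?big_nil// !big_cons -IH. Qed.

Lemma l1fun_sumE (R : realType) (G : choiceType) (V : normedModType R[i])
    (I : Type) (r : seq I) (f : I -> l1fun G V) g :
  (\sum_(i <- r) f i) g = \sum_(i <- r) f i g.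
Proof. by elim: r => [|i r IH]; rewrite ?big_nil// !big_cons -IH. Qed.

Lemma L1_sumE d (T : measurableType d) (R : realType)
    (mu : {measure set T -> \bar R}) (E : normedModType R[i]) (I : Type)
    (r : seq I) (u : I -> L1 mu E) (f : I -> T -> E) :
  (forall i, ae_eq mu [set: T] (u i) (f i)) ->
  ae_eq mu [set: T] (\sum_(i <- r) u i : L1 mu E) (fun x => \sum_(i <- r) f i x).
Proof.
move=> uf; elim: r => [|i r IH].
  by rewrite big_nil; apply: filterS (L10E mu E) => x h _; rewrite big_nil h.
rewrite big_cons; apply: (ae_eq_trans (L1DE _ _)).
by apply: filterS2 (uf i) IH => x h1 h2 _; rewrite big_cons h1// h2.
Qed.

Lemma rnorm_sum_disjoint (R : realType) (V : normedModType R[i]) (I : eqType)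
    (r : seq I) (f : I -> V) : uniq r ->
  (forall i j, i \in r -> j \in r -> f i != 0 -> f j != 0 -> i = j) ->
  rnorm (\sum_(i <- r) f i) = \sum_(i <- r) rnorm (f i).
Proof.
elim: r => [_ _|i r IH /= /andP[ir ur] fr]; first by rewrite !big_nil rnorm0.
rewrite !big_cons; have [fi0|fi] := eqVneq (f i) 0.
  rewrite fi0 add0r rnorm0 add0r; apply: IH => // j k jr kr.
  by apply: fr; rewrite inE ?jr ?kr orbT.
have f0 j : j \in r -> f j = 0.
  move=> jr; apply/eqP; apply: contraNT ir => fj.
  by rewrite (fr i j) ?inE ?eqxx ?jr ?orbT.
have -> : \sum_(j <- r) f j = 0 by rewrite big_seq big1.
have -> : \sum_(j <- r) rnorm (f j) = 0.
  by rewrite big_seq big1// => j /f0 ->; exact: rnorm0.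
by rewrite !addr0.
Qed.

Section disjoint_translates.
Context (X : topologicalType) (G : groupType) (t : G -> X -> X).
Hypothesis hausX : hausdorff_space X.
Hypothesis tM : forall g h x, t (g * h)%g x = t g (t h x).
Hypothesis tK : forall g, cancel (t g) (t g^-1%g).
Hypothesis ct : forall g, continuous (t g).
Hypothesis free : topologically_free t.

(** Induction on the list of pairs, shrinking [W] once for each pair. The set [W] cannot consist of
    fixed points of [k^-1 * h], so some point has distinct images under [t h] and [t k], and these
    are separated by open sets. *)
Lemma disjoint_translates (s : seq (G * G)) (U : set X) :
  (forall p, p \in s -> p.1 != p.2) -> open U -> U !=set0 ->
  exists W, [/\ open W, W !=set0, W `<=` U &
    forall p x y, p \in s -> W x -> W y -> t p.1 x <> t p.2 y].
Proof.
move=> + oU U0; elim: s => [_|[h k] s IH sP]; first by exists U; split.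
have [|W [oW W0 WU WP]] := IH; first by move=> p ps; apply: sP; rewrite inE ps orbT.
have hk : h != k by apply: (sP (h, k)); rewrite inE eqxx.
have [x [Wx xhk]] : exists x, W x /\ t h x <> t k x.
  apply: contrapT => /forallNP nex; have [x0 Wx0] := W0.
  have : [set x | t (k^-1 * h)%g x = x]^° x0.
    apply: (filterS _ (open_nbhs_nbhs (conj oW Wx0))) => x Wx /=.
    have htk : t h x = t k x by apply: contrapT => ne; apply: (nex x).
    by rewrite tM htk tK.
  rewrite free// -[1%g](mulVg k); apply: contra hk => /eqP/mulgI ->.
  exact: eqxx.
have := hausX; rewrite open_hausdorff => /(_ (t h x) (t k x)) [|[P Q]/=].
  exact/eqP.
move=> [/set_mem Ph /set_mem Qk] [oP oQ PQ0].
exists (W `&` (t h @^-1` P `&` t k @^-1` Q)); split.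
- apply: openI => //; apply: openI.
    by move: (@ct h) => /continuousP; exact.
  by move: (@ct k) => /continuousP; exact.
- by exists x.
- by move=> y [/WU].
- move=> p y z; rewrite inE => /orP[/eqP ->|ps] [Wy [Py Qy]] [Wz [Pz Qz]] /=; last first.
    exact: WP.
  move=> e; have : (P `&` Q) (t h y) by split=> //; rewrite e.
  by move/eqP: PQ0 => ->.
Qed.

End disjoint_translates.

Section norm_estimates.
Context (R : realType) (X : ptopologicalType) (G : groupType) (E : normedModType R[i]).
Context (mu : {sigma_finite_measure set (borel X) -> \bar R}) (t : G -> X -> X).
Hypothesis mu_support : measure_support mu = [set: X].
Hypothesis ht : homeo_action t.
Hypothesis pt : preserves_class mu t.
Local Notation D := (L1 mu E).
Local Notation A := (cbfun X (bop E E)).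
Local Notation H := (l1fun G D).
Local Notation T := (translation_op E mu t).
Local Notation M := (mult_op E mu).
Local Notation bar := (bar_op E mu t).
Local Notation V := (reg_op G D).
Local Notation shift := (shift ht).
Implicit Types (F : {fset G}) (a : G -> A).

(* Both kinds of finite sums turn out to have norm at most C exactly under this
   condition, which does not see the group structure beyond the translates. *)
Definition fiber_bound (C : R) F a := forall (y : X) (e : E),
  \sum_(h <- F) rnorm (a h (t h y) e) <= C * rnorm e.

(** The pointwise inequality is integrated. The coefficients enter untwisted so that the regular
    representation can use the lemma with coefficients moved by a further group element. *)
Lemma sum_mult_bound (C : R) F a (u : D) : 0 <= C ->
  (forall y e, \sum_(h <- F) rnorm (a h y e) <= C * rnorm e) ->
  \sum_(h <- F) rnorm (M (a h) u : D) <= C * rnorm u.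
Proof.
move=> C0 aC; rewrite -lee_fin -sumEFin EFinM rnorm_L1.
under eq_bigr do rewrite (rnorm_mult_op mu_support).
have mu_ := L1_strongly_measurable u.
have ma h := measurable_rnorm (strongly_measurable_mult mu_support (a h) mu_).
rewrite -ge0_integral_sum//; last by move=> h x _; rewrite lee_fin rnorm_ge0.
rewrite /int_norm -ge0_integralZl_EFin//; last 2 first.
- by move=> x _; rewrite lee_fin rnorm_ge0.
- exact: measurable_rnorm.
apply: ge0_le_integral => //.
- by move=> x _; apply: sume_ge0 => h _; rewrite lee_fin rnorm_ge0.
- by apply: emeasurable_sum => h; exact: ma.
- by apply: measurable_funeM; exact: measurable_rnorm.
- by move=> x _; rewrite sumEFin -EFinM lee_fin; exact: aC.
Qed.

Lemma fiber_bound_mult (C : R) F a (u : D) : 0 <= C -> fiber_bound C F a ->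
  \sum_(h <- F) rnorm (M (shift h (a h)) u : D) <= C * rnorm u.
Proof. by move=> C0 aC; apply: (sum_mult_bound (a := fun h => shift h (a h))). Qed.

(** The premise is an estimate on vectors rather than on fibres because that is the form in which
    the regular representation returns it. *)
Lemma fin_sum_mult_le (C : R) F a :
  (forall u : D, \sum_(h <- F) rnorm (M (shift h (a h)) u : D) <= C * rnorm u) ->
  0 <= C -> opnorm (fin_sum M T F a) <= C.
Proof.
move=> aC C0; apply: opnorm_le => u u1.
have -> : fin_sum M T F a u = \sum_(h <- F) (M (a h) * T h) u by exact: bop_sumE.
rewrite (le_trans (rnorm_sum _ _ _))// (@le_trans _ _ (C * rnorm u))//; last first.
  by rewrite ler_piMr.
apply: le_trans (aC u); apply: ler_sum => h _.
rewrite (mult_op_translation mu_support ht pt (a h) h).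
by rewrite -(rnorm_translation ht pt h (M (shift h (a h)) u)).
Qed.

Hypothesis hausX : hausdorff_space X.
Hypothesis free : topologically_free t.

(** An excess at a single [y] spreads to an open set by continuity of the coefficients. A test
    function equal to [e] on a suitable part of that set then violates the norm bound. *)
Lemma fiber_bound_of_norm (C : R) F a : 0 <= C ->
  opnorm (fin_sum M T F a) <= C -> fiber_bound C F a.
Proof.
move=> C0 nC y e; rewrite leNgt; apply/negP => lty.
pose phi x := \sum_(h <- F) rnorm (a h (t h x) e).
(* The midpoint leaves room on both sides: [c < phi y] makes [U] nonempty, and [C * rnorm e < c]
   gives the final strict inequality. *)
pose c := (C * rnorm e + phi y) / 2.
have [Cc cy] : C * rnorm e < c /\ c < phi y by move: lty; rewrite -/(phi y) /c; lra.
have cphi : continuous phi.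
  have ch h : continuous (fun x => rnorm (a h (t h x) e)).
    move=> x; apply: (@continuous_comp _ _ _ (fun x => a h (t h x) e)).
      exact: (@continuous_eval _ _ _ (shift h (a h)) e x).
    exact: rnorm_continuous.
  rewrite /phi; elim: (enum_fset F) => [|h r IH].
    by under eq_fun do rewrite big_nil; move=> x; exact: cvg_cst.
  under eq_fun do rewrite big_cons.
  by move=> x; exact: cvgD (ch h x) (IH x).
pose U := phi @^-1` [set r | c < r].
have oU : open U by move: cphi => /continuousP; apply; exact: open_gt.
pose s := [seq p <- [seq (h, k) | h <- F, k <- F] | p.1 != p.2].
have [||W [oW W0 WU WP]] := disjoint_translates hausX (actionM ht) (actionK ht)
  (@action_continuous _ _ _ ht) free (s := s) _ oU.
- by move=> p; rewrite mem_filter => /andP[].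
- by exists y.
have /sigma_finite_cover[K [mK Koo _ KT]] : sigma_finite [set: borel X] mu
  by exact: sigma_finiteT.
have mW := borel_open oW.
have [n Kn] := positive_part mK KT mW (open_measure_gt0 mu_support oW W0).
(* Finite measure makes the test function integrable; positive measure is needed to cancel [mu Q] at
   the end. *)
set Q : set (borel X) := W `&` K n in Kn.
have mQ : measurable Q by exact: measurableI.
have Qfin : mu Q \is a fin_num.
  rewrite ge0_fin_numE ?measure_ge0//; apply: le_lt_trans (Koo n).
  by apply: le_measure; rewrite ?inE//; exact: subIsetr.
have indQ : (\int[mu]_x (\1_Q x)%:E = mu Q)%E.
  by rewrite (integral_indic mu measurableT mQ) setIT.
pose d0 (x : borel X) := if x \in Q then e else 0.
have md0 : strongly_measurable d0.
  by apply: strongly_measurable_if => //; exact: strongly_measurable_cst.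
have nd0 : int_norm mu d0 = ((rnorm e)%:E * mu Q)%E.
  rewrite -indQ -ge0_integralZl_EFin//.
  - apply: eq_integral => x _; rewrite /d0 indicE -EFinM.
    by case: (x \in Q); rewrite ?mulr1 ?mulr0 ?rnorm0.
  - by apply/measurable_EFinP; exact: measurable_indic.
  - exact: rnorm_ge0.
have Id0 : bochner_integrable mu d0.
  by split=> //; rewrite nd0 -(fineK Qfin) -EFinM ltry.
pose u : D := mkL1 mu d0.
have uE : ae_eq mu [set: borel X] u d0 by exact: mkL1E.
pose rep h (x : borel X) := a h x ((density mu t h x)%:C *: d0 (t h^-1%g x)).
have mrep h : strongly_measurable (rep h).
  apply: (strongly_measurable_mult mu_support (a h)).
  exact: (strongly_measurable_translate ht pt h md0).
have repE h : ae_eq mu [set: borel X] (M (a h) (T h u) : D) (rep h).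
  apply: (ae_eq_trans (mult_opE mu_support (a h) (T h u))).
  apply: (filterS2 _ _ (translation_opE ht pt h u) (ae_eq_translation ht pt h^-1%g uE)).
  by move=> x h1 h2 _; rewrite h1// h2.
have sumE : ae_eq mu [set: borel X] (fin_sum M T F a u : D)
    (fun x => \sum_(h <- F) rep h x).
  have -> : fin_sum M T F a u = \sum_(h <- F) (M (a h) (T h u) : D) by exact: bop_sumE.
  exact: L1_sumE.
(* The change of variables by [t h] absorbs the density and brings the term to the fibre over
   [x]. *)
have int_rep h : int_norm mu (rep h) =
    (\int[mu]_x (rnorm (a h (t h x) (d0 x)))%:E)%E.
  have mah : measurable_fun [set: borel X]
      (fun x : borel X => (rnorm (a h x (d0 (t h^-1%g x))))%:E).
    apply: measurable_rnorm; apply: (strongly_measurable_mult mu_support (a h)).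
    exact: (strongly_measurable_precomp (action_measurable ht h^-1%g) md0).
  transitivity (\int[mu]_x ((rnorm (a h x (d0 (t h^-1%g x))))%:E * (density mu t h x)%:E))%E.
    apply: eq_integral => x _.
    by rewrite /rep bop_scale rnormZ rnorm_real ?(density_ge0 ht pt)// mulrC EFinM.
  rewrite (integral_translation ht pt h mah).
    by apply: eq_integral => x _; rewrite (actionK ht).
  by move=> x; rewrite lee_fin rnorm_ge0.
have normE : (rnorm (fin_sum M T F a u : D))%:E =
    (\int[mu]_x (\sum_(h <- F) (rnorm (a h (t h x) (d0 x)))%:E))%E.
  rewrite (rnorm_L1_ae _ sumE); last exact: strongly_measurable_sum.
  transitivity (\int[mu]_x (\sum_(h <- F) (rnorm (rep h x))%:E))%E.
    apply: eq_integral => x _; rewrite sumEFin rnorm_sum_disjoint// => h k hF kF.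
    (* The term with index [l] lives on the translate of [W] by [t l]; these translates are
       disjoint, so at most one term is nonzero at any point. *)
    have supp l : rep l x != 0 -> exists2 z, W z & x = t l z.
      rewrite /rep /d0; case: ifPn => [/set_mem[Wz _] _|_].
        by exists (t l^-1%g x) => //; rewrite (actionVK ht).
      by rewrite scaler0 bop_at0 eqxx.
    move=> /supp[z Wz xz] /supp[w Ww xw]; apply/eqP; apply: contrapT => /negP hk.
    apply: (WP (h, k) z w) => //; last by rewrite /= -xz -xw.
    rewrite mem_filter hk/=; apply/allpairsP; exists (h, k); split => //.
  rewrite ge0_integral_sum//; last 2 first.
  - by move=> h; exact: measurable_rnorm.
  - by move=> h x _; rewrite lee_fin rnorm_ge0.
  rewrite ge0_integral_sum//; last 2 first.
  - move=> h; apply: measurable_rnorm.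
    exact: (strongly_measurable_mult mu_support (shift h (a h)) md0).
  - by move=> h x _; rewrite lee_fin rnorm_ge0.
  by apply: eq_bigr => h _; exact: int_rep.
(* On [Q], which lies inside [U], the integrand is [phi x] and exceeds [c]. *)
have : (c%:E * mu Q <= (rnorm (fin_sum M T F a u : D))%:E)%E.
  have c0 : 0 <= c by rewrite (le_trans _ (ltW Cc))// mulr_ge0// rnorm_ge0.
  rewrite normE -indQ.
  rewrite -ge0_integralZl_EFin//; last first.
    by apply/measurable_EFinP; exact: measurable_indic.
  apply: ge0_le_integral => //.
  - by move=> x _; rewrite mule_ge0 ?lee_fin.
  - apply: measurable_funeM; apply/measurable_EFinP; exact: measurable_indic.
  - apply: emeasurable_sum => h; apply: measurable_rnorm.
    exact: (strongly_measurable_mult mu_support (shift h (a h)) md0).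
  - move=> x _; rewrite indicE /d0 sumEFin; case: ifPn => [/set_mem[Wx _]|_].
      by rewrite mule1 lee_fin; apply: ltW; exact: (WU x Wx).
    by rewrite mule0 lee_fin; apply: sumr_ge0 => h _; exact: rnorm_ge0.
(* The test function has norm [rnorm e * mu Q], so the operator bound gives at most
   [C * rnorm e * mu Q], strictly below [c * mu Q]. *)
apply/negP; rewrite -ltNge.
apply: (@le_lt_trans _ _ (C%:E * (rnorm u)%:E)%E).
  rewrite -EFinM lee_fin (le_trans (opnormM _ _))//.
  by rewrite ler_wpM2r ?rnorm_ge0.
rewrite (rnorm_L1_ae md0 uE) nd0 muleA -EFinM -(fineK Qfin) -!EFinM lte_fin.
by rewrite ltr_pM2r// -lte_fin fineK.
Qed.

Lemma fin_sum_mult_leP (C : R) F a : 0 <= C ->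
  opnorm (fin_sum M T F a) <= C <-> fiber_bound C F a.
Proof.
move=> C0; split; first exact: fiber_bound_of_norm.
by move=> aC; apply: fin_sum_mult_le => // u; exact: fiber_bound_mult.
Qed.

End norm_estimates.

(** * Norms of finite sums in the regular representation *)

Section regular_norm.
Context (R : realType) (X : ptopologicalType) (G : groupType) (E : normedModType R[i]).
Context (mu : {sigma_finite_measure set (borel X) -> \bar R}) (t : G -> X -> X).
Hypothesis mu_support : measure_support mu = [set: X].
Hypothesis ht : homeo_action t.
Hypothesis pt : preserves_class mu t.
Local Notation D := (L1 mu E).
Local Notation A := (cbfun X (bop E E)).
Local Notation H := (l1fun G D).
Local Notation T := (translation_op E mu t).
Local Notation M := (mult_op E mu).
Local Notation bar := (bar_op E mu t).
Local Notation V := (reg_op G D).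
Local Notation shift := (shift ht).
Implicit Types (F : {fset G}) (a : G -> A).

Lemma fin_sum_barE F a (xi : H) g :
  (fin_sum bar V F a xi : H) g =
  \sum_(h <- F) (M (shift g^-1%g (a h)) (xi (g * h)%g) : D).
Proof.
have -> : fin_sum bar V F a xi = \sum_(h <- F) (bar (a h) (V h xi) : H).
  exact: bop_sumE.
rewrite l1fun_sumE; apply: eq_bigr => h _.
apply: etrans (bar_opE mu_support ht pt (a h) (V h xi) g) _.
exact: (congr1 (M (shift g^-1%g (a h))) (reg_opE h xi g)).
Qed.

(* After the substitution k = g h the inner sums become those of [sum_mult_bound]. *)
Lemma fin_sum_bar_le (C : R) F a : 0 <= C -> fiber_bound t C F a ->
  opnorm (fin_sum bar V F a) <= C.
Proof.
move=> C0 aC; apply: opnorm_le => xi xi1; apply/l1norm_leP => K.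
pose b g h : D := M (shift g^-1%g (a h)) (xi (g * h)%g).
pose c k h : D := M (shift k^-1%g (shift h (a h))) (xi k).
have bc g h : b g h = c (g * h)%g h.
  by rewrite /b /c (shift_shift ht) invgM mulgA mulgV mul1g.
(* [K'] holds every product that occurs, so the range of [k] no longer depends on [h]; enlarging the
   range only adds nonnegative terms. *)
pose K' := [fset (g * h)%g | g in K, h in F]%fset.
apply: (@le_trans _ _ (\sum_(g <- K) \sum_(h <- F) rnorm (b g h))).
  by apply: ler_sum => g _; rewrite fin_sum_barE; exact: rnorm_sum.
rewrite exchange_big/=.
apply: (@le_trans _ _ (\sum_(h <- F) \sum_(k <- K') rnorm (c k h))).
  rewrite big_seq [leRHS]big_seq; apply: ler_sum => h hF.
  have inj : {in K &, injective (fun g => (g * h)%g)} by move=> g g' _ _; exact: mulIg.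
  under eq_bigr do rewrite bc.
  have <- : \sum_(k <- [fset (g * h)%g | g in K]%fset) rnorm (c k h) =
      \sum_(g <- K) rnorm (c (g * h)%g h) by rewrite big_imfset.
  apply: ler_sum_fsub => [k|k]; first exact: rnorm_ge0.
  by case/imfsetP => g gK ->; apply/imfset2P; exists g => //; exists h.
rewrite exchange_big/=.
apply: (@le_trans _ _ (\sum_(k <- K') C * rnorm (xi k))).
  apply: ler_sum => k _.
  apply: (sum_mult_bound mu_support (a := fun h => shift k^-1%g (shift h (a h)))) => //.
  by move=> y e; exact: aC (t k^-1%g y) e.
rewrite -mulr_sumr.
have /l1norm_leP/(_ K') h := xi1.
by rewrite (le_trans (ler_wpM2l C0 h))// mulr1.
Qed.

Definition delta1 (u : D) : G -> D := fun g => if g == 1%g then u else 0.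

Lemma delta1_l1 (u : D) : (esum_norm (delta1 u) <= (rnorm u)%:E)%E.
Proof.
apply/esum_norm_leP => F; have [F1|F1] := boolP (1%g \in F).
  rewrite (big_fsetD1 1%g F1)/= {1}/delta1 eqxx big_seq big1 ?addr0// => g.
  by rewrite !inE => /andP[g1 _]; rewrite /delta1 (negbTE g1) rnorm0.
rewrite big_seq big1 ?rnorm_ge0// => g gF; rewrite /delta1; case: eqP => [g1|_].
  by rewrite -g1 gF in F1.
by rewrite rnorm0.
Qed.

(** The sum is applied to [u] placed at the identity. Its component at [h^-1] comes from the index
    [h] alone, so the l1 norm over [G] separates the terms. *)
Lemma fin_sum_bar_ge (C : R) F a (u : D) : 0 <= C ->
  opnorm (fin_sum bar V F a) <= C ->
  \sum_(h <- F) rnorm (M (shift h (a h)) u : D) <= C * rnorm u.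
Proof.
move=> C0 aC; have l1 : (esum_norm (delta1 u) < +oo)%E.
  exact: le_lt_trans (delta1_l1 u) (ltry _).
pose xi : H := mkl1 (delta1 u).
have xiE g : xi g = delta1 u g by exact: mkl1E.
have xiu : rnorm xi <= rnorm u.
  by apply/l1norm_leP => K; under eq_bigr do rewrite xiE;
    exact: (esum_norm_leP _ _).1 (delta1_l1 u) K.
have nxi : rnorm (fin_sum bar V F a xi) <= C * rnorm u.
  rewrite (le_trans (opnormM _ _))// (@le_trans _ _ (C * rnorm xi))//.
    by rewrite ler_wpM2r ?rnorm_ge0.
  by rewrite ler_wpM2l.
have inj : {in F &, injective (fun g : G => g^-1%g)} by move=> g g' _ _; exact: invg_inj.
have /l1norm_leP/(_ [fset g^-1%g | g in F]%fset) := nxi.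
rewrite big_imfset//= => h; apply: le_trans h.
rewrite big_seq [leRHS]big_seq le_eqVlt; apply/orP; left; apply/eqP.
apply: eq_bigr => h hF; rewrite fin_sum_barE invgK (big_fsetD1 h hF)/=.
rewrite [X in _ + X]big_seq [X in _ + X]big1 ?addr0 => [|k].
  by rewrite mulVg xiE /delta1 eqxx.
rewrite !inE => /andP[kh _]; rewrite xiE /delta1 ifN ?bop_at0//.
by apply: contra kh => /eqP e; rewrite -[k]mul1g -(mulgV h) -mulgA e mulg1.
Qed.

Hypothesis hausX : hausdorff_space X.
Hypothesis free : topologically_free t.

(** In each inequality the constant [C] is the norm on the other side. *)
Lemma fin_sum_bar_norm F a :
  opnorm (fin_sum bar V F a) = opnorm (fin_sum M T F a).
Proof.
apply/eqP; rewrite eq_le; apply/andP; split.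
  apply: fin_sum_bar_le (opnorm_ge0 _) _.
  by apply/(fin_sum_mult_leP mu_support ht pt hausX free _ _ (opnorm_ge0 _)).
apply: (fin_sum_mult_le (ht := ht) mu_support pt) => [u|]; last exact: opnorm_ge0.
exact: fin_sum_bar_ge (opnorm_ge0 _) (lexx _).
Qed.

End regular_norm.

(** * Formal sums and their products *)

Section formal_sums.
Context (R : realType) (G : groupType) (A V : normedModType R[i]).
Variables (rep : A -> bop V V) (U : G -> bop V V).
Hypothesis rep_linear : linear rep.
Implicit Types (s : seq (G * A)) (F : {fset G}) (a : G -> A).

(* Finite sums indexed by lists, where an index may occur several times: unlike
   [fin_sum], their products and sums need no rearrangement. *)
Definition formal_sum s : bop V V := \sum_(p <- s) rep p.2 * U p.1.

Definition coefficient (g : G) s : A := \sum_(p <- s | p.1 == g) p.2.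

Definition formal_support s : {fset G} := [fset g in [seq p.1 | p <- s]]%fset.

Definition formal_scale (k : R[i]) s := [seq (p.1, k *: p.2) | p <- s].

Definition formal_of F a : seq (G * A) := [seq (g, a g) | g <- F].

Lemma rep0 : rep 0 = 0.
Proof. by have := rep_linear (-1) 0 0; rewrite !scaleN1r !addNr. Qed.

Lemma repD v w : rep (v + w) = rep v + rep w.
Proof. by have := rep_linear 1 v w; rewrite !scale1r. Qed.

Lemma repZ k v : rep (k *: v) = k *: rep v.
Proof. by have := rep_linear k v 0; rewrite !addr0 rep0 addr0. Qed.

Lemma rep_sum (I : Type) (r : seq I) (P : pred I) (f : I -> A) :
  rep (\sum_(i <- r | P i) f i) = \sum_(i <- r | P i) rep (f i).
Proof. exact: (big_morph rep repD rep0). Qed.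

Lemma bop_scalerAl k (f f' : bop V V) : k *: f * f' = k *: (f * f').
Proof. exact: bop_ext. Qed.

Lemma bop_scalerAr k (f f' : bop V V) : f * (k *: f') = k *: (f * f').
Proof. by apply: bop_ext => x; exact: bop_scale. Qed.

(** Linearity of [rep] merges the entries with equal index. [F] may be larger than the set of
    indices that occur, the extra coefficients being 0. *)
Lemma formal_sum_fin F s : (forall p, p \in s -> p.1 \in F) ->
  formal_sum s = fin_sum rep U F (coefficient^~ s).
Proof.
move=> sF; rewrite /fin_sum /coefficient.
under eq_bigr do rewrite rep_sum mulr_suml.
rewrite (exchange_big_dep xpredT)//= /formal_sum big_seq [RHS]big_seq.
apply: eq_bigr => p ps; rewrite -big_filter.
have -> : [seq g <- F | p.1 == g] = [:: p.1].
  rewrite -(filter_pred1_uniq (fset_uniq F) (sF p ps)).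
  by apply: eq_filter => g; rewrite /= eq_sym.
by rewrite big_seq1.
Qed.

Lemma formal_supportP s p : p \in s -> p.1 \in formal_support s.
Proof. by move=> ps; rewrite inE /= map_f. Qed.

Lemma formal_sum_of F a : formal_sum (formal_of F a) = fin_sum rep U F a.
Proof. by rewrite /formal_sum big_map. Qed.

Lemma coefficient_of F a g :
  coefficient g (formal_of F a) = if g \in F then a g else 0.
Proof.
rewrite /coefficient big_map/=; case: ifPn => gF.
  by rewrite -big_filter (filter_pred1_uniq (fset_uniq F) gF) big_seq1.
rewrite big_seq_cond big1// => h /andP[hF /eqP hg].
by rewrite hg (negbTE gF) in hF.
Qed.

Lemma coefficient_notin s g : g \notin formal_support s -> coefficient g s = 0.
Proof.
move=> gs; rewrite /coefficient big_seq_cond big1// => p /andP[ps /eqP pg].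
by rewrite -pg formal_supportP in gs.
Qed.

Lemma formal_sum_cat s s' : formal_sum (s ++ s') = formal_sum s + formal_sum s'.
Proof. exact: big_cat. Qed.

Lemma coefficient_cat g s s' :
  coefficient g (s ++ s') = coefficient g s + coefficient g s'.
Proof. exact: big_cat. Qed.

Lemma formal_sum_scale k s : formal_sum (formal_scale k s) = k *: formal_sum s.
Proof.
rewrite /formal_sum big_map scaler_sumr; apply: eq_bigr => p _.
by rewrite /= repZ bop_scalerAl.
Qed.

Lemma coefficient_scale g k s :
  coefficient g (formal_scale k s) = k *: coefficient g s.
Proof. by rewrite /coefficient big_map scaler_sumr. Qed.

Lemma gen_algP b :
  gen_alg rep U b <-> forall e : R, 0 < e -> exists s, rnorm (b - formal_sum s) < e.
Proof.
split=> [/closure_rnormP cb e e0|cb].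
  by have [_ [F [a ->]] be] := cb e e0; exists (formal_of F a); rewrite formal_sum_of.
apply/closure_rnormP => e e0; have [s be] := cb e e0.
exists (formal_sum s) => //; exists (formal_support s), (coefficient^~ s).
exact: formal_sum_fin (@formal_supportP s).
Qed.

End formal_sums.

Section formal_product.
Context (R : realType) (G : groupType) (A V : normedModType R[i]).
Variables (mul : A -> A -> A) (sh : G -> A -> A).

(** The product of the algebraic crossed product. The action [sh] is a parameter, so that one list
    multiplies correctly in both representations. *)
Definition formal_mul (s s' : seq (G * A)) : seq (G * A) :=
  [seq ((p.1 * q.1)%g, mul p.2 (sh p.1 q.2)) | p <- s, q <- s'].

Variables (rep : A -> bop V V) (U : G -> bop V V).
Hypothesis repM : forall a b, rep (mul a b) = rep a * rep b.
Hypothesis covariant : forall g a, U g * rep a = rep (sh g a) * U g.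
Hypothesis UM : forall g h, U (g * h)%g = U g * U h.

Lemma formal_sum_mul s s' :
  formal_sum rep U (formal_mul s s') = formal_sum rep U s * formal_sum rep U s'.
Proof.
rewrite /formal_sum big_allpairs_dep/= mulr_suml; apply: eq_bigr => p _.
rewrite mulr_sumr; apply: eq_bigr => q _.
by rewrite repM UM -!mulrA; congr (_ * _); rewrite !mulrA covariant.
Qed.

End formal_product.

(** * The isomorphism, the coefficient maps and invariance under characters *)

Section isomorphism.
Context (R : realType) (X : ptopologicalType) (E : completeNormedModType R[i]).
Context (G : groupType).
Context (mu : {sigma_finite_measure set (borel X) -> \bar R}) (t : G -> X -> X).
Hypothesis hausX : hausdorff_space X.
Hypothesis mu_support : measure_support mu = [set: X].
Hypothesis ht : homeo_action t.
Hypothesis pt : preserves_class mu t.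
Hypothesis free : topologically_free t.
Local Notation D := (L1 mu E).
Local Notation A := (cbfun X (bop E E)).
Local Notation H := (l1fun G D).
Local Notation T := (translation_op E mu t).
Local Notation M := (mult_op E mu).
Local Notation bar := (bar_op E mu t).
Local Notation V := (reg_op G D).
Local Notation shift := (shift ht).
Local Notation sumT := (formal_sum M T).
Local Notation sumV := (formal_sum bar V).
Implicit Types (F : {fset G}) (a : G -> A) (s : seq (G * A)).

Let linM : linear M := @mult_op_linear R X E mu mu_support.
Let linbar : linear bar := @bar_op_linear R X G E mu t mu_support ht pt.

Lemma rnorm_formal_sum s : rnorm (sumV s) = rnorm (sumT s).
Proof.
rewrite (formal_sum_fin T linM (@formal_supportP _ _ _ s)).
rewrite (formal_sum_fin V linbar (@formal_supportP _ _ _ s)).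
exact: fin_sum_bar_norm.
Qed.

(** One list read in both representations. It need not be determined by [b]; equality of norms makes
    the relation single valued in both directions. *)
Definition sum_rel (b : bop D D) (c : bop H H) := exists s, b = sumT s /\ c = sumV s.

Lemma sum_rel_linear : rel_linear sum_rel.
Proof.
move=> k _ _ _ _ [s [-> ->]] [s' [-> ->]]; exists (formal_scale k s ++ s').
by rewrite !formal_sum_cat (formal_sum_scale T linM) (formal_sum_scale V linbar).
Qed.

Lemma sum_rel_contractive : rel_contractive sum_rel.
Proof. by move=> _ _ [s [-> ->]]; rewrite rnorm_formal_sum. Qed.

Lemma sum_rel_expansive : rel_contractive (fun c b => sum_rel b c).
Proof. by move=> _ _ [s [-> ->]]; rewrite rnorm_formal_sum. Qed.

Lemma sum_rel_mul b c b' c' :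
  sum_rel b c -> sum_rel b' c' -> sum_rel (b * b') (c * c').
Proof.
move=> [s [-> ->]] [s' [-> ->]].
exists (formal_mul (@cb_mul R X E) (fun g => shift g^-1%g) s s'); split.
  apply: esym; apply: formal_sum_mul; first exact: mult_opM.
    exact: translation_mult_op.
  exact: translation_opM.
apply: esym; apply: formal_sum_mul; first exact: bar_opM.
  exact: reg_bar_op.
exact: reg_opM.
Qed.

Lemma rel_closure_gen_alg b c :
  rel_closure sum_rel b c -> gen_alg M T b /\ gen_alg bar V c.
Proof.
move=> bc; split; [apply/(gen_algP T linM)|apply/(gen_algP V linbar)] => e e0;
  have [_ [_ [[s [-> ->]] h h']]] := bc e e0; by exists s.
Qed.

(** Off the generated algebra the value is the default 0; only values on the algebra enter
    [isometric_alg_iso]. *)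
Definition Phi (b : bop D D) : bop H H := xget 0 [set c | rel_closure sum_rel b c].

Let cL1 : rapidly_complete D := @rapidly_complete_L1 _ _ _ mu E.

Lemma PhiP b : gen_alg M T b -> rel_closure sum_rel b (Phi b).
Proof.
move=> gb; rewrite /Phi; case: xgetP => // nex.
have [c bc] : exists c, rel_closure sum_rel b c.
  apply: (rel_closure_total _ sum_rel_linear sum_rel_contractive).
    exact/rapidly_complete_bop/rapidly_complete_l1fun.
  apply/closure_rnormP => e e0; have [s bs] := (gen_algP T linM b).1 gb e e0.
  by exists (sumT s) => //; exists (sumV s), s.
by have := nex c.
Qed.

Lemma Phi_rel b c : rel_closure sum_rel b c -> Phi b = c.
Proof.
move=> bc; have [gb _] := rel_closure_gen_alg bc.
apply: (rel_contractive_unique (rel_closure_linear sum_rel_linear)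
  (rel_closure_contractive sum_rel_contractive) (PhiP gb) bc).
Qed.

Lemma rnorm_rel_closure b c : rel_closure sum_rel b c -> rnorm c = rnorm b.
Proof.
move=> bc; apply/eqP; rewrite eq_le.
rewrite (rel_closure_contractive sum_rel_contractive bc).
by move/rel_closureC : bc => /(rel_closure_contractive sum_rel_expansive) ->.
Qed.

(** The inverse relation is contractive as well, so the extension argument runs backwards, now using
    completeness of [D]. *)
Lemma Phi_surjective c : gen_alg bar V c -> exists2 b, gen_alg M T b & Phi b = c.
Proof.
move=> gc.
have expl : rel_linear (fun c b => sum_rel b c).
  by move=> k v w v' w' h h'; exact: sum_rel_linear h h'.
have [b bc] : exists b, rel_closure (fun c b => sum_rel b c) c b.
  apply: (rel_closure_total _ expl sum_rel_expansive).
    exact/rapidly_complete_bop.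
  apply/closure_rnormP => e e0; have [s bs] := (gen_algP V linbar c).1 gc e e0.
  by exists (sumV s) => //; exists (sumT s), s.
have {}bc : rel_closure sum_rel b c by apply/rel_closureC.
by exists b; [have [] := rel_closure_gen_alg bc|exact: Phi_rel].
Qed.

Lemma Phi_iso : isometric_alg_iso (gen_alg M T) (gen_alg bar V) Phi.
Proof.
have Phi_lin (k : R[i]) b c : gen_alg M T b -> gen_alg M T c ->
    Phi (k *: b + c) = k *: Phi b + Phi c.
  move=> gb gc; apply: Phi_rel.
  exact: rel_closure_linear sum_rel_linear _ _ _ _ _ (PhiP gb) (PhiP gc).
have Phi_norm b : gen_alg M T b -> rnorm (Phi b) = rnorm b.
  by move=> gb; exact: rnorm_rel_closure (PhiP gb).
split; [split|exact: Phi_lin| |].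
  + by move=> b gb; have [_] := rel_closure_gen_alg (PhiP gb).
  + move=> b c /set_mem gb /set_mem gc e.
    (* Injectivity: the difference of the two pairs relates [c - b] to 0, and the closed relation
       preserves norms. *)
    have bc : rel_closure sum_rel (- 1 *: b + c) (- 1 *: Phi b + Phi c).
      exact: rel_closure_linear sum_rel_linear _ _ _ _ _ (PhiP gb) (PhiP gc).
    have := rnorm_rel_closure bc; rewrite e !scaleN1r addNr rnorm0 => /esym/rnorm_eq0/eqP.
    by rewrite addrC subr_eq0 => /eqP ->.
  + by move=> c gc; have [b gb <-] := Phi_surjective gc; exists b.
- move=> b c gb gc; apply: Phi_rel.
  exact: rel_closure_mul sum_rel_mul (PhiP gb) (PhiP gc).
- by move=> b gb; apply/rnorm_normE; exact: Phi_norm.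
Qed.

Lemma Phi_mult (v : A) : Phi (M v) = bar v.
Proof.
apply: Phi_rel; apply: subset_rel_closure; exists [:: (1%g, v)].
rewrite /formal_sum !big_seq1/= (translation_op1 ht pt E) reg_op1.
by rewrite !mulr1.
Qed.

Lemma Phi_translation g : Phi (T g) = V g.
Proof.
apply: Phi_rel; apply: subset_rel_closure; exists [:: (g, cb_one X E)].
rewrite /formal_sum !big_seq1/= (mult_op1 E mu_support) (bar_op1 E mu_support ht pt).
by rewrite !mul1r.
Qed.

(** A single term of the fibre sum is at most the whole sum; the fibre over [t h^-1 x] is the one in
    which [a h] is evaluated at [x]. All coefficients are covered, which gives [property_star] and
    the contractivity of every coefficient map. *)
Lemma coefficient_bound F a h : h \in F -> rnorm (a h) <= rnorm (fin_sum M T F a).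
Proof.
move=> hF; apply: supnorm_le => x; apply: opnorm_le => e e1.
have := (fin_sum_mult_leP mu_support ht pt hausX free F a
  (opnorm_ge0 (fin_sum M T F a))).1 (lexx _) (t h^-1%g x) e.
rewrite (big_fsetD1 h hF)/= (actionVK ht) => le.
apply: le_trans (le_trans _ le) _.
  by rewrite lerDl sumr_ge0// => k _; exact: rnorm_ge0.
by rewrite ler_piMr// opnorm_ge0.
Qed.

Lemma coefficient_contractive g s : rnorm (coefficient g s) <= rnorm (sumT s).
Proof.
have [gs|gs] := boolP (g \in formal_support s); last first.
  by rewrite coefficient_notin// rnorm0 rnorm_ge0.
rewrite (formal_sum_fin T linM (@formal_supportP _ _ _ s)).
exact: (coefficient_bound (fun h => coefficient h s) gs).
Qed.

Definition coef_rel g (b : bop D D) (v : A) :=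
  exists s, b = sumT s /\ v = coefficient g s.

Lemma coef_rel_linear g : rel_linear (coef_rel g).
Proof.
move=> k _ _ _ _ [s [-> ->]] [s' [-> ->]]; exists (formal_scale k s ++ s').
by rewrite formal_sum_cat coefficient_cat (formal_sum_scale T linM) coefficient_scale.
Qed.

Lemma coef_rel_contractive g : rel_contractive (coef_rel g).
Proof. by move=> _ _ [s [-> ->]]; exact: coefficient_contractive. Qed.

Definition coef_map g (b : bop D D) : A := xget 0 [set v | rel_closure (coef_rel g) b v].

Lemma coef_mapP g b : gen_alg M T b -> rel_closure (coef_rel g) b (coef_map g b).
Proof.
move=> gb; rewrite /coef_map; case: xgetP => // nex.
have [v bv] : exists v, rel_closure (coef_rel g) b v.
  apply: (rel_closure_total _ (@coef_rel_linear g) (@coef_rel_contractive g)).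
    exact/rapidly_complete_cbfun/rapidly_complete_bop/complete_rapidly.
  apply/closure_rnormP => e e0; have [s bs] := (gen_algP T linM b).1 gb e e0.
  by exists (sumT s) => //; exists (coefficient g s), s.
by have := nex v.
Qed.

Lemma coef_map_rel g b v : gen_alg M T b ->
  rel_closure (coef_rel g) b v -> coef_map g b = v.
Proof.
move=> gb bv; exact: (rel_contractive_unique (rel_closure_linear (@coef_rel_linear g))
  (rel_closure_contractive (@coef_rel_contractive g)) (coef_mapP g gb) bv).
Qed.

Lemma formal_sum_gen_alg s : gen_alg M T (sumT s).
Proof. by apply/(gen_algP T linM) => e e0; exists s; rewrite subrr rnorm0. Qed.

Lemma coef_map_formal_sum g s : coef_map g (sumT s) = coefficient g s.
Proof.
apply: (coef_map_rel (@formal_sum_gen_alg s)).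
by apply: subset_rel_closure; exists s.
Qed.

Lemma coef_map_lipschitz g b c : gen_alg M T b -> gen_alg M T c ->
  rnorm (coef_map g b - coef_map g c) <= rnorm (b - c).
Proof.
move=> gb gc.
have := rel_closure_linear (@coef_rel_linear g) (-1) (coef_mapP g gc) (coef_mapP g gb).
move=> /(rel_closure_contractive (@coef_rel_contractive g)).
by rewrite !scaleN1r ![- _ + _]addrC.
Qed.

Lemma coef_map_coefficient_maps : coefficient_maps M T coef_map.
Proof.
move=> g; split=> [|F a].
  apply/subspace_continuousP => b gb; apply/cvg_rnormP => e e0.
  apply: filterS (near_rnorm b e0) => c bc gc.
  exact: le_lt_trans (coef_map_lipschitz g gb gc) bc.
by rewrite -(formal_sum_of M T F a) coef_map_formal_sum coefficient_of.
Qed.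

(** With [s] approximating [b] to within [e / 3], it suffices that [sumT s] has norm at most
    [2 * (e / 3)]. A finer approximant [s'] has all coefficients at most [r], since those of [b]
    vanish; so on the support [F] of [s] the coefficients of [s] are nearly those of the difference,
    whose fibre sums are controlled. *)
Lemma coef_map_injective b : gen_alg M T b -> (forall g, coef_map g b = 0) -> b = 0.
Proof.
move=> gb b0; apply: eq_of_rnorm => e e0.
have e30 : 0 < e / 3 by rewrite divr_gt0.
have [s bs] := (gen_algP T linM b).1 gb _ e30.
pose F := formal_support s; pose n : R := (size F)%:R.
have n0 : 0 <= n by exact: ler0n.
(* Chosen so that [r + n * r = e / 3]: one [r] pays for the distance from [s'] to [b], and [n * r]
   for the coefficients of [s'] on [F]. Since [s] is chosen first, [n] is fixed by now. *)
pose r := e / 3 / (1 + n); have r0 : 0 < r by rewrite divr_gt0// ltr_wpDr.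
have rn : r + n * r = e / 3.
  by rewrite -{1}[r]mul1r -mulrDl mulrC divfK// gt_eqF// ltr_wpDr.
have [s' bs'] := (gen_algP T linM b).1 gb _ r0.
have small h : rnorm (coefficient h s') <= r.
  have := coef_map_lipschitz h (@formal_sum_gen_alg s') gb.
  rewrite b0 subr0 coef_map_formal_sum rnorm_sub_sym => /le_trans; apply; exact: ltW.
pose s2 := s ++ formal_scale (-1) s'.
have s2E : sumT s2 = sumT s - sumT s'.
  by rewrite formal_sum_cat (formal_sum_scale T linM) scaleN1r.
have c2E h : coefficient h s2 = coefficient h s - coefficient h s'.
  by rewrite coefficient_cat coefficient_scale scaleN1r.
have er0 : 0 <= e / 3 + r by rewrite addr_ge0// ltW.
have n2 : rnorm (sumT s2) <= e / 3 + r.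
  rewrite s2E (le_trans (rnorm_triangle b _ _))// lerD//; last exact: ltW.
  by rewrite rnorm_sub_sym ltW.
rewrite (formal_sum_fin T linM (@formal_supportP _ _ _ s2)) in n2.
have fb := (fin_sum_mult_leP mu_support ht pt hausX free _ _ er0).1 n2.
have sub : {subset F <= formal_support s2}.
  by move=> h; rewrite !inE /= map_cat mem_cat => ->.
pose a h : A := coefficient h s; pose a' h : A := coefficient h s'.
pose a2 h : A := coefficient h s2.
have fbs : fiber_bound t (2 * (e / 3)) F a.
  move=> y v; apply: (@le_trans _ _ (\sum_(h <- F)
      (rnorm (a2 h (t h y) v) + r * rnorm v))).
    apply: ler_sum => h _.
    have ah : a h = 1 *: a2 h + a' h by rewrite scale1r /a2 c2E subrK.
    have {}ah : a h (t h y) v = 1 *: a2 h (t h y) v + a' h (t h y) v.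
      rewrite ah; apply: etrans (bop_linE 1 _ _ v).
      exact: (congr1 (fun f : bop E E => f v) (cbfun_linE 1 (a2 h) (a' h) (t h y))).
    rewrite scale1r in ah; rewrite ah.
    apply: le_trans (rnormD _ _) _; rewrite lerD2l.
    apply: le_trans (opnormM (a' h (t h y)) v) _.
    have le := le_trans (supnorm_ge (a' h) (t h y)) (small h).
    exact: ler_wpM2r (rnorm_ge0 v) _ _ le.
  (* The support of [s2] may be far larger than [F]; restricting a sum of nonnegative terms to [F]
     keeps the bound. *)
  have h : \sum_(h <- F) rnorm (a2 h (t h y) v) <= (e / 3 + r) * rnorm v.
    by apply: le_trans (fb y v); apply: ler_sum_fsub => // h; exact: rnorm_ge0.
  rewrite big_split/= big_const_seq count_predT iter_addr_0 -[X in _ + X]mulr_natl -/n.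
  apply: le_trans (lerD h (lexx _)) _; rewrite (mulrA n r) -mulrDl.
  apply: ler_wpM2r (rnorm_ge0 v) _ _ _.
  by rewrite -addrA rn mulrDl mul1r.
have e320 : 0 <= 2 * (e / 3) by rewrite mulr_ge0// ltW.
have nc := (fin_sum_mult_leP mu_support ht pt hausX free _ _ e320).2 fbs.
rewrite -(formal_sum_fin T linM (@formal_supportP _ _ _ s)) in nc.
have h : rnorm (sumT s - 0) <= 2 * (e / 3) by rewrite subr0; exact: nc.
apply: le_trans (rnorm_triangle (sumT s) b 0) _.
apply: le_trans (lerD (ltW bs) h) _.
by rewrite [leRHS](_ : e = e / 3 + 2 * (e / 3)); last by field.
Qed.

Lemma mult_property_star : property_star M T.
Proof. by move=> F a F1; rewrite le_rnorm_norm; exact: (coefficient_bound a F1). Qed.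

Lemma mult_property_star_star : property_star_star M T.
Proof.
split; first exact: mult_property_star.
exists coef_map; split; first exact: coef_map_coefficient_maps.
move=> b gb; split=> [b0 g|]; last exact: coef_map_injective.
have e0 : sumT [::] = 0 by rewrite /formal_sum big_nil.
by rewrite b0 -e0 coef_map_formal_sum /coefficient big_nil.
Qed.

(** The fibre condition sees only the norms of vectors, which unimodular factors preserve. One
    inequality is enough, since the pointwise inverse of [chi] is unimodular too and gives the
    other. *)
Lemma fin_sum_character_le F a chi : (forall g, `|chi g| = 1) ->
  rnorm (fin_sum M T F (fun g => chi g *: a g)) <= rnorm (fin_sum M T F a).
Proof.
move=> chi1; have n0 := opnorm_ge0 (fin_sum M T F a).
apply/(fin_sum_mult_leP mu_support ht pt hausX free _ _ n0) => y e.
have fb := (fin_sum_mult_leP mu_support ht pt hausX free F a n0).1 (lexx _) y e.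
apply: le_trans fb; apply: ler_sum => h _.
have -> : rnorm ((chi h *: a h : A) (t h y) e) = rnorm (chi h *: a h (t h y) e).
  by [].
by rewrite rnormZ [X in X * _](_ : _ = 1) ?mul1r// /rnorm chi1.
Qed.

Lemma mult_character_invariant : character_invariant M T.
Proof.
move=> F a chi [chi1 _].
have -> : \sum_(g <- F) M (a g) * (chi g *: T g) =
    fin_sum M T F (fun g => chi g *: a g).
  apply: eq_bigr => g _.
  exact: etrans (bop_scalerAr _ _ _) (etrans (esym (bop_scalerAl _ _ _))
    (congr1 (fun f => f * T g) (esym (repZ linM _ _)))).
have inv : (fun g => (chi g)^-1 *: (chi g *: a g)) = a.
  apply/funext => g; rewrite scalerA mulVf ?scale1r//.
  by rewrite -normr_eq0 chi1 oner_eq0.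
have chiV1 g : `|(chi g)^-1| = 1 by rewrite normfV chi1 invr1.
have le1 := fin_sum_character_le F a chi1.
have le2 := fin_sum_character_le F (fun g => chi g *: a g) chiV1.
rewrite inv in le2.
have e := le_anti (introT andP (conj le2 le1)).
exact (proj1 (rnorm_normE _ _) e).
Qed.

End isomorphism.

Theorem lemma7p5 (R : realType) (X : ptopologicalType)
    (E : completeNormedModType R[i]) (G : groupType)
    (mu : {sigma_finite_measure set (borel X) -> \bar R}) (t : G -> X -> X) :
  hausdorff_space X -> completely_regular_space X ->
  measure_support mu = [set: X] ->
  (exists e : E, e != 0) ->
  homeo_action t -> preserves_class mu t ->
  topologically_free t ->
  let T := translation_op E mu t in
  let V := reg_op G (L1 mu E) in
  let mul := mult_op E mu in
  let bar := bar_op E mu t in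
  [/\ exists Phi : bop (L1 mu E) (L1 mu E) ->
                   bop (l1fun G (L1 mu E)) (l1fun G (L1 mu E)),
        [/\ isometric_alg_iso (gen_alg mul T) (gen_alg bar V) Phi,
            forall a : cbfun X (bop E E), Phi (mul a) = bar a &
            forall g : G, Phi (T g) = V g],
      property_star mul T,
      property_star_star mul T &
      character_invariant mul T].
Proof.
move=> hausX _ mu_support _ ht pt free /=; split.
- exists (Phi t); split.
  + exact: Phi_iso hausX mu_support ht pt free.
  + exact: Phi_mult hausX mu_support ht pt free.
  + exact: Phi_translation hausX mu_support ht pt free.
- exact: mult_property_star hausX mu_support ht pt free.
- exact: mult_property_star_star hausX mu_support ht pt free.
- exact: mult_character_invariant hausX mu_support ht pt free.
Qed.
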